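(* Let $T\colon X\to X$ be a continuous map on a compact metric space such that the map $\mu\mapsto h_\mu(T)$ is upper semicontinuous, let $\Phi=\{\phi_1,\ldots,\phi_d\}$ be a family of continuous functions $\phi_i\colon X\to\mathbb{R}$, and let $F\colon\mathbb{R}^d\to\mathbb{R}$ be a continuous function. If the pair $(T,\Phi)$ has an abundance of ergodic measures or $F$ is convex, then there exists at least one equilibrium measure for $(F,\Phi)$.
   Context: $\mathcal{M}$ is the set of $T$-invariant Borel probability measures on $X$ with the weak$^*$ topology, $h_\mu(T)$ is the Kolmogorov–Sinai entropy, and $\int_X\Phi\,d\mu=\left(\int_X\phi_1\,d\mu,\ldots,\int_X\phi_d\,d\mu\right)$. The pair $(T,\Phi)$ has an abundance of ergodic measures if for each $\mu\in\mathcal{M}$ and $\epsilon>0$ there exists an ergodic measure $\nu\in\mathcal{M}$ such that $h_\nu(T)\ge h_\mu(T)-\epsilon$ and $\left|\int_X\phi_i\,d\nu-\int_X\phi_i\,d\mu\right|<\epsilon$ for $i=1,\ldots,d$. Let $d$ also denote the metric of $X$. For $n\in\mathbb{N}$ let $d_n(x,y)=\max\{d(T^k(x),T^k(y)):k=0,\ldots,n-1\}$; a set $E\subset X$ is $(n,\epsilon)$-separated if $d_n(x,y)>\epsilon$ for all $x,y\in E$ with $x\ne y$. With $S_n\phi=\sum_{k=0}^{n-1}\phi\circ T^k$, the nonlinear topological pressure of $\Phi$ is $$P_F(\Phi)=\lim_{\epsilon\to0}\limsup_{n\to\infty}\frac1n\log\sup_E\sum_{x\in E}\exp\left[nF\left(\frac{S_n\phi_1(x)}{n},\ldots,\frac{S_n\phi_d(x)}{n}\right)\right],$$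 with the supremum over all $(n,\epsilon)$-separated sets $E$. A measure $\nu\in\mathcal{M}$ is an equilibrium measure for $(F,\Phi)$ (with respect to $T$) if $P_F(\Phi)=h_\nu(T)+F\left(\int_X\Phi\,d\nu\right)$. *)

(* Defs.v *)
From HB Require Import structures.
From mathcomp Require Import all_boot all_order all_algebra.
From mathcomp Require Import all_classical all_reals all_analysis.

Set Implicit Arguments.
Unset Strict Implicit.
Unset Printing Implicit Defensive.

Import Order.TTheory GRing.Theory Num.Theory.
Import numFieldNormedType.Exports.

Local Open Scope classical_set_scope.
Local Open Scope ring_scope.

(* Measurable types are pointed in MathComp-Analysis, so the Borel
   sigma-algebra can only be put on a nonempty metric space.  (On the empty
   space there is no probability measure at all.) *)
#[short(type="pmetricType")]
HB.structure Definition PointedMetric (R : numDomainType) :=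
  { X of Metric R X & Pointed X }.

Section Dynamics.
Context {R : realType} {X : pmetricType R}.

Definition borel := g_sigma_algebraType (@open X).

Definition borel_probability := probability borel R.

(* The coarsest topology for which mu |-> \int f dmu is continuous for every
   continuous f : X -> R. *)
Definition weak_star := initial_topology
  (fun (mu : borel_probability) =>
     (fun f : continuousType X R => \int[mu]_x f x)
       : prod_topology (fun _ : continuousType X R => R)).
HB.instance Definition _ := Topological.on weak_star.

Definition upper_semicontinuous (Y : topologicalType) (f : Y -> \bar R) :=
  lower_semicontinuous (fun y => - f y)%E.

Section Map.
Variable T : X -> X.

Definition invariant_measures : set weak_star :=
  [set mu : borel_probability |
    forall A : set borel, measurable A -> mu (T @^-1` A) = mu A].

Definition ergodic : set weak_star :=
  [set mu : borel_probability | invariant_measures mu /\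
    forall A : set borel, measurable A -> T @^-1` A = A ->
      mu A = 0%E \/ mu A = 1%E].

Definition measurable_partition (m : nat) (P : 'I_m -> set borel) :=
  partition setT P setT /\ forall i, measurable (P i).

(* The cells of the join of P, T^-1 P, ..., T^-(n-1) P, indexed by words of
   length n.  Some of these cells may be empty; they contribute 0 to the
   entropy below. *)
Definition iterated_join (m : nat) (P : 'I_m -> set borel) (n : nat)
    (w : {ffun 'I_n -> 'I_m}) : set borel :=
  [set x | forall k : 'I_n, P (w k) (iter k T x)].

(* [ln 0 = 0] in the library, in accordance with 0 log 0 = 0. *)
Definition shannon_entropy (mu : borel_probability) (I : finType)
    (P : I -> set borel) : R :=
  - \sum_i fine (mu (P i)) * ln (fine (mu (P i))).

Definition partition_entropy (mu : borel_probability) (m : nat)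
    (P : 'I_m -> set borel) : R :=
  lim ((n%:R^-1 * shannon_entropy mu (@iterated_join m P n)) @[n --> \oo]).

Definition KS_entropy (mu : borel_probability) : \bar R :=
  ereal_sup [set h : \bar R | exists (m : nat) (P : 'I_m -> set borel),
    measurable_partition P /\ h = (partition_entropy mu P)%:E].

Definition bowen_dist (n : nat) (x y : X) : R :=
  \big[Num.max/0]_(k < n) mdist (iter k T x) (iter k T y).

Definition dn_separated (n : nat) (e : R) (E : set X) :=
  forall x y, E x -> E y -> x <> y -> e < bowen_dist n x y.

Definition birkhoff_sum (n : nat) (phi : X -> R) (x : X) : R :=
  \sum_(k < n) phi (iter k T x).

Section Potentials.
Variables (d : nat) (Phi : 'I_d -> X -> R).

Definition integral_vec (mu : borel_probability) : 'rV[R]_d :=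
  \row_i \int[mu]_x Phi i x.

Definition abundance_of_ergodic_measures :=
  forall mu, invariant_measures mu -> forall e : R, 0 < e ->
    exists nu, [/\ ergodic nu,
      (KS_entropy mu - e%:E <= KS_entropy nu)%E &
      forall i, `|\int[nu]_x Phi i x - \int[mu]_x Phi i x| < e].

Variable F : 'rV[R]_d -> R.

(* The (n, e)-separated subsets of a compact space are finite; [\esum] avoids
   carrying a finiteness proof. *)
Definition separated_sum (n : nat) (E : set X) : \bar R :=
  (\esum_(x in E)
    (expR (n%:R * F (\row_i (birkhoff_sum n (Phi i) x / n%:R))))%:E)%E.

Definition pressure_at (e : R) : \bar R :=
  limn_esup (fun n : nat => (n%:R^-1)%:E *
    lne (ereal_sup [set separated_sum n E | E in dn_separated n e]))%E.

Definition nonlinear_pressure : \bar R :=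
  lim (pressure_at e @[e --> 0^'+]).

Definition equilibrium_measure (nu : borel_probability) :=
  invariant_measures nu /\
  nonlinear_pressure = (KS_entropy nu + (F (integral_vec nu))%:E)%E.

End Potentials.
End Map.
End Dynamics.

(* Main.v *)
Require Import Defs.
From HB Require Import structures.
From mathcomp Require Import all_boot all_order all_algebra.
From mathcomp Require Import all_classical all_reals all_analysis.
From mathcomp Require Import measurable_realfun ring lra.

(** Write [h] for the entropy and [P] for the pressure.

    Lower bound: [h mu + F (\int Phi dmu) <= P] when [F] is convex or [mu] is
    ergodic.  Take a maximal separated set [E] and a measurable nearest-point map
    [q : X -> E].  Gibbs' inequality for the pair formed by the [n]-itinerary of a
    partition and [q] bounds the entropy of the itinerary plus the [mu]-mean of
    [n F (S_n Phi / n)] at [q x] by the logarithm of the separated sum, up to a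
    small multiple of [n]; Jensen's inequality, respectively the ergodic theorem,
    bounds that mean from below by [n F (\int Phi dmu)].  With an abundance of
    ergodic measures the bound extends to all invariant measures.

    Upper bound: for [c < P], large separated sums and the pigeonhole principle
    give separated sets on which [S_n Phi / n] is almost constant.  An ultrafilter
    limit [mu] of the orbit averages of their uniform measures is invariant by
    almost-invariance of the averages, and the counting argument of Misiurewicz,
    for partitions into cells with null boundary, gives
    [c - eps <= h mu + F (\int Phi dmu)].

    Letting [c] tend to [P], an ultrafilter limit of these measures is an
    equilibrium measure, by upper semicontinuity of [h] and the first bound. *)

Set Implicit Arguments.
Unset Strict Implicit.
Unset Printing Implicit Defensive.

Import Order.TTheory GRing.Theory Num.Theory.
Import numFieldNormedType.Exports.
Local Open Scope classical_set_scope.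
Local Open Scope ring_scope.

(** * Entropy of finite labellings *)

Section FiniteEntropy.
Context {R : realType}.

(** For nonlinear [F] the mean of [F (S_n Phi / n)] need not dominate [F] of the mean when [mu] has
    several ergodic components; this is the obstacle behind the two alternatives of the hypothesis,
    and [subaverage] isolates what each of them supplies. In the upper bound the same nonlinearity
    is met by freezing [S_n Phi / n] on a cell of a grid whose number of cells does not depend on
    [n], at a cost that vanishes after division by [n]. Removing additive constants by passing to
    powers of [T] would not keep ergodicity; instead wrong letters are penalized by [exp (- c1)]
    with [c1] at choice, so that each time step costs arbitrarily little. Limits of measures rest on
    weak-* compactness: along an ultrafilter the integrals converge to a positive normalized
    functional, and Riesz's theorem, obtained from an outer measure defined by covers with
    continuous functions, turns it into a probability. Pressure and entropy are handled as extended
    reals, so comparisons run through real numbers below [P]. *)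

Lemma gibbs (I : finType) (p r : I -> R) :
  (forall i, 0 <= p i) -> (forall i, 0 <= r i) ->
  (forall i, 0 < p i -> 0 < r i) -> \sum_i r i <= \sum_i p i ->
  - (\sum_i p i * ln (p i)) <= - \sum_i p i * ln (r i).
Proof.
move=> p0 r0 pr spr; rewrite lerN2.
suff: \sum_i p i * ln (r i) <= \sum_i (p i * ln (p i) + (r i - p i)).
  rewrite big_split/= sumrB => /le_trans; apply; rewrite gerDl.
  by rewrite subr_le0.
apply: ler_sum => i _; have := p0 i; rewrite le_eqVlt => /predU1P[<-|pi0].
  by rewrite !mul0r add0r subr0.
have ri0 := pr _ pi0.
rewrite -lerBlDl -mulrBr -ln_div ?posrE//.
have : ln (r i / p i) <= r i / p i - 1.
  rewrite -[X in ln X](subrK 1) addrC; apply: le_ln1Dx.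
  by rewrite ltrBrDr addrC subrr divr_gt0.
by move=> /(ler_wpM2l (ltW pi0)); rewrite mulrBr mulr1 mulrCA divff ?mulr1 ?gt_eqF.
Qed.

(** Gibbs' inequality against the weights [q j * k (i, c j)]. Since [k] is only asked to be
    substochastic in [i], it may be the conditional weights of another measure, and [c] lets them
    depend on [j] through a coarser label. *)
Lemma chain_rule_le (I J U : finType) (p : I * J -> R) (c : J -> U)
    (k : I * U -> R) (q : J -> R) :
  (forall j, q j = \sum_i p (i, j)) ->
  (forall x, 0 <= p x) -> (forall x, 0 <= k x) ->
  (forall u, \sum_i k (i, u) <= 1) ->
  (forall x, 0 < p x -> 0 < k (x.1, c x.2)) ->
  - (\sum_x p x * ln (p x)) <=
  - (\sum_j q j * ln (q j)) - \sum_x p x * ln (k (x.1, c x.2)).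
Proof.
move=> qE p0 k0 k1 pk.
have pq x : p x <= q x.2.
  by case: x => i j; rewrite qE (bigD1 i)//= lerDl sumr_ge0.
have q0 j : 0 <= q j by rewrite qE sumr_ge0.
have sp : \sum_x p x = \sum_j q j.
  rewrite (eq_bigr _ (fun j _ => qE j)) exchange_big pair_bigA/=.
  by apply: eq_bigr => -[].
pose r x := q x.2 * k (x.1, c x.2).
have r0 x : 0 <= r x by rewrite mulr_ge0.
have pr x : 0 < p x -> 0 < r x.
  by move=> px; rewrite mulr_gt0 ?pk// (lt_le_trans px).
apply: (le_trans (gibbs p0 r0 pr _)).
  rewrite -(pair_bigA _ (fun i j => r (i, j)))/= exchange_big/=.
  rewrite sp; apply: ler_sum => j _; rewrite /r/= -mulr_sumr.
  by rewrite -[leRHS]mulr1 ler_wpM2l.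
rewrite -opprD lerN2 le_eqVlt; apply/orP; left; apply/eqP/esym.
transitivity (\sum_x (p x * ln (q x.2) + p x * ln (k (x.1, c x.2)))).
  apply: eq_bigr => x _; have := p0 x; rewrite le_eqVlt => /predU1P[<-|px].
    by rewrite !mul0r addr0.
  by rewrite /r lnM ?mulrDr// posrE ?pk// (lt_le_trans px).
rewrite big_split/=; congr (_ + _).
rewrite [RHS](eq_bigr (fun j => \sum_i p (i, j) * ln (q j))).
  by rewrite exchange_big pair_bigA/=; apply: eq_bigr => -[].
by move=> j _; rewrite {1}qE mulr_suml.
Qed.

Lemma entropy_le_ln_card (I : finType) (p : I -> R) : (forall i, 0 <= p i) ->
  \sum_i p i = 1 -> - (\sum_i p i * ln (p i)) <= ln #|I|%:R.
Proof.
move=> p0 p1; have I0 : (0 < #|I|)%N.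
  rewrite lt0n; apply/eqP => I0; move: p1; rewrite big1 => [/eqP|i _].
    by rewrite eq_sym oner_eq0.
  by have := fintype0 i; rewrite I0.
apply: (@le_trans _ _ (- (\sum_i p i * ln (#|I|%:R^-1)))).
  apply: gibbs => // [i _|]; first by rewrite invr_gt0 ltr0n.
  by rewrite p1 sumr_const -[leLHS]mulr_natr mulVf// pnatr_eq0 -lt0n.
by rewrite -mulr_suml p1 mul1r lnV ?opprK// posrE ltr0n.
Qed.

End FiniteEntropy.

(** * Entropy of measurable maps to finite types *)

Section Labels.
Context {R : realType} {X : pmetricType R}.
Notation borelX := (@borel R X).
Notation prob := (@borel_probability R X).
Implicit Types mu : prob.

(** A finite measurable partition is carried by its labelling map. Fibres may be empty, unlike the
    cells of [measurable_partition], so pairs, images and composites with [T] are again labels. *)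
Definition mlabel (K : finType) (f : X -> K) :=
  forall k, measurable (f @^-1` [set k] : set borelX).

Definition law mu (K : finType) (f : X -> K) (k : K) : R :=
  fine (mu (f @^-1` [set k])).

Definition entropy mu (K : finType) (f : X -> K) : R :=
  - \sum_k law mu f k * ln (law mu f k).

Lemma mlabel_preimage (K : finType) (f : X -> K) (A : set K) :
  mlabel f -> measurable (f @^-1` A : set borelX).
Proof.
move=> mf; have -> : f @^-1` A = \big[setU/set0]_(k | k \in A) f @^-1` [set k].
  apply/seteqP; split => x/=.
    by move=> Ax; rewrite (bigD1 (f x)) ?inE//=; left.
  by rewrite -bigcup_seq_cond/= => -[k/= /andP[_]]; rewrite inE => Ak ->.
by apply: bigsetU_measurable => k _; exact: mf.
Qed.

Lemma mlabel_comp (K L : finType) (f : X -> K) (g : K -> L) :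
  mlabel f -> mlabel (g \o f).
Proof. by move=> mf l; rewrite comp_preimage; exact: mlabel_preimage. Qed.

Lemma mlabel_pair (K L : finType) (f : X -> K) (g : X -> L) :
  mlabel f -> mlabel g -> mlabel (fun x => (f x, g x)).
Proof.
move=> mf mg [k l].
rewrite [X in measurable X](_ : _ = f @^-1` [set k] `&` g @^-1` [set l]).
  exact: measurableI.
by apply/seteqP; split => x/= [-> ->].
Qed.

Lemma mlabel_bool (A : set borelX) : measurable A -> mlabel (fun x => `[< A x >]).
Proof.
move=> mA [].
  rewrite [X in measurable X](_ : _ = A)//.
  by apply/seteqP; split => x/= /asboolP.
rewrite [X in measurable X](_ : _ = ~` A); first exact: measurableC.
by apply/seteqP; split => x/= => [/negbT/asboolPn|/asboolPn/negbTE].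
Qed.

Lemma law_ge0 mu (K : finType) (f : X -> K) k : 0 <= law mu f k.
Proof. exact: fine_ge0. Qed.

Lemma fine_prob_sum mu (K : finType) (F : K -> set borelX) (P : pred K) :
  (forall k, measurable (F k)) -> trivIset setT F ->
  fine (mu (\big[setU/set0]_(k | P k) F k)) = \sum_(k | P k) fine (mu (F k)).
Proof.
move=> mF tF; elim: (index_enum K) (index_enum_uniq K) => [|k s ih]/=.
  by move=> _; rewrite !big_nil measure0.
move=> /andP[ks us]; rewrite !big_cons; case: ifP => Pk; last exact: ih.
have mS : measurable (\big[setU/set0]_(j <- s | P j) F j).
  by apply: bigsetU_measurable => ? _; exact: mF.
rewrite measureU//; first by rewrite fineD ?fin_num_measure// ih.
apply/eqP/negPn/negP => /set0P[x [Fkx]].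
rewrite -bigcup_seq_cond => -[j/= /andP[js Pj] Fjx].
move: ks; rewrite (_ : k = j) ?js//.
by apply: tF => //; exists x.
Qed.

Lemma law_comp mu (K L : finType) (f : X -> K) (g : K -> L) l : mlabel f ->
  law mu (g \o f) l = \sum_(k | g k == l) law mu f k.
Proof.
move=> mf; rewrite /law -fine_prob_sum//; last first.
  by move=> k k' _ _ [x/= [<- <-]].
congr (fine (mu _)); apply/seteqP; split => x/=.
  by move=> gx; rewrite (bigD1 (f x)) ?gx//=; left.
by rewrite -bigcup_seq_cond/= => -[k/= /andP[_ /eqP <-]] ->.
Qed.

Lemma law_sum1 mu (K : finType) (f : X -> K) : mlabel f ->
  \sum_k law mu f k = 1.
Proof.
move=> mf; have := @law_comp mu _ unit f (fun=> tt) tt mf.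
rewrite (eq_bigl xpredT)// => <-.
rewrite /law (_ : _ @^-1` _ = setT) ?probability_setT//.
by apply/seteqP; split.
Qed.

Lemma law_le1 mu (K : finType) (f : X -> K) k : mlabel f -> law mu f k <= 1.
Proof.
by move=> mf; rewrite -(law_sum1 mu mf) (bigD1 k)//= lerDl sumr_ge0// => *;
  exact: law_ge0.
Qed.

Lemma entropy_comp_inj mu (K L : finType) (f : X -> K) (g : K -> L) :
  injective g -> mlabel f -> entropy mu (g \o f) = entropy mu f.
Proof.
move=> gi mf; rewrite /entropy; congr (- _).
transitivity (\sum_l \sum_(k | g k == l) law mu f k * ln (law mu f k)).
  apply: eq_bigr => l _; rewrite law_comp//.
  have [[k kl]|nl] := pselect (exists k, g k = l); last first.
    rewrite !big_pred0 ?mul0r// => k; apply/negP => /eqP kl; apply: nl;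
    by exists k.
  by rewrite -kl !(big_pred1 k)// => k' /=; rewrite (inj_eq gi).
by rewrite [RHS](partition_big g xpredT).
Qed.

Lemma law_le_comp mu (K L : finType) (f : X -> K) (g : K -> L) k :
  mlabel f -> law mu f k <= law mu (g \o f) (g k).
Proof.
move=> mf; rewrite law_comp// (bigD1 k)//= lerDl sumr_ge0// => *.
exact: law_ge0.
Qed.

Lemma entropy_comp_le mu (K L : finType) (f : X -> K) (g : K -> L) :
  mlabel f -> entropy mu (g \o f) <= entropy mu f.
Proof.
move=> mf; rewrite lerN2 [leRHS](_ : _ =
    \sum_l \sum_(k | g k == l) law mu f k * ln (law mu (g \o f) l)).
  rewrite (partition_big g xpredT)//=; apply: ler_sum => l _.
  apply: ler_sum => k /eqP <-.
  have := law_ge0 mu f k; rewrite le_eqVlt => /predU1P[<-|l0].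
    by rewrite !mul0r.
  rewrite ler_wpM2l ?law_ge0// ler_ln ?posrE ?law_le_comp//.
  by rewrite (lt_le_trans l0)// law_le_comp.
by apply: eq_bigr => l _; rewrite {1}law_comp// mulr_suml.
Qed.

Lemma entropy_le_ln mu (K : finType) (f : X -> K) : mlabel f ->
  entropy mu f <= ln #|K|%:R.
Proof.
by move=> mf; apply: entropy_le_ln_card (law_sum1 mu mf) => k; exact: law_ge0.
Qed.

Lemma entropy_ge0 mu (K : finType) (f : X -> K) : mlabel f ->
  0 <= entropy mu f.
Proof.
move=> mf; rewrite /entropy -sumrN sumr_ge0// => k _; rewrite -mulrN.
by rewrite mulr_ge0 ?law_ge0// oppr_ge0 ln_le0// law_le1.
Qed.

Lemma law_pair_snd mu (I U : finType) (f : X -> I) (g : X -> U) u :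
  mlabel f -> mlabel g ->
  law mu g u = \sum_i law mu (fun x => (f x, g x)) (i, u).
Proof.
move=> mf mg; rewrite -[g in LHS]/(snd \o (fun x => (f x, g x))).
rewrite law_comp; last exact: mlabel_pair.
transitivity (\sum_i \sum_(u' | u' == u) law mu (fun x => (f x, g x)) (i, u')).
  by rewrite pair_big/=; apply: eq_big => -[].
by apply: eq_bigr => i _; rewrite big_pred1_eq.
Qed.

Lemma entropy_pair_le mu (I J U : finType) (f : X -> I) (g : X -> J)
    (c : J -> U) (k : I * U -> R) :
  mlabel f -> mlabel g -> (forall x, 0 <= k x) ->
  (forall u, \sum_i k (i, u) <= 1) ->
  (forall x, 0 < law mu (fun x => (f x, c (g x))) x -> 0 < k x) ->
  entropy mu (fun x => (f x, g x)) <= entropy mu g -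
    \sum_x law mu (fun x => (f x, c (g x))) x * ln (k x).
Proof.
move=> mf mg k0 k1 lk.
have mfg := mlabel_pair mf mg.
pose h (x : I * J) := (x.1, c x.2).
have lE x : law mu (fun x => (f x, c (g x))) x =
    \sum_(y | h y == x) law mu (fun x => (f x, g x)) y by rewrite -law_comp.
have := @chain_rule_le R I J U (law mu (fun x => (f x, g x))) c k (law mu g).
rewrite -/(entropy mu (fun x => (f x, g x))) -/(entropy mu g).
move=> /(_ _ (law_ge0 mu _) k0 k1); set s1 := \sum_x _; set s2 := \sum_x _.
have -> : s1 = s2.
  rewrite /s1 (partition_big h xpredT)//=; apply: eq_bigr => x _.
  by rewrite lE mulr_suml; apply: eq_bigr => y /eqP <-.
apply.
- by move=> j; exact: law_pair_snd.
- move=> [i j] lij; apply: lk; apply: (lt_le_trans lij).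
  by rewrite lE (bigD1 (i, j))//= lerDl sumr_ge0// => *; exact: law_ge0.
Qed.

(** The conditional weights come from [nu], so the subtracted sum is affine in [mu]. For [nu = mu]
    it is a conditional entropy, by [entropy_condE]. *)
Lemma entropy_pair_le_cond mu nu (I J U : finType) (f : X -> I) (g : X -> J)
    (c : J -> U) :
  mlabel f -> mlabel g ->
  (forall x, 0 < law mu (fun x => (f x, c (g x))) x ->
             0 < law nu (fun x => (f x, c (g x))) x) ->
  entropy mu (fun x => (f x, g x)) <= entropy mu g -
    \sum_x law mu (fun x => (f x, c (g x))) x *
      ln (law nu (fun x => (f x, c (g x))) x / law nu (c \o g) x.2).
Proof.
move=> mf mg munu; have mcg := mlabel_comp c mg.
have mfcg : mlabel (fun x => (f x, c (g x))) by exact: mlabel_pair.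
apply: (@entropy_pair_le mu _ _ _ f g c (fun x =>
  law nu (fun x => (f x, c (g x))) x / law nu (c \o g) x.2)) => //.
- by move=> x; rewrite divr_ge0 ?law_ge0.
- move=> u /=; rewrite -mulr_suml -(law_pair_snd nu (g := c \o g) u mf mcg).
  (* If [nu] does not charge [u], division by 0 makes the weights vanish, and their sum is still at
     most 1. *)
  have [->|?] := eqVneq (law nu (c \o g) u) 0; first by rewrite mul0r.
  by rewrite divff.
- move=> [i u] /munu l0; rewrite divr_gt0//; apply: (lt_le_trans l0).
  by rewrite [leRHS](law_pair_snd nu _ mf mcg) (bigD1 i)//= lerDl sumr_ge0// => *; exact: law_ge0.
Qed.

Lemma entropy_condE mu (I U : finType) (f : X -> I) (g : X -> U) :
  mlabel f -> mlabel g ->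
  - (\sum_x law mu (fun x => (f x, g x)) x *
      ln (law mu (fun x => (f x, g x)) x / law mu g x.2)) =
  entropy mu (fun x => (f x, g x)) - entropy mu g.
Proof.
move=> mf mg; have mfg := mlabel_pair mf mg.
rewrite /entropy opprK addrC -[RHS]opprB; congr (- _).
rewrite [X in _ = _ - X](eq_bigr (fun u =>
   \sum_i law mu (fun x => (f x, g x)) (i, u) * ln (law mu g u))); last first.
  by move=> u _; rewrite {1}(law_pair_snd mu u mf mg) mulr_suml.
rewrite exchange_big pair_bigA/= -sumrB; apply: eq_bigr => -[i u] _ /=.
have := law_ge0 mu (fun x => (f x, g x)) (i, u).
rewrite le_eqVlt => /predU1P[<-|l0]; first by rewrite !mul0r subr0.
rewrite ln_div ?mulrBr// posrE (lt_le_trans l0)//.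
by rewrite [leRHS](law_pair_snd mu _ mf mg) (bigD1 i)//= lerDl sumr_ge0// => *; exact: law_ge0.
Qed.

End Labels.

(** * Itineraries and the entropy of a partition *)

Section Itineraries.
Context {R : realType} {X : pmetricType R}.
Notation borelX := (@borel R X).
Notation prob := (@borel_probability R X).
Implicit Types mu nu : prob.
Variable T : X -> X.
Hypothesis mT : forall A : set borelX, measurable A -> measurable (T @^-1` A : set borelX).

Lemma mlabel_compT (K : finType) (f : X -> K) : mlabel f -> mlabel (f \o T).
Proof. by move=> mf k; rewrite comp_preimage; exact: mT. Qed.

Lemma mlabel_iter (K : finType) (f : X -> K) n :
  mlabel f -> mlabel (f \o iter n T).
Proof.
elim: n f => [|n ih] f mf //=.
have -> : f \o iter n.+1 T = (f \o iter n T) \o T.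
  by apply/funext => x/=; rewrite -iterS iterSr.
by have := mlabel_compT (ih f mf).
Qed.

Lemma law_iter mu (K : finType) (f : X -> K) n : invariant_measures T mu ->
  mlabel f -> law mu (f \o iter n T) = law mu f.
Proof.
move=> imu; elim: n f => [|n ih] f mf //=.
rewrite -[RHS]ih//; apply/funext => k; rewrite /law -(imu _ (mlabel_iter n mf k)); congr (fine (mu _)).
by apply/seteqP; split => x/=; rewrite -iterS iterSr.
Qed.

Section Itin.
Variables (m : nat) (l : X -> 'I_m).
Hypothesis ml : mlabel l.

Definition itin n (x : X) : {ffun 'I_n -> 'I_m} := [ffun k : 'I_n => l (iter k T x)].

Definition word_split n (w : {ffun 'I_n.+1 -> 'I_m}) : 'I_m * {ffun 'I_n -> 'I_m} :=
  (w ord0, [ffun k => w (lift ord0 k)]).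

Lemma word_split_inj n : injective (@word_split n).
Proof.
move=> v w [v0 /ffunP vw]; apply/ffunP => k.
case: (unliftP ord0 k) => [j|] -> //.
by have := vw j; rewrite !ffunE.
Qed.

(** The letter [l point] fills the positions from [n] on; none is read when [q <= n]. *)
Definition word_prefix q n (w : {ffun 'I_n -> 'I_m}) : {ffun 'I_q -> 'I_m} :=
  [ffun k : 'I_q => if insub (k : nat) is Some j then w j else l point].

Lemma word_split_itin n : @word_split n \o itin n.+1 = fun x => (l x, itin n (T x)).
Proof.
apply/funext => x; rewrite /word_split/= ffunE/=; congr pair.
by apply/ffunP => k; rewrite !ffunE lift0 iterSr.
Qed.

Lemma word_prefix_itin q n : (q <= n)%N -> @word_prefix q n \o itin n = itin q.
Proof.
move=> qn; apply/funext => x; apply/ffunP => k; rewrite !ffunE.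
case: insubP => [j _ jk|]; last by rewrite (leq_trans (ltn_ord k) qn).
by rewrite ffunE jk.
Qed.

Lemma mlabel_itin n : mlabel (itin n).
Proof.
elim: n => [|n ih] w.
  rewrite (_ : _ @^-1` _ = setT)//; apply/seteqP; split => x//= _.
  by apply/ffunP => -[].
rewrite (_ : _ @^-1` _ = (@word_split n \o itin n.+1) @^-1` [set word_split w]).
  rewrite word_split_itin; apply: mlabel_pair => //.
  by have := mlabel_compT ih.
by apply/seteqP; split => x /= => [->//|/word_split_inj].
Qed.

Lemma entropy_itinS mu n :
  entropy mu (itin n.+1) = entropy mu (fun x => (l x, itin n (T x))).
Proof.
by rewrite -word_split_itin (entropy_comp_inj mu (@word_split_inj n) (@mlabel_itin n.+1)).
Qed.

Lemma entropy_itinT mu n : invariant_measures T mu ->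
  entropy mu (itin n \o T) = entropy mu (itin n).
Proof.
by move=> imu; rewrite /entropy (law_iter 1 imu (@mlabel_itin n)).
Qed.

(** The first letter is conditioned on the next [q] letters only, so the cost of removing it from a
    word involves [q] but not the length [n]. *)
Lemma entropy_itin_step mu nu q n : (q <= n)%N ->
  (forall x, 0 < law mu (fun x => (l x, itin q (T x))) x ->
             0 < law nu (fun x => (l x, itin q (T x))) x) ->
  entropy mu (itin n.+1) <= entropy mu (itin n \o T) -
    \sum_x law mu (fun x => (l x, itin q (T x))) x *
      ln (law nu (fun x => (l x, itin q (T x))) x / law nu (itin q \o T) x.2).
Proof.
move=> qn munu; have cE := word_prefix_itin qn.
have -> : itin q \o T = @word_prefix q n \o (itin n \o T) by rewrite compA cE.
have eE : (fun x => (l x, itin q (T x))) =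
    (fun x => (l x, word_prefix q ((itin n \o T) x))).
  by apply/funext => x /=; rewrite -cE.
rewrite entropy_itinS; move: munu; rewrite eE => munu.
apply: (@entropy_pair_le_cond R X mu nu) => //.
by have := mlabel_compT (@mlabel_itin n).
Qed.

(** For invariant [mu], the conditional entropy of the first letter given the next [n]. *)
Definition entropy_incr mu n := entropy mu (itin n.+1) - entropy mu (itin n).

(** The case [nu = mu] of [entropy_itin_step]: conditioning the first letter on [n] letters instead
    of [n.+1] can only raise its entropy. *)
Lemma entropy_incr_noninc mu : invariant_measures T mu ->
  nonincreasing_seq (entropy_incr mu).
Proof.
move=> imu; apply/nonincreasing_seqP => n; rewrite /entropy_incr.
have /= := @entropy_itin_step mu mu n n.+1 (leqnSn n) (fun x h => h).
rewrite (@entropy_condE R X mu _ _ l (itin n \o T))//; last first.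
  by have := mlabel_compT (@mlabel_itin n).
rewrite /= -entropy_itinS !entropy_itinT//; lra.
Qed.

Lemma entropy_itin0 mu : entropy mu (itin 0) = 0.
Proof.
have := entropy_le_ln mu (@mlabel_itin 0); have := entropy_ge0 mu (@mlabel_itin 0).
by rewrite card_ffun !card_ord expn0 ln1 => *; apply/eqP; rewrite eq_le; apply/andP.
Qed.

Lemma entropy_itin_sum mu n : entropy mu (itin n) = series (entropy_incr mu) n.
Proof.
by rewrite seriesEnat/= telescope_sumr// entropy_itin0 subr0.
Qed.

Lemma entropy_incr_ge0 mu n : invariant_measures T mu -> 0 <= entropy_incr mu n.
Proof.
move=> imu; rewrite subr_ge0 -(entropy_itinT n imu) entropy_itinS.
rewrite -[itin n \o T]/(snd \o (fun x => (l x, itin n (T x)))).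
apply: entropy_comp_le; apply: mlabel_pair => //.
by have := mlabel_compT (@mlabel_itin n).
Qed.

Lemma cvg_entropy_incr mu : invariant_measures T mu -> cvgn (entropy_incr mu).
Proof.
move=> imu; apply: nonincreasing_is_cvgn; first exact: entropy_incr_noninc.
by exists 0 => _ [n _ <-]; exact: entropy_incr_ge0.
Qed.

(** The normalized entropies are the Cesaro means of the increments, which converge by monotonicity;
    this takes the place of a subadditivity argument. *)
Lemma cvg_entropy_itin mu : invariant_measures T mu ->
  n%:R^-1 * entropy mu (itin n) @[n --> \oo] --> limn (entropy_incr mu).
Proof.
move=> imu; rewrite -cvg_shiftS/=.
have /cesaro := cvg_entropy_incr imu.
apply: cvg_trans; apply: near_eq_cvg; apply: nearW => n /=.
by rewrite entropy_itin_sum.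
Qed.

End Itin.

Lemma partition_label m (P : 'I_m -> set borelX) : measurable_partition P ->
  exists l : X -> 'I_m, mlabel l /\ forall i, P i = l @^-1` [set i].
Proof.
move=> [[PT tP _] mP].
have /choice[l lP] : forall x : X, exists i, P i x.
  by move=> x; have : [set: borelX] x by []; rewrite -PT => -[i _ Pix]; exists i.
have lE i : P i = l @^-1` [set i].
  apply/seteqP; split => x/=; last by move=> <-.
  by move=> Pix; apply: tP => //; exists x.
exists l; split => // i; rewrite -lE; exact: mP.
Qed.

Lemma shannon_itin mu m (P : 'I_m -> set borelX) (l : X -> 'I_m) n :
  (forall i, P i = l @^-1` [set i]) ->
  shannon_entropy mu (@iterated_join R X T m P n) = entropy mu (itin l n).
Proof.
move=> lE; rewrite /shannon_entropy /entropy; congr (- _).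
apply: eq_bigr => w _; rewrite /law.
rewrite (_ : iterated_join T P w = itin l n @^-1` [set w])//.
apply/seteqP; split => x/=.
  by move=> xw; apply/ffunP => k; have := xw k; rewrite lE ffunE.
by move=> <- k; rewrite lE ffunE.
Qed.

Lemma partition_entropyE mu m (P : 'I_m -> set borelX) (l : X -> 'I_m) :
  invariant_measures T mu -> mlabel l -> (forall i, P i = l @^-1` [set i]) ->
  partition_entropy T mu P = limn (entropy_incr l mu).
Proof.
move=> imu ml lE; apply/cvg_lim => //.
under eq_fun do rewrite (shannon_itin mu _ lE).
exact: cvg_entropy_itin.
Qed.

Lemma partition_entropy_cvg mu m (P : 'I_m -> set borelX) (l : X -> 'I_m) :
  invariant_measures T mu -> mlabel l -> (forall i, P i = l @^-1` [set i]) ->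
  n%:R^-1 * entropy mu (itin l n) @[n --> \oo] --> partition_entropy T mu P.
Proof.
by move=> imu ml lE; rewrite (partition_entropyE imu ml lE); exact: cvg_entropy_itin.
Qed.

End Itineraries.

(** * Integration of bounded Borel functions *)

Section BoundedMeasurable.
Context {R : realType} {X : pmetricType R}.
Notation borelX := (@borel R X).
Notation prob := (@borel_probability R X).
Implicit Types (mu : prob) (f g : X -> R).

(** Bounded Borel functions are integrable for every probability, so their integrals are real and
    linear without further side conditions. *)
Definition bmeas f :=
  measurable_fun [set: borelX] (f : borelX -> R) /\ exists M, forall x, `|f x| <= M.

Lemma bmeas_integrable mu f : bmeas f -> mu.-integrable setT (EFin \o (f : borelX -> R)).
Proof.
move=> [mf [M fM]]; apply: measurable_bounded_integrable => //.
  by rewrite (le_lt_trans (probability_le1 mu measurableT)) ?ltry.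
by exists M; split; rewrite ?num_real// => y My x _; exact: le_trans (fM x) (ltW My).
Qed.

Lemma bmeas_cst c : bmeas (fun=> c).
Proof. by split; [exact: measurable_cst|exists `|c|]. Qed.

Lemma bmeasD f g : bmeas f -> bmeas g -> bmeas (fun x => f x + g x).
Proof.
move=> [mf [M fM]] [mg [N gN]]; split; first exact: measurable_funD.
by exists (M + N) => x; rewrite (le_trans (ler_normD _ _))// lerD.
Qed.

Lemma bmeasM f g : bmeas f -> bmeas g -> bmeas (fun x => f x * g x).
Proof.
move=> [mf [M fM]] [mg [N gN]]; split; first exact: measurable_funM.
by exists (M * N) => x; rewrite normrM ler_pM.
Qed.

Lemma bmeasZ c f : bmeas f -> bmeas (fun x => c * f x).
Proof. by move=> bf; apply: bmeasM => //; exact: bmeas_cst. Qed.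

Lemma bmeasB f g : bmeas f -> bmeas g -> bmeas (fun x => f x - g x).
Proof.
move=> bf bg; apply: bmeasD => //.
have -> : (fun x => - g x) = (fun x => -1 * g x) by apply/funext => x; rewrite mulN1r.
exact: bmeasZ.
Qed.

Lemma bmeas_sum (I : Type) (s : seq I) (P : pred I) (F : I -> X -> R) :
  (forall i, P i -> bmeas (F i)) -> bmeas (fun x => \sum_(i <- s | P i) F i x).
Proof.
move=> bF; elim: s => [|i s ih].
  by under eq_fun do rewrite big_nil; exact: bmeas_cst.
under eq_fun do rewrite big_cons.
by case: (boolP (P i)) => [Pi|_]//; apply: bmeasD => //; exact: bF.
Qed.

Lemma bmeas_indic (A : set borelX) : measurable A -> bmeas (\1_A : X -> R).
Proof.
move=> mA; split; first exact: measurable_indic.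
exists 1 => x; rewrite indicE; by case: (x \in A); rewrite ?normr1 ?normr0.
Qed.

Lemma integral_indicE mu (A : set borelX) : measurable A ->
  \int[mu]_x (\1_A x : R) = fine (mu A).
Proof. by move=> mA; rewrite /Rintegral integral_indic// setIT. Qed.

Lemma Rint_ext mu f g : f =1 g -> \int[mu]_x f x = \int[mu]_x g x.
Proof. by move=> fg; apply: eq_Rintegral => x _; exact: fg. Qed.

Lemma RintD mu f g : bmeas f -> bmeas g ->
  \int[mu]_x (f x + g x) = \int[mu]_x f x + \int[mu]_x g x.
Proof. by move=> ? ?; rewrite RintegralD//; exact: bmeas_integrable. Qed.

Lemma RintB mu f g : bmeas f -> bmeas g ->
  \int[mu]_x (f x - g x) = \int[mu]_x f x - \int[mu]_x g x.
Proof. by move=> ? ?; rewrite RintegralB//; exact: bmeas_integrable. Qed.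

Lemma RintZ mu c f : bmeas f -> \int[mu]_x (c * f x) = c * \int[mu]_x f x.
Proof. by move=> ?; rewrite RintegralZl//; exact: bmeas_integrable. Qed.

Lemma Rint_cst mu c : \int[mu]_x c = c.
Proof. by rewrite Rintegral_cst// [X in fine X](probability_setT mu) mulr1. Qed.

Lemma Rint_le mu f g : bmeas f -> bmeas g -> (forall x, f x <= g x) ->
  \int[mu]_x f x <= \int[mu]_x g x.
Proof. by move=> ? ? fg; apply: le_Rintegral => //; exact: bmeas_integrable. Qed.

Lemma Rint_ge0 mu f : (forall x, 0 <= f x) -> 0 <= \int[mu]_x f x.
Proof. by move=> f0; exact: Rintegral_ge0. Qed.

Lemma Rint_sum mu (I : Type) (s : seq I) (P : pred I) (F : I -> X -> R) :
  (forall i, P i -> bmeas (F i)) ->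
  \int[mu]_x (\sum_(i <- s | P i) F i x) = \sum_(i <- s | P i) \int[mu]_x F i x.
Proof.
move=> bF; elim: s => [|i s ih].
  by under eq_Rintegral do rewrite big_nil; rewrite Rint_cst big_nil.
under eq_Rintegral do rewrite big_cons.
rewrite big_cons; case: (boolP (P i)) => [Pi|_]//.
by rewrite RintD ?ih//; [exact: bF|exact: bmeas_sum].
Qed.

End BoundedMeasurable.

(** * Continuous functions and Borel sets *)

Section Continuous.
Context {R : realType} {X : pmetricType R}.
Notation borelX := (@borel R X).
Notation prob := (@borel_probability R X).
Implicit Types (mu : prob) (f g : X -> R).

Lemma open_borel (A : set X) : open A -> measurable (A : set borelX).
Proof. exact: sub_sigma_algebra. Qed.

Lemma closed_borel (A : set X) : closed A -> measurable (A : set borelX).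
Proof. by rewrite -openC => /open_borel/measurableC; rewrite setCK. Qed.

Lemma continuous_borel (T : X -> X) : continuous T ->
  forall A : set borelX, measurable A -> measurable (T @^-1` A : set borelX).
Proof.
move=> cT A mA; rewrite -[X in measurable X]setTI.
have : measurable_fun [set: borelX] (T : borelX -> borelX); last exact.
apply: (@measurability _ _ borelX borelX setT T (@open X) erefl) => _ [B oB <-].
by rewrite setTI; apply: open_borel; apply: open_comp => // x _; exact: cT.
Qed.

Lemma continuous_mfun f : continuous f -> measurable_fun [set: borelX] (f : borelX -> R).
Proof.
move=> cf; apply: (measurability _ (RGenOpens.measurableE R)) => _ [_ [a [b ->]] <-].
rewrite setTI; apply: open_borel; apply: open_comp; last exact: interval_open.
by move=> x _; exact: cf.
Qed.

Lemma continuous_bounded f : compact [set: X] -> continuous f ->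
  exists2 M, 0 < M & forall x, `|f x| <= M.
Proof.
move=> cX cf; have := @continuous_compact _ _ f setT (continuous_subspaceT cf) cX.
move=> /compact_bounded[M [_ MP]]; exists (`|M| + 1); first by rewrite ltr_wpDl.
by move=> x; apply: MP; [rewrite (le_lt_trans (ler_norm _))// ltrDl|exists x].
Qed.

Lemma continuous_bmeas f : compact [set: X] -> continuous f -> bmeas f.
Proof.
move=> cX cf; split; first exact: continuous_mfun.
by have [M _ fM] := continuous_bounded cX cf; exists M.
Qed.

Lemma lipschitz1_continuous f : (forall x y, f x <= f y + mdist x y) -> continuous f.
Proof.
move=> fl x; apply/cvgrPdist_le => /= e e0.
apply/metricType_numDomainType.nbhs_mdistP; exists e => // y /= /ltW xy.
have := fl x y; have := fl y x; rewrite (metric_sym y x) ler_norml.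
by move=> *; apply/andP; split; lra.
Qed.

Lemma mdist_continuous (x : X) : continuous (mdist x).
Proof.
apply: lipschitz1_continuous => y z.
by rewrite (le_trans (metric_triangle _ z _))// lerD2l metric_sym.
Qed.

(** [phi] is the distance to the complement of [U]. The whole space is treated apart, because the
    infimum would then run over the empty set. *)
Lemma open_positivity (U : set X) : open U ->
  exists phi : X -> R, [/\ continuous phi, forall x, 0 <= phi x &
    U = [set x | 0 < phi x]].
Proof.
move=> oU; have [[z Uz]|UT] := pselect (exists z, ~ U z); last first.
  exists (fun=> 1); split => //; first by move=> x; exact: cvg_cst.
  apply/seteqP; split => x //= _; apply: contrapT => nUx; apply: UT.
  by exists x.
pose S x := [set mdist x y | y in ~` U].
have lS x : has_inf (S x).
  split; first by exists (mdist x z), z.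
  by exists 0 => _ [y _ <-]; exact: mdist_ge0.
exists (fun x => inf (S x)); split.
- apply: lipschitz1_continuous => x y; rewrite -lerBlDr; apply: lb_le_inf.
    exact: (lS y).1.
  move=> _ [w Uw <-]; rewrite lerBlDr; apply: (@le_trans _ _ (mdist x w)).
    by apply: (ge_inf (lS x).2); exists w.
  by rewrite addrC (metric_triangle x y).
- by move=> x; apply: lb_le_inf (lS x).1 _ => _ [y _ <-]; exact: mdist_ge0.
- apply/seteqP; split => x/=.
    move=> Ux; have /metricType_numDomainType.nbhs_mdistP[/= e e0 eU] : nbhs x U by apply: open_nbhs_nbhs.
    apply: (lt_le_trans e0); apply: lb_le_inf (lS x).1 _ => _ [y Uy <-].
    by rewrite leNgt; apply/negP => xy; apply: Uy; exact: eU.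
  apply: contraPP => Ux; apply/negP; rewrite -leNgt.
  by rewrite -(mdistxx x); apply: (ge_inf (lS x).2); exists x.
Qed.

End Continuous.

(** The enumeration [e] is chosen before the family [a], so that one reindexing serves both the
    values of a double family of functions at every point and their images under [L]. *)
Lemma nneseries_flatten {R : realType} : exists e : nat -> nat * nat,
  forall a : nat -> nat -> \bar R, (forall i j, (0 <= a i j)%E) ->
  (\sum_(n <oo) a (e n).1 (e n).2 = \sum_(i <oo) \sum_(j <oo) a i j)%E.
Proof.
have /card_esym/card_set_bijP[e be] := card_nat2.
exists e => a a0; rewrite nneseries_esumT//.
rewrite -(reindex_esum setT setT e (fun p => a p.1 p.2))//.
rewrite nneseries_esumT; last by move=> i; exact: nneseries_ge0.
rewrite [RHS](eq_esum (b := fun i => \esum_(j in setT) a i j)); last first.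
  by move=> i _; rewrite nneseries_esumT.
by rewrite esum_esum//; congr esum; apply/seteqP; split.
Qed.

(** * Riesz representation and weak-* compactness *)

Section Riesz.
Context {R : realType} {X : pmetricType R}.
Notation borelX := (@borel R X).
Notation prob := (@borel_probability R X).
Hypothesis cX : compact [set: X].
Variable L : (X -> R) -> R.
Hypothesis LD : forall f g : X -> R, continuous f -> continuous g ->
  L (fun x => f x + g x) = L f + L g.
Hypothesis LZ : forall (c : R) (f : X -> R), continuous f -> L (fun x => c * f x) = c * L f.
Hypothesis L_ge0 : forall f : X -> R, continuous f -> (forall x, 0 <= f x) -> 0 <= L f.
Hypothesis L_1 : L (fun=> 1) = 1.

Let cst_cont (c : R) : continuous (fun _ : X => c).
Proof. by move=> x; exact: cvg_cst. Qed.

Let add_cont (f g : X -> R) : continuous f -> continuous g ->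
  continuous (fun x => f x + g x).
Proof. by move=> cf cg x; apply: cvgD; [exact: cf|exact: cg]. Qed.

Let mul_cont (f g : X -> R) : continuous f -> continuous g ->
  continuous (fun x => f x * g x).
Proof. by move=> cf cg x; apply: cvgM; [exact: cf|exact: cg]. Qed.

Let opp_cont (f : X -> R) : continuous f -> continuous (fun x => - f x).
Proof. by move=> cf x; apply: cvgN; exact: cf. Qed.

Let L_0 : L (fun=> 0) = 0.
Proof. by have := LZ 0 (@cst_cont 0); under eq_fun do rewrite mul0r; rewrite mul0r. Qed.

Let L_cst c : L (fun=> c) = c.
Proof.
have -> : (fun _ : X => c) = (fun x => c * (fun=> 1) x).
  by apply/funext => x /=; rewrite mulr1.
by rewrite (LZ c (@cst_cont 1)) L_1 mulr1.
Qed.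

Let LB (f g : X -> R) : continuous f -> continuous g -> L (fun x => f x - g x) = L f - L g.
Proof.
move=> cf cg; rewrite LD//; last exact: opp_cont.
congr (_ + _); rewrite -mulN1r -LZ//; congr L.
by apply/funext => x; rewrite mulN1r.
Qed.

Let L_le (f g : X -> R) : continuous f -> continuous g -> (forall x, f x <= g x) -> L f <= L g.
Proof.
move=> cf cg fg; rewrite -subr_ge0 -LB//; apply: L_ge0.
  by apply: add_cont => //; exact: opp_cont.
by move=> x; rewrite subr_ge0.
Qed.

Let sum_cont (F : nat -> X -> R) n : (forall i, continuous (F i)) ->
  continuous (fun x => \sum_(0 <= i < n) F i x).
Proof.
move=> cF; elim: n => [|n ih].
  by under eq_fun do rewrite big_geq//; exact: cst_cont.
by under eq_fun do rewrite big_nat_recr//=; exact: add_cont.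
Qed.

Let L_sum (F : nat -> X -> R) n : (forall i, continuous (F i)) ->
  L (fun x => \sum_(0 <= i < n) F i x) = \sum_(0 <= i < n) L (F i).
Proof.
move=> cF; elim: n => [|n ih].
  by under eq_fun do rewrite big_geq//; rewrite big_geq.
under eq_fun do rewrite big_nat_recr//=.
by rewrite LD ?ih ?big_nat_recr//; exact: sum_cont.
Qed.

Local Open Scope ereal_scope.

Definition fcover (A : set X) (f : nat -> X -> R) :=
  [/\ forall n, continuous (f n), forall n x, (0 <= f n x)%R &
      forall x, A x -> 1 <= \sum_(n <oo) (f n x)%:E].

(* The outer measure generated by [L]; since [X] is compact it gives [X] mass
   exactly [L 1 = 1]. *)
Definition daniell (A : set X) : \bar R :=
  ereal_inf [set \sum_(n <oo) (L (f n))%:E | f in fcover A].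

Let Lfc_ge0 A f n : fcover A f -> 0 <= (L (f n))%:E.
Proof. by move=> [cf f0 _]; rewrite lee_fin L_ge0. Qed.

Lemma daniell_ge0 A : 0 <= daniell A.
Proof.
apply: le_ereal_inf_tmp => _ [f fA <-]; apply: nneseries_ge0 => n _ _.
exact: Lfc_ge0 fA.
Qed.

Lemma daniell_le1 A (f : X -> R) : continuous f -> (forall x, 0 <= f x)%R ->
  (forall x, A x -> 1 <= f x)%R -> daniell A <= (L f)%:E.
Proof.
move=> cf f0 fA; pose g (n : nat) := if n is 0%N then f else (fun=> 0%R).
(* The cover is [f] followed by zeros; [h] will be [L] and the evaluations at points. *)
have sumg (h : (X -> R) -> R) : h (fun=> 0%R) = 0%R -> (0 <= h f)%R ->
    \sum_(n <oo) (h (g n))%:E = (h f)%:E.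
  move=> h0 hf0; rewrite nneseries_recl//; last first.
    by move=> [|n] _ /=; rewrite lee_fin// h0.
  by rewrite eseries_cond/= eseries0 ?adde0// => -[|n]//= _ _; rewrite h0.
rewrite -(sumg L)//; last exact: L_ge0.
apply: ereal_inf_lbound; exists g => //; split.
- by case=> [|n]//=; exact: cst_cont.
- by case.
- by move=> x Ax; rewrite (sumg (fun f => f x))// lee_fin fA.
Qed.

Lemma daniell_le2 A (f : nat -> nat -> X -> R) :
  (forall i j, continuous (f i j)) -> (forall i j x, 0 <= f i j x)%R ->
  (forall x, A x -> 1 <= \sum_(i <oo) \sum_(j <oo) (f i j x)%:E) ->
  daniell A <= \sum_(i <oo) \sum_(j <oo) (L (f i j))%:E.
Proof.
move=> cf f0 fA; have [e eP] := @nneseries_flatten R.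
rewrite -eP; last by move=> i j; rewrite lee_fin L_ge0.
apply: ereal_inf_lbound; exists (fun n => f (e n).1 (e n).2) => //; split => //.
move=> x Ax; rewrite (eP (fun i j => (f i j x)%:E)); first exact: fA.
by move=> i j; rewrite lee_fin.
Qed.

Lemma daniell0 : daniell set0 = 0.
Proof.
apply/eqP; rewrite eq_le daniell_ge0 andbT.
have := @daniell_le1 set0 (fun=> 0%R) (@cst_cont 0%R); rewrite L_0; by apply.
Qed.

Lemma le_daniell : {homo daniell : A B / A `<=` B >-> A <= B}.
Proof.
move=> A B AB; apply: ereal_inf_le_tmp => _ [f [cf f0 fB] <-]; exists f => //.
by split => // x /AB; exact: fB.
Qed.

Lemma daniell_sigma_subadditive : sigma_subadditive daniell.
Proof.
move=> A; have [[i ioo]|] := pselect (exists i, daniell (A i) = +oo).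
  rewrite (eseries_pinfty _ _ ioo) ?leey// => n _.
  by rewrite -ltNye (lt_le_trans _ (daniell_ge0 _)).
rewrite -forallNE => Aoo.
apply/lee_addgt0Pr => _/posnumP[e].
rewrite (le_trans _ (epsilon_trick _ _ _))//; last first.
  by move=> n; exact: daniell_ge0.
have /choice[f fP] : forall n, exists f, fcover (A n) f /\
    \sum_(k <oo) (L (f k))%:E <= daniell (A n) + (e%:num / (2 ^ n.+1)%:R)%:E.
  move=> n; have fin : daniell (A n) \is a fin_num.
    by rewrite ge0_fin_numE ?daniell_ge0// lt_neqAle leey andbT; exact/eqP/Aoo.
  have en1 : (0 < e%:num / (2 ^ n.+1)%:R)%R by [].
  have [_ [f fA <-] /ltW ?] := lb_ereal_inf_adherent en1 fin.
  by exists f.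
apply: (@le_trans _ _ (\sum_(i <oo) \sum_(j <oo) (L (f i j))%:E)).
  apply: daniell_le2.
  - by move=> i j; have [[]] := fP i.
  - by move=> i j x; have [[]] := fP i.
  - move=> x [i _ Aix]; have [[cf f0 /(_ x Aix) h] _] := fP i.
    apply: (le_trans h).
    rewrite [leRHS](@nneseriesD1 _ _ i)//; last first.
      by move=> k _; apply: nneseries_ge0 => j _ _; have [[_ + _] _] := fP k; rewrite lee_fin.
    rewrite leeDl//; apply: nneseries_ge0 => k _ _; apply: nneseries_ge0 => j _ _.
    by have [[_ + _] _] := fP k; rewrite lee_fin.
apply: lee_nneseries.
  by move=> i _ _; apply: nneseries_ge0 => j _ _; exact: Lfc_ge0 (fP i).1.
by move=> i _; exact: (fP i).2.
Qed.

HB.instance Definition _ := isOuterMeasure.Build R X daniell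
  daniell0 daniell_ge0 le_daniell daniell_sigma_subadditive.

(** The truncations [h J] vanish off [U] and increase to its indicator. A cover [f] of [A] splits
    into [f * h J] and [f * (1 - h J)]. The second part covers the points of [A] outside [U]; the
    first, written as a sum of the increments [f * dh j] with [j < J], exhausts as [J] grows a
    double family that covers the points of [A] in [U]. *)
Lemma open_caratheodory (U : set X) : open U -> caratheodory_measurable daniell U.
Proof.
move=> oU; apply: le_caratheodory_measurable => A.
have [phi [cphi phi0 UE]] := open_positivity oU.
pose h (j : nat) x := Num.min 1%R (j%:R * phi x)%R.
have ch j : continuous (h j).
  move=> x; apply: (@continuous_min _ _ (fun=> 1%R) (fun x => j%:R * phi x)%R).
    exact: cst_cont.
  by apply: mul_cont => //; exact: cst_cont.
have h0 x : h 0%N x = 0%R by rewrite /h mul0r minElt ltr10.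
have h_ge0 j x : (0 <= h j x)%R by rewrite le_min ler01 mulr_ge0.
have h_le1 j x : (h j x <= 1)%R by rewrite ge_min lexx.
have hS j x : (h j x <= h j.+1 x)%R.
  by rewrite le_min h_le1/= ge_min ler_wpM2r ?ler_nat ?orbT.
have hU j x : ~ U x -> h j x = 0%R.
  rewrite UE/= => /negP; rewrite -leNgt => phix.
  have -> : h j x = Num.min 1%R 0%R; last by rewrite minElt ltr10.
  by rewrite /h (_ : phi x = 0%R) ?mulr0//; apply/eqP; rewrite eq_le phix phi0.
have h1 x : U x -> exists J, h J x = 1%R.
  rewrite UE/= => phix; exists (Num.truncn (phi x)^-1).+1.
  rewrite /h minElt; case: ltP => // hx; apply/eqP; rewrite eq_le {}hx/=.
  rewrite -ler_pdivrMr// div1r; apply/ltW.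
  by have := truncnS_gt (phi x)^-1.
pose dh j x := (h j.+1 x - h j x)%R.
have cdh j : continuous (dh j).
  by apply: add_cont => //; apply: opp_cont.
have dh0 j x : (0 <= dh j x)%R by rewrite subr_ge0.
have dhE J x : (\sum_(0 <= j < J) dh j x = h J x)%R.
  by rewrite telescope_sumr// h0 subr0.
apply: le_ereal_inf_tmp => _ [f fA <-]; have [cf f0 f1] := fA.
pose c J := \sum_(k <oo) (L (fun x => f k x * h J x)%R)%:E.
have cfh k J : continuous (fun x => f k x * h J x)%R by exact: mul_cont.
have cfdh k J : continuous (fun x => f k x * dh J x)%R by exact: mul_cont.
have c1h J : continuous (fun x => 1 - h J x)%R.
  by apply: add_cont; [exact: cst_cont|exact: opp_cont].
have cf1h k J : continuous (fun x => f k x * (1 - h J x))%R by exact: mul_cont.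
have le1 J : c J + daniell (A `&` ~` U) <= \sum_(k <oo) (L (f k))%:E.
  have -> : \sum_(k <oo) (L (f k))%:E =
      c J + \sum_(k <oo) (L (fun x => f k x * (1 - h J x))%R)%:E.
    rewrite -nneseriesD; last 2 first.
    - by move=> k _ _; rewrite lee_fin L_ge0// => x; rewrite mulr_ge0.
    - by move=> k _ _; rewrite lee_fin L_ge0// => x; rewrite mulr_ge0// subr_ge0.
    apply: eq_eseriesr => k _; rewrite -EFinD -LD//; congr (L _)%:E.
    by apply/funext => x; rewrite -mulrDr addrC subrK mulr1.
  apply: leeD2l; apply: ereal_inf_lbound.
  exists (fun k x => f k x * (1 - h J x))%R => //; split => //.
    by move=> k x; rewrite mulr_ge0// subr_ge0.
  move=> x [Ax Ux]; under eq_eseriesr do rewrite hU// subr0 mulr1.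
  exact: f1.
have le2 : daniell (A `&` U) <= \sum_(j <oo) \sum_(k <oo) (L (fun x => f k x * dh j x)%R)%:E.
  apply: daniell_le2 => //; first by move=> *; rewrite mulr_ge0.
  move=> x [Ax Ux]; have [J hJ] := h1 x Ux.
  apply: (@le_trans _ _ (\sum_(0 <= j < J) \sum_(k <oo) (f k x * dh j x)%:E)); last first.
    apply: nneseries_lim_ge => j _ _; apply: nneseries_ge0 => k _ _.
    by rewrite lee_fin mulr_ge0.
  rewrite -nneseries_sum_nat; last by move=> *; rewrite lee_fin mulr_ge0.
  rewrite (eq_eseriesr (g := fun k => (f k x)%:E)); first exact: f1.
  by move=> k _; rewrite sumEFin -mulr_sumr dhE hJ mulr1.
have cE J : \sum_(0 <= j < J) \sum_(k <oo) (L (fun x => f k x * dh j x)%R)%:E = c J.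
  rewrite -nneseries_sum_nat; last first.
    by move=> *; rewrite lee_fin L_ge0// => x; rewrite mulr_ge0.
  apply: eq_eseriesr => k _; rewrite sumEFin -L_sum//; congr (L _)%:E.
  by apply/funext => x; rewrite -mulr_sumr dhE.
(* The subtraction below needs a finite value; if it is infinite, [le1] makes the sum of the cover
   infinite too. *)
have [doo|dfin] := eqVneq (daniell (A `&` ~` U)) +oo.
  have := le1 0%N; rewrite doo addey ?leye_eq; last first.
    rewrite gt_eqF// (lt_le_trans ltNy0)//; apply: nneseries_ge0 => k _ _.
    by rewrite lee_fin L_ge0// => x; rewrite mulr_ge0.
  by move=> /eqP ->; rewrite leey.
have {}dfin : daniell (A `&` ~` U) \is a fin_num.
  by rewrite ge0_fin_numE ?daniell_ge0// lt_neqAle dfin leey.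
rewrite -leeBrDr//; apply: (le_trans le2); apply: lime_le.
  apply: is_cvg_nneseries => j _ _; apply: nneseries_ge0 => k _ _.
  by rewrite lee_fin L_ge0// => x; rewrite mulr_ge0.
by apply: nearW => J; rewrite cE leeBrDr.
Qed.

(** Compactness enters here: the partial sums of a cover of [X] increase, so one of them exceeds
    [1 - e] everywhere, and applying [L] to that finite sum gives at least [1 - e]. *)
Lemma daniell_setT : daniell [set: X] = 1.
Proof.
apply/eqP; rewrite eq_le; apply/andP; split.
  by rewrite -L_1; apply: daniell_le1 => //; exact: cst_cont.
apply: le_ereal_inf_tmp => _ [f [cf f0 f1] <-].
apply/lee_subgt0Pr => e e0.
have fsum x m n : (m <= n)%N ->
    (\sum_(0 <= k < m) f k x <= \sum_(0 <= k < n) f k x)%R.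
  move=> mn; by rewrite (big_cat_nat (leq0n m) mn)/= lerDl sumr_ge0.
have [N _ /(_ N (leqnn N)) fN] : \forall N \near \oo,
    [set: X] `<=` (fun x => 1 - e < \sum_(0 <= k < N) f k x)%R.
  apply: (compact_near_coveringP _).1 cX _ _ _ _ _ => x _.
  have [N fN] : exists N, (1 - e < \sum_(0 <= k < N) f k x)%R.
    apply: contrapT => /forallNP fN; have := f1 x I; apply/negP; rewrite -ltNge.
    apply: (@le_lt_trans _ _ (1 - e)%:E); last by rewrite lte_fin ltrBlDr ltrDl.
    apply: lime_le; first by apply: is_cvg_nneseries => k _ _; rewrite lee_fin.
    by apply: nearW => N; rewrite sumEFin lee_fin leNgt; exact/negP.
  have := @sum_cont f N cf x => /cvgr_gt/(_ _ fN) xN.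
  exists ([set y | 1 - e < \sum_(0 <= k < N) f k y]%R, [set n | (N <= n)%N]).
    by split => //; exists N.
  by move=> [y n]/= [fNy Nn]; rewrite (lt_le_trans fNy)// fsum.
apply: (@le_trans _ _ (\sum_(0 <= k < N) (L (f k))%:E)); last first.
  by apply: nneseries_lim_ge => k _ _; rewrite lee_fin L_ge0.
rewrite sumEFin -L_sum// -EFinB lee_fin.
rewrite -[leLHS]L_cst; apply: L_le; [exact: cst_cont|exact: sum_cont|].
by move=> x; apply: ltW; exact: (fN x I).
Qed.

Let borel_daniell : set borelX -> \bar R := daniell.

Let borel_daniell_sigma_additive : semi_sigma_additive borel_daniell.
Proof.
have sub (A : set X) : measurable (A : set borelX) -> caratheodory_measurable daniell A.
  move: A; apply: smallest_sub.
    exact: (@sigma_algebra_measurable _ (caratheodory_type daniell)).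
  exact: open_caratheodory.
move=> F mF tF mUF; apply: (@caratheodory_measure_sigma_additive R X daniell) => //.
  by move=> i; exact: sub.
exact: sub.
Qed.

HB.instance Definition _ := isMeasure.Build _ borelX R borel_daniell
  daniell0 daniell_ge0 borel_daniell_sigma_additive.

HB.instance Definition _ := Measure_isProbability.Build _ borelX R borel_daniell
  daniell_setT.

Local Close Scope ereal_scope.

Let nu : prob := borel_daniell.

(** Cut [f] into [N] horizontal slices [h i] of height [1 / N]. A slice lies between [1 / N] times
    the indicators of [S i.+1] and [S i]. The upper bounds control the integral, the lower ones
    control [L f], and the two sums differ by a shift of index, which costs at most [1 / N]. *)
Let integral_le_L01 (f : X -> R) : continuous f ->
  (forall x, 0 <= f x) -> (forall x, f x <= 1) -> \int[nu]_x f x <= L f.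
Proof.
move=> cf f0 f1; apply/ler_addgt0Pr => e e0.
pose n := Num.truncn e^-1; pose N : R := n.+1%:R.
have N0 : 0 < N by rewrite ltr0n.
have Ne : N^-1 <= e.
  by rewrite -[leRHS]invrK lef_pV2 ?posrE ?invr_gt0//; apply/ltW; exact: truncnS_gt.
pose g (i : nat) x := Num.min (f x) (i%:R / N).
pose h (i : nat) x := g i.+1 x - g i x.
have cg i : continuous (g i).
  move=> x; apply: (@continuous_min _ _ f (fun=> i%:R / N)); first exact: cf.
  exact: cst_cont.
have ch i : continuous (h i) by apply: add_cont => //; exact: opp_cont.
have iN i : i%:R / N <= i.+1%:R / N by rewrite ler_pM2r ?invr_gt0// ler_nat.
have iNS i : i.+1%:R / N = i%:R / N + N^-1 by rewrite -natr1 mulrDl mul1r.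
have h0 i x : 0 <= h i x.
  by rewrite subr_ge0 le_min ge_min lexx/= ge_min iN orbT.
have fE x : f x = \sum_(0 <= i < n.+1) h i x.
  rewrite telescope_sumr// /g mul0r divff ?gt_eqF// (min_idPl (f1 x)).
  by rewrite (min_idPr (f0 x)) subr0.
pose S (i : nat) : set borelX := [set x | i%:R / N <= f x].
have mS i : measurable (S i).
  rewrite [S i](_ : _ = (f : borelX -> R) @^-1` [set y | i%:R / N <= y]); last by [].
  have := continuous_mfun cf measurableT; move=> /(_ `[i%:R / N, +oo[%classic).
  rewrite setTI; have -> : `[i%:R / N, +oo[%classic = [set y | i%:R / N <= y].
    by apply/seteqP; split => y/=; rewrite in_itv/= andbT.
  by apply; rewrite -(_ : `[i%:R / N, +oo[%classic = [set y | i%:R / N <= y]) //;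
    apply/seteqP; split => y/=; rewrite in_itv/= andbT.
have SL i : N^-1 * fine (nu (S i.+1)) <= L (h i).
  rewrite ler_pdivrMl//.
  have cNh : continuous (fun x => N * h i x) by apply: mul_cont => //; exact: cst_cont.
  rewrite -LZ// -lee_fin fineK ?fin_num_measure//; apply: daniell_le1 => //.
    by move=> x; rewrite mulr_ge0// ltW.
  move=> x; rewrite /S/= => Sx; rewrite -ler_pdivrMl// mulr1.
  rewrite /h /g (min_idPr Sx) (min_idPr (le_trans (iN i) Sx)) iNS.
  by rewrite addrAC subrr add0r.
have hS i x : h i x <= N^-1 * \1_(S i) x.
  rewrite indicE /h /g; have [Sx|Sx] := leP (i%:R / N) (f x).
    by rewrite mem_set// mulr1 iNS lerBlDr addrC ge_min lexx orbT.
  rewrite memNset/=; last by rewrite /S/=; apply/negP; rewrite -ltNge.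
  by rewrite (min_idPl (le_trans (ltW Sx) (iN i))) subrr mulr0.
under eq_Rintegral do rewrite fE.
rewrite Rint_sum; last by move=> i _; exact: continuous_bmeas.
apply: (@le_trans _ _ (\sum_(0 <= i < n.+1) N^-1 * fine (nu (S i)))).
  apply: ler_sum => i _; rewrite -(integral_indicE nu (mS i)) -(RintZ nu); last exact: bmeas_indic.
  apply: Rint_le => //; first exact: continuous_bmeas.
  by apply: bmeasZ; exact: bmeas_indic.
rewrite big_nat_recl// addrC lerD//.
  rewrite [f](_ : _ = fun x => \sum_(0 <= i < n.+1) h i x); last exact/funext.
  rewrite L_sum// big_nat_recr//= -[leLHS]addr0 lerD//; last exact: L_ge0.
  by apply: ler_sum.
rewrite (le_trans _ Ne)// -[leRHS]mulr1 ler_wpM2l ?invr_ge0 ?(ltW N0)//.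
by rewrite -lee_fin fineK ?fin_num_measure// probability_le1.
Qed.

(** The previous inequality for [g] and for [1 - g] gives equality when [g] has values in [[0, 1]];
    an affine change of values brings every continuous function into that range. *)
Theorem riesz_representation :
  exists mu : prob, forall f, continuous f -> \int[mu]_x f x = L f.
Proof.
exists nu => f cf.
have eq01 (g : X -> R) : continuous g ->
    (forall x, 0 <= g x) -> (forall x, g x <= 1) -> \int[nu]_x g x = L g.
  move=> cg g0 g1; apply/eqP; rewrite eq_le integral_le_L01//=.
  have c1g : continuous (fun x => 1 - g x).
    by apply: add_cont; [exact: cst_cont|exact: opp_cont].
  have := integral_le_L01 c1g; rewrite RintB ?Rint_cst; last 2 first.
    exact: bmeas_cst.
    exact: continuous_bmeas.
  rewrite (LB (@cst_cont 1) cg).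
  rewrite L_1 lerD2l lerN2; apply => x.
    by rewrite subr_ge0.
  by rewrite gerBl.
have [M M0 fM] := continuous_bounded cX cf.
pose g x := (2 * M)^-1 * (f x + M).
have M20 : 0 < 2 * M by rewrite mulr_gt0.
have cfM : continuous (fun x => f x + M) by apply: add_cont => //; exact: cst_cont.
have cg : continuous g by apply: mul_cont => //; exact: cst_cont.
have : \int[nu]_x g x = L g.
  apply: eq01 => // x; have := fM x; rewrite ler_norml => /andP[fM1 fM2].
    by rewrite mulr_ge0 ?invr_ge0 ?(ltW M20)// -lerBlDr sub0r.
  by rewrite ler_pdivrMl// mulr1 mulr_natl mulr2n lerD2r.
rewrite RintZ; last exact: continuous_bmeas.
rewrite RintD; last 2 first.
  exact: continuous_bmeas.
  exact: bmeas_cst.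
rewrite (LZ _ cfM) (LD cf (@cst_cont M)).
rewrite Rint_cst => /mulfI; rewrite invr_eq0 gt_eqF// => /(_ isT).
rewrite L_cst; exact: addIr.
Qed.

End Riesz.

Lemma ultra_bounded_cvg (R : realType) (T : Type) (F : set_system T)
    (g : T -> R) (M : R) : UltraFilter F -> (forall t, `|g t| <= M) ->
  cvg (g @ F).
Proof.
move=> UF gM; have : (g @ F) `[- M, M]%classic.
  have : \forall t \near F, `[- M, M]%classic (g t); last exact.
  by apply: filterE => t /=; rewrite in_itv/= -ler_norml; exact: gM.
move=> /(@segment_compact R (- M) M _ _)[p [_ clp]].
apply/cvg_ex; exists p => V Vp.
have [//|FV] := in_ultra_setVsetC (g @^-1` V) UF.
have : (g @ F) (~` V) by [].
by move=> h; have [x []] := clp _ _ h Vp.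
Qed.

(** * Weak-* convergence and compactness *)

Section WeakStar.
Context {R : realType} {X : pmetricType R}.
Notation prob := (@borel_probability R X).
Implicit Types (mu : prob) (f g : X -> R).

Lemma weak_star_integral_continuous f : continuous f ->
  continuous (fun mu : @weak_star R X => \int[mu]_x f x).
Proof.
move=> cf mu; pose F : continuousType X R := mkcts cf.
pose P : topologicalType := prod_topology (fun _ : continuousType X R => R).
pose G : @weak_star R X -> P :=
  fun mu (f : continuousType X R) => \int[mu]_x f x.
have cG : continuous G by exact: initial_continuous.
have cp : continuous (fun g : P => g F).
  exact: (@proj_continuous (continuousType X R) (fun=> R) F).
exact: (continuous_comp (cG mu) (cp (G mu))).
Qed.

Lemma weak_star_cvg (F : set_system (@weak_star R X)) mu : Filter F ->
  (forall f, continuous f -> (fun nu : @weak_star R X => \int[nu]_x f x) @ F --> \int[mu]_x f x) ->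
  F --> (mu : @weak_star R X).
Proof.
move=> FF Fmu.
pose G (mu : prob) := (fun f : continuousType X R => \int[mu]_x f x)
   : prod_topology (fun _ : continuousType X R => R).
have GF : G @ F --> G mu.
  apply/cvg_sup => f A /= [_ [[B oB <-] Bf] BA].
  apply: (filterS BA); apply: (Fmu f); first exact: cts_fun.
  exact: open_nbhs_nbhs.
move=> A /= [_ [[B oB <-] Bmu] BA].
apply: (filterS BA); apply: GF; exact: open_nbhs_nbhs.
Qed.

Lemma weak_star_compact : compact [set: X] -> compact [set: @weak_star R X].
Proof.
move=> cX; rewrite compact_ultra => F UF _.
pose L f := lim ((fun nu : @weak_star R X => \int[nu]_x f x) @ F).
have Lcvg f : continuous f -> (fun nu : @weak_star R X => \int[nu]_x f x) @ F --> L f.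
  move=> cf; have [M M0 fM] := continuous_bounded cX cf.
  have bf := continuous_bmeas cX cf.
  apply: (@ultra_bounded_cvg _ _ _ _ M) => nu; rewrite ler_norml.
  apply/andP; split.
    rewrite -[leLHS](Rint_cst nu); apply: Rint_le => //; first exact: bmeas_cst.
    by move=> x; have := fM x; rewrite ler_norml => /andP[].
  rewrite -[leRHS](Rint_cst nu M); apply: Rint_le => //; first exact: bmeas_cst.
  by move=> x; have := fM x; rewrite ler_norml => /andP[].
have PF : ProperFilter F by exact: ultra_proper.
have [||||mu muL] := @riesz_representation R X cX L.
- move=> f g cf cg; apply/cvg_lim => //.
  under eq_fun do rewrite (RintD _ (continuous_bmeas cX cf) (continuous_bmeas cX cg)).
  by apply: cvgD; exact: Lcvg.
- move=> c f cf; apply/cvg_lim => //.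
  under eq_fun do rewrite (RintZ _ _ (continuous_bmeas cX cf)).
  by apply: cvgM; [exact: cvg_cst|exact: Lcvg].
- move=> f cf f0; apply: limr_ge; first by apply: cvgP; exact: Lcvg.
  by apply: nearW => nu; exact: Rint_ge0.
- apply/cvg_lim => //; under eq_fun do rewrite Rint_cst; exact: cvg_cst.
exists mu; split => //; apply: weak_star_cvg => f cf.
by rewrite /= muL//; exact: Lcvg.
Qed.

End WeakStar.

Lemma bigcap_setDl (T : Type) (U : set T) (K : nat -> set T) :
  \bigcap_n (U `\` K n) = U `\` \bigcup_n K n.
Proof.
apply/seteqP; split => x.
  by move=> UK; split; [have [] := UK 0%N I|move=> [n _]; have [] := UK n I].
by move=> [Ux Kx] n _; split => // Knx; apply: Kx; exists n.
Qed.

(** * Regularity and uniqueness of Borel probabilities *)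

Section Regularity.
Context {R : realType} {X : pmetricType R}.
Notation borelX := (@borel R X).
Notation prob := (@borel_probability R X).
Implicit Types (mu nu : prob).
Hypothesis cX : compact [set: X].

(** With [phi] positive exactly on [U], the set [K n] is where [phi] is at least [1 / n.+1], and
    [h n] is [n.+1 * phi] cut off at 1. *)
Lemma open_exhaustion (U : set X) : open U ->
  exists K : nat -> set X, exists h : nat -> X -> R,
  [/\ forall n, closed (K n), nondecreasing_seq K, \bigcup_n K n = U &
   forall n, [/\ continuous (h n), forall x, 0 <= h n x <= 1,
     forall x, K n x -> h n x = 1 & forall x, ~ U x -> h n x = 0]].
Proof.
move=> /open_positivity[phi [cphi phi0 UE]].
exists (fun n => phi @^-1` [set y | n.+1%:R^-1 <= y]).
exists (fun n x => Num.min 1 (n.+1%:R * phi x)); split.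
- by move=> n; apply: closed_comp => [x _|]; [exact: cphi|exact: closed_ge].
- move=> m n mn; apply/subsetPset => x /=; apply: le_trans.
  by rewrite lef_pV2 ?posrE// ler_nat.
- rewrite UE; apply/seteqP; split => x/=.
    by move=> [n _]/=; apply: lt_le_trans; rewrite invr_gt0.
  move=> phix; exists (Num.truncn (phi x)^-1) => //=.
  by rewrite -[leRHS]invrK lef_pV2 ?posrE ?invr_gt0//; apply/ltW; exact: truncnS_gt.
- move=> n; split.
  + move=> x; apply: (@continuous_min _ _ (fun=> 1) (fun x => n.+1%:R * phi x)).
      exact: cvg_cst.
    by apply: cvgM; [exact: cvg_cst|exact: cphi].
  + by move=> x; rewrite le_min ler01 mulr_ge0//= ge_min lexx.
  + by move=> x /= Kx; apply/min_idPl; rewrite -ler_pdivrMl// mulr1.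
  + move=> x; rewrite UE/= => /negP; rewrite -leNgt => phix.
    have -> : phi x = 0 by apply/eqP; rewrite eq_le phix phi0.
    by rewrite mulr0 minElt ltr10.
Qed.

(** The integral of [h n] separates the mass [mu (K n)] from the mass [nu U]; then [K n] increases
    to [U]. *)
Lemma integral_le_open mu nu :
  (forall f, continuous f -> \int[mu]_x (f x : R) = \int[nu]_x f x) ->
  forall U, open U -> (mu U <= nu U)%E.
Proof.
move=> munu U oU; have [K [h [cK ndK KU hP]]] := open_exhaustion oU.
have mK n : measurable (K n : set borelX) by exact: closed_borel.
have mU : measurable (U : set borelX) by exact: open_borel.
have muK : (mu \o K) @ \oo --> mu U.
  by rewrite -KU; apply: nondecreasing_cvg_mu => //; rewrite KU.
rewrite -(cvg_lim _ muK)//.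
apply: lime_le.
  apply: ereal_nondecreasing_is_cvgn => m n mn.
  by rewrite le_measure ?inE//; exact/subsetPset/ndK.
apply: nearW => n /=; have [ch h01 h1 h0] := hP n.
rewrite -(fineK (fin_num_measure mu _ (mK n))) -(fineK (fin_num_measure nu _ mU)).
rewrite lee_fin -!integral_indicE//.
apply: (@le_trans _ _ (\int[mu]_x h n x)).
  apply: Rint_le; [exact: bmeas_indic|exact: continuous_bmeas|move=> x].
  rewrite indicE; case: (boolP (x \in K n)) => [/set_mem/h1->//|_].
  by have /andP[] := h01 x.
rewrite munu//; apply: Rint_le; [exact: continuous_bmeas|exact: bmeas_indic|move=> x].
rewrite indicE; case: (boolP (x \in U)) => [_|/negP xU].
  by have /andP[] := h01 x.
by rewrite h0// => Ux; apply: xU; exact/mem_set.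
Qed.

Lemma prob_unique mu nu :
  (forall f, continuous f -> \int[mu]_x (f x : R) = \int[nu]_x f x) ->
  forall A : set borelX, measurable A -> mu A = nu A.
Proof.
move=> munu; have open_eq U : open U -> mu U = nu U.
  move=> oU; apply/eqP; rewrite eq_le (integral_le_open munu)//=.
  by apply: integral_le_open => // f cf; rewrite munu.
apply: (@measure_unique _ R borelX (@open X) (fun=> setT)) => //.
- exact: openI.
- by move=> _; exact: openT.
- by rewrite bigcup_const.
- by move=> n; rewrite [ltLHS]probability_setT ltry.
Qed.

(** The sets with such approximations form a sigma-algebra containing the open sets. In a countable
    union the inner closed sets have to be cut to a finite union to remain closed; half of [e] pays
    for the approximations and continuity from above for the cut. *)
Lemma borel_regular mu (A : set borelX) : measurable A -> forall e : R, 0 < e ->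
  exists K O : set X, [/\ closed K, open O, K `<=` A, A `<=` O &
    (mu (O `\` K) < e%:E)%E].
Proof.
pose reg (A : set borelX) := forall e : R, 0 < e ->
  exists K O : set X, [/\ closed K, open O, K `<=` A, A `<=` O &
    (mu (O `\` K) < e%:E)%E].
suff : (measurable : set (set borelX)) `<=` reg by apply.
clear A; apply: smallest_sub; last first.
  move=> U oU e e0; have [K [h [cK ndK KU _]]] := open_exhaustion oU.
  have mK n : measurable (K n : set borelX) by exact: closed_borel.
  have mU : measurable (U : set borelX) by exact: open_borel.
  have : (mu \o (fun n => U `\` K n)) @ \oo --> mu (\bigcap_n (U `\` K n)).
    apply: nonincreasing_cvg_mu.
    - by rewrite ltey_eq fin_num_measure//; exact: measurableD.
    - by move=> n; exact: measurableD.
    - by apply: bigcap_measurable => // n _; exact: measurableD.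
    - by move=> m n mn; apply/subsetPset; apply: setDS; exact/subsetPset/ndK.
  have -> : \bigcap_n (U `\` K n) = set0.
    by rewrite bigcap_setDl KU setDv.
  rewrite measure0 => /fine_cvgP[_ /cvgr_lt/(_ e e0)] [n _ /(_ n (leqnn n))/= Ke].
  exists (K n), U; split => //; first by rewrite -KU; exact: bigcup_sup.
  by rewrite -lte_fin fineK// in Ke; rewrite fin_num_measure//; exact: measurableD.
split.
- move=> e e0; exists set0, set0; split; rewrite ?setD0 ?measure0//.
    exact: closed0.
  exact: open0.
- move=> A rA e /rA[K [V [cK oV KA AV VK]]]; exists (~` V), (~` K); split.
  + exact: open_closedC.
  + exact: closed_openC.
  + by rewrite setTD; apply: subsetC.
  + by rewrite setTD; apply: subsetC.
  + by rewrite setDE setCK setIC -setDE.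
- move=> A rA e e0.
  have e20 : 0 < e / 2 by rewrite divr_gt0.
  have /choice[K /choice[V KV]] : forall n, exists K O : set X,
    [/\ closed K, open O, K `<=` A n, A n `<=` O &
    (mu (O `\` K) < (e / 2 / (2 ^ n.+1)%:R)%:E)%E].
    by move=> n; apply: rA; rewrite divr_gt0// ltr0n expn_gt0.
  have mK n : measurable (K n : set borelX).
    by apply: closed_borel; have [] := KV n.
  have mV n : measurable (V n : set borelX).
    by apply: open_borel; have [] := KV n.
  pose U := \bigcup_n V n; pose L n := \big[setU/set0]_(i < n) K i.
  have oU : open U by apply: bigcup_open => n _; have [] := KV n.
  have mU : measurable (U : set borelX) by exact: open_borel.
  have cL n : closed (L n).
    by apply: closed_bigsetU => i _; have [] := KV i.
  have mL n : measurable (L n : set borelX) by exact: closed_borel.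
  have : (mu \o (fun n => U `\` L n)) @ \oo --> mu (\bigcap_n (U `\` L n)).
    apply: nonincreasing_cvg_mu.
    - by rewrite ltey_eq fin_num_measure//; exact: measurableD.
    - by move=> n; exact: measurableD.
    - by apply: bigcap_measurable => // n _; exact: measurableD.
    - move=> m n mn; apply/subsetPset; apply: setDS.
      exact: subset_bigsetU.
  rewrite bigcap_setDl => muL.
  have UL : (mu (U `\` \bigcup_n L n) < e%:E)%E.
    apply: (@le_lt_trans _ _ (e / 2)%:E); last first.
      by rewrite lte_fin ltr_pdivrMr// ltr_pMr// ltr1n.
    apply: (@le_trans _ _ (\sum_(n <oo) mu (V n `\` K n))%E).
      apply: measure_sigma_subadditive => //.
      + by move=> n; exact: measurableD.
      + by apply: measurableD => //; exact: bigcup_measurable.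
      + move=> x [[n _ Vx] Lx]; exists n => //; split => // Kx; apply: Lx.
        exists n.+1 => //; rewrite /L big_ord_recr/=; right.
        exact: Kx.
    apply: le_trans (epsilon_trick0 xpredT (ltW e20)).
    by apply: lee_nneseries => // n _; apply/ltW; have [] := KV n.
  have ULfin : mu (U `\` \bigcup_n L n) \is a fin_num.
    by rewrite fin_num_measure//; apply: measurableD => //; exact: bigcup_measurable.
  move: muL; rewrite -(fineK ULfin) => /fine_cvgP[_ /cvgr_lt/(_ e)].
  rewrite -lte_fin fineK// => /(_ UL)[n _ /(_ n (leqnn n))/= Le].
  exists (L n), U; split => //.
  + move=> x; rewrite /L -bigcup_seq => -[i/= _ Kx]; exists i => //.
    by have [_ _ + _ _] := KV i; apply.
  + by move=> x [i _ Ax]; exists i => //; have [_ _ _ + _] := KV i; apply.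
  + by rewrite -lte_fin fineK// in Le; rewrite fin_num_measure//; exact: measurableD.
Qed.

End Regularity.

(** * Invariant measures and averages *)

Section Average.
Context {R : realType} {X : pmetricType R}.
Notation borelX := (@borel R X).
Notation prob := (@borel_probability R X).
Variables (nu : nat -> prob) (n : nat).

Let k0 : (0 <= n.+1%:R^-1 :> R). Proof. by rewrite invr_ge0. Qed.

Let average : set borelX -> \bar R := mscale (NngNum k0) (msum nu n.+1).

HB.instance Definition _ := Measure.on average.

Let averageE (A : set borelX) : measurable A ->
  average A = (n.+1%:R^-1 * \sum_(i < n.+1) fine (nu i A))%:E.
Proof.
move=> mA; rewrite /average /mscale/= /msum EFinM -sumEFin; congr (_ * _)%E.
by apply: eq_bigr => i _; rewrite fineK// fin_num_measure.
Qed.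

Let average1 : average setT = 1%E.
Proof.
rewrite averageE//; under eq_bigr do rewrite probability_setT.
by rewrite sumr_const card_ord mulVf.
Qed.

HB.instance Definition _ := Measure_isProbability.Build _ _ _ average average1.

Lemma average_prob : exists rho : prob,
  (forall A : set borelX, measurable A ->
     fine (rho A) = n.+1%:R^-1 * \sum_(i < n.+1) fine (nu i A)) /\
  (forall f : X -> R, bmeas f ->
     \int[rho]_x f x = n.+1%:R^-1 * \sum_(i < n.+1) \int[nu i]_x f x).
Proof.
pose rho : prob := average.
exists rho; split=> [A mA|f bf]; first by rewrite /rho/= averageE.
have [mf [M fM]] := bf.
(* The shift makes the function nonnegative, as the rules for integrals against sums and multiples
   of measures require. *)
pose g x := f x + M.
have bg : bmeas g by apply: bmeasD => //; exact: bmeas_cst.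
have g0 x : 0 <= g x by have := fM x; rewrite ler_norml => /andP[? _]; rewrite /g; lra.
have : \int[rho]_x g x = n.+1%:R^-1 * \sum_(i < n.+1) \int[nu i]_x g x.
  rewrite /Rintegral /rho/= /average ge0_integral_mscale//; last 2 first.
  - by apply/measurable_EFinP; exact: bg.1.
  - by move=> x _; rewrite lee_fin.
  rewrite ge0_integral_measure_sum//; last 2 first.
  - by move=> x _; rewrite lee_fin.
  - by apply/measurable_EFinP; exact: bg.1.
  have intE (i : 'I_n.+1) : (\int[nu i]_x (g x)%:E = (\int[nu i]_x g x)%R%:E)%E.
    by rewrite /Rintegral fineK//; apply: integrable_fin_num => //; exact: bmeas_integrable.
  by rewrite (eq_bigr _ (fun i _ => intE i)) sumEFin -EFinM.
have gE (mu : prob) : \int[mu]_x g x = \int[mu]_x f x + M.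
  by rewrite (RintD mu bf (bmeas_cst M)) Rint_cst.
rewrite gE; under eq_bigr do rewrite gE.
rewrite big_split/= sumr_const card_ord mulrDr -[M *+ _]mulr_natl mulKf//.
by move/addIr.
Qed.

End Average.

(** * Dirac measures, image measures and invariance *)

Section Constructions.
Context {R : realType} {X : pmetricType R}.
Notation borelX := (@borel R X).
Notation prob := (@borel_probability R X).
Implicit Types (mu nu : prob) (f : X -> R).

Lemma dirac_prob (x : X) : exists rho : prob,
  (forall A : set borelX, measurable A -> fine (rho A) = \1_A x) /\
  (forall f, bmeas f -> \int[rho]_y f y = f x).
Proof.
exists (@dirac _ borelX x R); split=> [A mA|f [mf _]]; first by [].
rewrite /Rintegral integral_dirac//; last exact/measurable_EFinP.
by rewrite /dirac indicE mem_set//= mul1r.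
Qed.

Variable T : X -> X.
Hypothesis mT : forall A : set borelX, measurable A -> measurable (T @^-1` A : set borelX).

Lemma bmeas_compT f : bmeas f -> bmeas (f \o T).
Proof.
move=> [mf [M fM]]; split; last by exists M => x /=.
move=> _ A mA; rewrite setTI comp_preimage; apply: mT.
by rewrite -[X in measurable X]setTI; exact: mf.
Qed.

Lemma bmeas_comp_iter f n : bmeas f -> bmeas (f \o iter n T).
Proof.
move=> bf; elim: n => [|n ih] //.
have := bmeas_compT ih.
rewrite (_ : _ \o T = f \o iter n.+1 T)//.
by apply/funext => x /=; rewrite -iterS iterSr.
Qed.

Lemma bmeas_birkhoff f n : bmeas f -> bmeas (birkhoff_sum T n f).
Proof.
move=> bf; rewrite /birkhoff_sum; apply: bmeas_sum => i _.
exact: (@bmeas_comp_iter f i bf).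
Qed.

Lemma pushforward_prob mu : exists rho : prob,
  (forall A : set borelX, measurable A -> rho A = mu (T @^-1` A)) /\
  (forall f, bmeas f -> \int[rho]_x f x = \int[mu]_x f (T x)).
Proof.
have mfT : measurable_fun [set: borelX] (T : borelX -> borelX).
  by move=> _ A mA; rewrite setTI; exact: mT.
pose T' : {mfun borelX >-> borelX} :=
  MeasurableFun.Pack (MeasurableFun.Class (isMeasurableFun.Build _ _ _ _ _ mfT)).
exists (distribution mu T'); split => // f bf.
rewrite /Rintegral integral_pushforward//.
  by apply/measurable_EFinP; exact: bf.1.
by rewrite preimage_setT; apply: (bmeas_integrable mu (bmeas_compT bf)).
Qed.

Lemma integral_invariant mu f : invariant_measures T mu -> bmeas f ->
  \int[mu]_x f (T x) = \int[mu]_x f x.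
Proof.
move=> imu bf; have [rho [rhoE <-//]] := pushforward_prob mu.
rewrite /Rintegral; congr fine; apply: eq_measure_integral => A mA _.
by have := rhoE A mA; rewrite imu.
Qed.

Lemma integral_invariant_iter mu f n : invariant_measures T mu -> bmeas f ->
  \int[mu]_x f (iter n T x) = \int[mu]_x f x.
Proof.
move=> imu bf; elim: n => [|n ih]//.
rewrite -ih -(integral_invariant imu (bmeas_comp_iter n bf))/=.
by apply: eq_Rintegral => x _; rewrite -iterS iterSr.
Qed.

Lemma integral_birkhoff mu f n : invariant_measures T mu -> bmeas f ->
  \int[mu]_x birkhoff_sum T n f x = n%:R * \int[mu]_x f x.
Proof.
move=> imu bf; rewrite /birkhoff_sum Rint_sum; last first.
  by move=> i _; exact: (bmeas_comp_iter i bf).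
under eq_bigr do rewrite integral_invariant_iter//.
by rewrite sumr_const card_ord mulr_natl.
Qed.

Lemma invariantP mu : compact [set: X] ->
  (forall f, continuous f -> \int[mu]_x f (T x) = \int[mu]_x f x) ->
  invariant_measures T mu.
Proof.
move=> cX muT A mA; have [rho [rhoE rhoI]] := pushforward_prob mu.
rewrite -rhoE//; apply: prob_unique => // f cf.
by rewrite rhoI; [rewrite muT|exact: continuous_bmeas].
Qed.

End Constructions.

(** * Lower bound for the pressure *)

Section LowerBoundEntropy.
Context {R : realType} {X : pmetricType R}.
Notation borelX := (@borel R X).
Notation prob := (@borel_probability R X).
Implicit Types (mu : prob).

Lemma mlabel_ffun (K : finType) (B : K -> set borelX) : (forall k, measurable (B k)) ->
  mlabel (fun x => [ffun k => `[< B k x >]] : {ffun K -> bool}).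
Proof.
move=> mB w; rewrite [X in measurable X](_ : _ =
    \bigcap_(k in [set: K]) (fun x => `[< B k x >]) @^-1` [set w k]).
  apply: fin_bigcap_measurable => [|k _]; first exact: finite_finset.
  exact: mlabel_bool.
apply/seteqP; split => x/=.
  by move=> /ffunP xw k _; have := xw k; rewrite ffunE.
by move=> xw; apply/ffunP => k; rewrite ffunE; exact: xw.
Qed.

(** The chosen index depends on [x] only through the finite vector recording which sets contain [x],
    hence measurably. *)
Lemma mlabel_cover (K : finType) (B : K -> set borelX) :
  (forall k, measurable (B k)) -> (forall x, exists k, B k x) ->
  exists q : X -> K, mlabel q /\ forall x, B (q x) x.
Proof.
move=> mB Bx; have [k0 _] := Bx point.
pose c (w : {ffun K -> bool}) := odflt k0 [pick k | w k].
exists (c \o (fun x => [ffun k => `[< B k x >]])); split.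
  by apply: mlabel_comp; exact: mlabel_ffun.
move=> x /=; rewrite /c; case: pickP => [k|no] /=.
  by rewrite ffunE => /asboolP.
by have [k /asboolP kx] := Bx x; have := no k; rewrite ffunE kx.
Qed.

Lemma bmeas_label (K : finType) (q : X -> K) (g : K -> R) : mlabel q ->
  bmeas (fun x => g (q x)).
Proof.
move=> mq; rewrite (_ : (fun x => _) =
    (fun x => \sum_k g k * \1_(q @^-1` [set k]) x)).
  by apply: bmeas_sum => k _; apply: bmeasZ; apply: bmeas_indic; exact: mq.
apply/funext => x; rewrite (bigD1 (q x))//= indicE mem_set//= mulr1 big1 ?addr0//.
by move=> k kq; rewrite indicE memNset ?mulr0//= => qk; rewrite qk eqxx in kq.
Qed.

Lemma integral_label mu (K : finType) (q : X -> K) (g : K -> R) : mlabel q ->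
  \int[mu]_x g (q x) = \sum_k law mu q k * g k.
Proof.
move=> mq; have mqk k : measurable (q @^-1` [set k] : set borelX) by exact: mq.
rewrite (@Rint_ext _ _ mu _ (fun x => \sum_k g k * \1_(q @^-1` [set k]) x)); last first.
  move=> x; rewrite (bigD1 (q x))//= indicE mem_set//= mulr1 big1 ?addr0//.
  by move=> k kq; rewrite indicE memNset ?mulr0//= => qk; rewrite qk eqxx in kq.
rewrite Rint_sum; last by move=> k _; apply: bmeasZ; exact: bmeas_indic.
apply: eq_bigr => k _; rewrite RintZ; last exact: bmeas_indic.
by rewrite integral_indicE// mulrC.
Qed.

Variable T : X -> X.
Hypothesis mT : forall A : set borelX, measurable A -> measurable (T @^-1` A : set borelX).

(* Gibbs' inequality against the weights [exp (a k) / Z] on [k], times a product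
   over time that favours the guessed letter [g k j] and penalizes each wrong
   letter by a factor [exp (- c1)]. *)
Lemma gibbs_partition mu (m n : nat) (l : X -> 'I_m) (K : finType) (q : X -> K)
    (a : K -> R) (g : K -> 'I_n -> 'I_m) (c0 c1 : R) :
  mlabel l -> mlabel q -> m%:R * expR (- c1) <= c0 ->
  entropy mu (itin T l n) + \sum_k law mu q k * a k <=
  ln (\sum_k expR (a k)) + n%:R * c0 +
  c1 * \sum_(j < n) fine (mu [set x | l (iter j T x) != g (q x) j]).
Proof.
move=> ml mq c01; have mi := @mlabel_itin _ _ T mT m l ml n.
have miq := mlabel_pair mi mq.
set Z := \sum_k expR (a k).
have Z0 : 0 < Z.
  rewrite /Z (bigD1 (q point))//=; apply: ltr_pwDl; first exact: expR_gt0.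
  by apply: sumr_ge0 => k _; exact: expR_ge0.
pose t (i j : 'I_m) : R := c0 + c1 * (i != j)%:R.
pose r (x : {ffun 'I_n -> 'I_m} * K) : R :=
  expR (a x.2) / Z * \prod_j expR (- t (x.1 j) (g x.2 j)).
(* The right letter weighs [exp (- c0)] and the wrong ones together at most [exp (- c0) * c0], by
   the hypothesis on [c1]; and [1 + c0 <= exp c0]. *)
have t1 j : \sum_i expR (- t i j) <= 1.
  have -> : \sum_i expR (- t i j) = expR (- c0) * \sum_i expR (- (c1 * (i != j)%:R)).
    by rewrite mulr_sumr; apply: eq_bigr => i _; rewrite -expRD opprD.
  rewrite expRN ler_pdivrMl ?expR_gt0// mulr1.
  rewrite (bigD1 j)//= eqxx mulr0 oppr0 expR0.
  apply: le_trans (expR_ge1Dx c0); rewrite lerD2l; apply: le_trans c01.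
  rewrite (eq_bigr (fun=> expR (- c1))); last by move=> i ->; rewrite mulr1.
  rewrite sumr_const -[leLHS]mulr_natl ler_wpM2r ?expR_ge0// ler_nat.
  by rewrite (leq_trans (max_card _))// card_ord.
have r1 : \sum_x r x <= 1.
  rewrite -(pair_bigA _ (fun w k => r (w, k)))/= exchange_big/=.
  apply: (@le_trans _ _ (\sum_k expR (a k) / Z)); last first.
    by rewrite -mulr_suml divff// gt_eqF.
  apply: ler_sum => k _; rewrite /r/= -mulr_sumr -[leRHS]mulr1 ler_wpM2l//.
    by rewrite divr_ge0 ?expR_ge0// ltW.
  rewrite -(bigA_distr_bigA (fun j i => expR (- t i (g k j)))).
  apply: prodr_ile1 => j _; rewrite t1 andbT.
  by apply: sumr_ge0 => i _; exact: expR_ge0.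
have r0 x : 0 < r x.
  rewrite /r mulr_gt0 ?divr_gt0 ?expR_gt0//.
  by apply: prodr_gt0 => j _; exact: expR_gt0.
have lnr x : ln (r x) = a x.2 - ln Z - n%:R * c0 -
    c1 * \sum_j (x.1 j != g x.2 j)%:R.
  rewrite /r lnM ?posrE ?divr_gt0 ?expR_gt0//; last first.
    by apply: prodr_gt0 => j _; exact: expR_gt0.
  rewrite ln_div ?posrE ?expR_gt0// expRK -expR_sum expRK -addrA -!addrA.
  congr (_ + (_ + _)); rewrite sumrN /t big_split/= sumr_const card_ord opprD.
  by rewrite mulr_natl mulr_sumr.
have := @gibbs R _ (law mu (fun x => (itin T l n x, q x))) r.
move=> /(_ (law_ge0 mu _) (fun x => ltW (r0 x)) (fun x _ => r0 x)).
rewrite (law_sum1 mu miq) => /(_ r1).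
rewrite -/(entropy mu (fun x => (itin T l n x, q x))) => hH.
have := @entropy_comp_le _ _ mu _ _ _ fst miq; rewrite -/(itin T l n) => /= hH'.
have {hH hH'} := le_trans hH' hH.
rewrite -(integral_label mu (fun x => ln (r x)) miq).
rewrite (@Rint_ext _ _ mu _ (fun x => (a (q x) - (ln Z + n%:R * c0)) -
    c1 * \sum_(j < n) (l (iter j T x) != g (q x) j)%:R)); last first.
  move=> x; rewrite lnr/= opprD addrA; congr (_ - _ * _).
  by apply: eq_bigr => j _; rewrite ffunE.
pose A (j : 'I_n) : set borelX := [set x | l (iter j T x) != g (q x) j].
have mlj (j : 'I_n) : mlabel (l \o iter j T) by exact: mlabel_iter.
have mA j : measurable (A j).
  exact: (mlabel_preimage [set p | p.1 != g p.2 j] (mlabel_pair (mlj j) mq)).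
have AE (j : 'I_n) x : (l (iter j T x) != g (q x) j)%:R = \1_(A j) x :> R.
  rewrite indicE /A; case: (boolP (l _ != _)) => h; first by rewrite mem_set.
  by rewrite memNset//=; exact/negP.
have bA : bmeas (fun x => \sum_j \1_(A j) x : R).
  by apply: bmeas_sum => j _; exact: bmeas_indic.
rewrite (@Rint_ext _ _ mu _ (fun x => (a (q x) - (ln Z + n%:R * c0)) -
    c1 * \sum_j \1_(A j) x)); last first.
  by move=> x; congr (_ - _ * _); apply: eq_bigr => j _.
have IA : \int[mu]_x (\sum_j \1_(A j) x : R) = \sum_j fine (mu (A j)).
  rewrite Rint_sum; last by move=> j _; exact: bmeas_indic.
  by apply: eq_bigr => j _; rewrite integral_indicE.
have bq : bmeas (fun x => a (q x)) by exact: bmeas_label.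
rewrite RintB; [|by apply: bmeasB => //; exact: bmeas_cst|exact: bmeasZ].
rewrite RintB//; last exact: bmeas_cst.
rewrite Rint_cst RintZ// IA integral_label// => h.
by rewrite -lerBrDr (le_trans h)//; lra.
Qed.

End LowerBoundEntropy.

(** * Uniform scales from compactness; Bowen distances *)

Section MetricCompactness.
Context {R : realType} {X : pmetricType R}.
Hypothesis cX : compact [set: X].

(** The form in which compactness is used below: scales that work near each point can be chosen for
    all points at once. *)
Lemma compact_near0 (P : R -> X -> Prop) :
  (forall x, exists2 r : R, 0 < r & forall y e, mdist x y < r -> 0 < e -> e < r -> P e y) ->
  \forall e \near 0^'+, forall x, P e x.
Proof.
move=> h.
have : \forall e \near 0^'+, [set: X] `<=` P e.
  apply: (compact_near_coveringP _).1 cX _ _ _ _ _ => x _.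
  have [r r0 hr] := h x.
  exists ([set y | mdist x y < r], [set e | 0 < e < r]).
    split => /=; first by apply/metricType_numDomainType.nbhs_mdistP; exists r.
    near=> e; apply/andP; split; near: e; first exact: nbhs_right_gt.
    exact: nbhs_right_lt.
  by move=> [y e] /= [xy /andP[e0 er]]; exact: hr.
by apply: filterS => e he x; exact: he.
Unshelve. all: by end_near. Qed.

Lemma open_mdist (U : set X) x : open U -> U x ->
  exists2 r : R, 0 < r & forall y, mdist x y < r -> U y.
Proof.
move=> oU Ux; have /metricType_numDomainType.nbhs_mdistP[r r0 rU] : nbhs x U.
  exact: open_nbhs_nbhs.
by exists r => // y xy; exact: rU.
Qed.

Lemma closed_separation (A B : set X) : closed A -> closed B -> A `&` B = set0 ->
  \forall e \near (0 : R)^'+, forall x y, A x -> B y -> e <= mdist x y.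
Proof.
move=> cA cB AB.
have : \forall e \near (0 : R)^'+, forall x, A x -> forall y, B y -> e <= mdist x y.
  apply: compact_near0 => x; have [Ax|nAx] := pselect (A x); last first.
    have [r r0 rA] := open_mdist (closed_openC cA) nAx.
    by exists r => // y e xy _ _ Ay; have := rA _ xy.
  have nBx : (~` B) x by move=> Bx; rewrite -[False]/(set0 x) -AB.
  have [r r0 rB] := open_mdist (closed_openC cB) nBx.
  exists (r / 2); first by rewrite divr_gt0.
  move=> y e xy e0 er _ z Bz; rewrite leNgt; apply/negP => yz.
  apply: (rB z) => //; rewrite (le_lt_trans (metric_triangle _ y _))//.
  by rewrite [r]splitr ltrD// (lt_trans yz).
by apply: filterS => e he x y Ax; exact: he.
Qed.

Lemma continuous_uniform (f : X -> R) (d : R) : continuous f -> 0 < d ->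
  \forall e \near (0 : R)^'+, forall x y, mdist x y <= e -> `|f x - f y| <= d.
Proof.
move=> cf d0; apply: (@compact_near0 (fun e x => forall y, mdist x y <= e -> _)).
move=> x; have d20 : 0 < d / 2 by rewrite divr_gt0.
have /cvgr_dist_lt/(_ _ d20)/metricType_numDomainType.nbhs_mdistP[r r0 rf] := cf x.
exists (r / 2); first by rewrite divr_gt0.
move=> y e xy e0 er z yz.
have fy : `|f x - f y| < d / 2.
  by apply: rf; rewrite /= (lt_le_trans xy)// ler_pdivrMr// ler_pMr// ler1n.
have fz : `|f x - f z| < d / 2.
  apply: rf => /=; rewrite (le_lt_trans (metric_triangle _ y _))//.
  by rewrite [r]splitr ltrD// (le_lt_trans yz).
rewrite (_ : f y - f z = (f x - f z) - (f x - f y)); last by ring.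
by rewrite (le_trans (ler_normB _ _))// [d]splitr lerD// ltW.
Qed.

Variable T : X -> X.

Lemma bowen_dist_le n x y (e : R) : 0 <= e ->
  (bowen_dist T n x y <= e) <-> (forall k, (k < n)%N -> mdist (iter k T x) (iter k T y) <= e).
Proof.
move=> e0; rewrite /bowen_dist; split => [/bigmax_leP[_ h] k kn|h].
  exact: (h (Ordinal kn) isT).
by apply/bigmax_leP; split => // -[k kn] _; exact: h.
Qed.

Lemma bowen_dist_ge0 n x y : 0 <= bowen_dist T n x y.
Proof. by rewrite /bowen_dist; exact: bigmax_ge_id. Qed.

Lemma bowen_dist_sym n x y : bowen_dist T n x y = bowen_dist T n y x.
Proof. by apply: eq_bigr => k _; rewrite metric_sym. Qed.

Lemma bowen_dist_triangle n x y z :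
  bowen_dist T n x z <= bowen_dist T n x y + bowen_dist T n y z.
Proof.
apply/bowen_dist_le => [|k kn]; first by rewrite addr_ge0 ?bowen_dist_ge0.
rewrite (le_trans (metric_triangle _ (iter k T y) _))// lerD//.
  exact: (bowen_dist_le n x y (bowen_dist_ge0 n x y)).1 (lexx _) k kn.
exact: (bowen_dist_le n y z (bowen_dist_ge0 n y z)).1 (lexx _) k kn.
Qed.

Lemma iter_continuous n : continuous T -> continuous (iter n T).
Proof.
move=> cT; elim: n => [|n ih] x; first exact: cvg_id.
by apply: (@continuous_comp _ _ _ (iter n T) T); [exact: ih|exact: cT].
Qed.

Lemma bowen_dist_continuous n x : continuous T -> continuous (bowen_dist T n x).
Proof.
move=> cT; rewrite /bowen_dist.
elim: (index_enum 'I_n) => [|k s ih] y.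
  by under eq_fun do rewrite big_nil; exact: cvg_cst.
under eq_fun do rewrite big_cons;
apply: (@continuous_max _ _ (fun y => mdist (iter k T x) (iter k T y))
  (fun y => \big[Num.max/0]_(j <- s) mdist (iter j T x) (iter j T y))); last exact: ih.
apply: (@continuous_comp _ _ _ (iter k T) (mdist (iter k T x))).
  exact: iter_continuous.
exact: mdist_continuous.
Qed.

(** [E] is extracted greedily from the centres of a finite cover by Bowen balls of radius [e]. A
    point is within [e] of a centre and a centre within [e] of [E], whence the factor 2. *)
Lemma separated_net n (e : R) : continuous T -> 0 < e ->
  exists E : seq X, [/\ uniq E, dn_separated T n e [set` E] &
    forall y, exists2 x, x \in E & bowen_dist T n x y <= 2 * e].
Proof.
move=> cT e0.
have greedy (s : seq X) : exists E : seq X, [/\ uniq E, dn_separated T n e [set` E] &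
    forall y, y \in s -> exists2 x, x \in E & bowen_dist T n x y <= e].
  elim: s => [|z s [E [uE sE Es]]]; first by exists [::]; split.
  have [[x xE xz]|nz] := pselect (exists2 x, x \in E & bowen_dist T n x z <= e).
    exists E; split => // y; rewrite inE => /predU1P[->|/Es//].
    by exists x.
  have zE x : x \in E -> e < bowen_dist T n x z.
    by move=> xE; rewrite ltNge; apply/negP => xz; apply: nz; exists x.
  exists (z :: E); split.
  - rewrite /= uE andbT; apply/negP => /zE; rewrite ltNge => /negP; apply.
    by apply/bowen_dist_le => [|k _]; rewrite ?mdistxx ltW.
  - move=> x y /=; rewrite !inE => /predU1P[->|xE] /predU1P[->|yE] xy //.
    + by rewrite bowen_dist_sym zE.
    + exact: zE.
    + exact: sE.
  - move=> y; rewrite inE => /predU1P[->|/Es[x xE xy]].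
      exists z; first by rewrite inE eqxx.
      by apply/bowen_dist_le => [|k _]; rewrite ?mdistxx ltW.
    by exists x => //; rewrite inE xE orbT.
move: cX; rewrite compact_cover => /(_ X setT (fun x => [set y | bowen_dist T n x y < e])).
case.
- move=> x _; apply: (open_comp (f := bowen_dist T n x) (D := [set z | z < e])).
    by move=> y _; exact: bowen_dist_continuous.
  exact: open_lt.
- move=> x _; exists x => //=; apply: (le_lt_trans _ e0).
  by apply/bowen_dist_le => // k _; rewrite mdistxx.
move=> D _ DX; have [E [uE sE DE]] := greedy (finmap.enum_fset D).
exists E; split => // y; have [x xD xy] := DX y I.
have [z zE zx] := DE x xD; exists z => //.
rewrite (le_trans (bowen_dist_triangle _ _ x _))// mulr_natl mulr2n lerD//.
exact: ltW.
Qed.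

End MetricCompactness.

(** * Continuous functions of row vectors on bounded boxes *)

Section Box.
Context {R : realType} {d : nat}.

Lemma rV_continuous_at (F : 'rV[R]_d -> R) (u : 'rV[R]_d) (e : R) : continuous F -> 0 < e ->
  exists2 r : R, 0 < r & forall v : 'rV[R]_d, (forall i, `|u 0 i - v 0 i| < r) -> `|F u - F v| < e.
Proof.
move=> cF e0; have /cvgr_dist_lt/(_ _ e0)/nbhs_ballP[r /= r0 rF] := cF u.
exists r => // v uv; apply: rF; split => // i j; rewrite ord1; exact: uv.
Qed.

Lemma rV_uniform (F : 'rV[R]_d -> R) (C e : R) : continuous F -> 0 < e ->
  exists2 r : R, 0 < r & forall u v : 'rV[R]_d, (forall i, `|u 0 i| <= C) ->
    (forall i, `|u 0 i - v 0 i| <= r) -> `|F u - F v| <= e.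
Proof.
move=> cF e0; have e20 : 0 < e / 2 by rewrite divr_gt0.
have cB := @rV_compact R d (fun=> `[- C, C]%classic) (fun=> @segment_compact R _ _).
suff : \forall r \near (0 : R)^'+, [set u : 'rV[R]_d | forall i, `[- C, C]%classic (u 0 i)]
   `<=` (fun u : 'rV[R]_d => forall v : 'rV[R]_d, (forall i, `|u 0 i - v 0 i| <= r) -> `|F u - F v| <= e).
  move=> h; near (0 : R)^'+ => r; exists r => // u v uC uv.
  apply: (near h r) => // i /=; rewrite in_itv/= -ler_norml; exact: uC.
apply: (compact_near_coveringP _).1 cB _ _ _ _ _ => u _.
have [r r0 rF] := rV_continuous_at u cF e20.
exists ([set v : 'rV[R]_d | forall i, `|u 0 i - v 0 i| < r / 2], [set q | 0 < q < r / 2]).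
  split => /=.
    apply/nbhs_ballP; exists (r / 2) => /=; first by rewrite divr_gt0.
    by move=> v [_ uv] i; exact: uv.
  near=> q; apply/andP; split; near: q; first exact: nbhs_right_gt.
  by apply: nbhs_right_lt; rewrite divr_gt0.
move=> [v q] /= [uv /andP[q0 qr]] w vw.
have Fv : `|F u - F v| < e / 2.
  apply: rF => i; rewrite (lt_le_trans (uv i))// ler_pdivrMr// ler_pMr// ler1n//.
have Fw : `|F u - F w| < e / 2.
  apply: rF => i; rewrite (_ : _ - _ = (u 0 i - v 0 i) + (v 0 i - w 0 i)); last by ring.
  by rewrite (le_lt_trans (ler_normD _ _))// [r]splitr ltrD// (le_lt_trans (vw i)).
rewrite (_ : F v - F w = (F u - F w) - (F u - F v)); last by ring.
by rewrite (le_trans (ler_normB _ _))// [e]splitr lerD// ltW.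
Unshelve. all: by end_near. Qed.

Lemma rV_bounded (F : 'rV[R]_d -> R) (C : R) : continuous F ->
  exists2 M : R, 0 < M & forall u : 'rV[R]_d, (forall i, `|u 0 i| <= C) -> `|F u| <= M.
Proof.
move=> cF.
have cB := @rV_compact R d (fun=> `[- C, C]%classic) (fun=> @segment_compact R _ _).
have := continuous_compact (continuous_subspaceT cF) cB.
move=> /compact_bounded[M [_ MP]]; exists (`|M| + 1); first by rewrite ltr_wpDl.
move=> u uC; apply: MP; first by rewrite (le_lt_trans (ler_norm _))// ltrDl.
by exists u => // i /=; rewrite in_itv/= -ler_norml; exact: uC.
Qed.

End Box.

Section BirkhoffBounds.
Context {R : realType} {X : pmetricType R}.

Lemma family_bounded (I : finType) (Phi : I -> X -> R) : compact [set: X] ->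
  (forall i, continuous (Phi i)) -> exists C, forall i x, `|Phi i x| <= C.
Proof.
move=> cX cPhi.
have /choice[C CP] : forall i, exists C, forall x, `|Phi i x| <= C.
  by move=> i; have [M _ ?] := continuous_bounded cX (@cPhi i); exists M.
exists (\sum_i `|C i|) => i x; rewrite (le_trans (CP i x))// (bigD1 i)//=.
by rewrite (le_trans (ler_norm _))// lerDl sumr_ge0.
Qed.

Lemma birkhoff_average_le (T : X -> X) n (f : X -> R) (C : R) x : (0 < n)%N ->
  (forall y, `|f y| <= C) -> `|birkhoff_sum T n f x / n%:R| <= C.
Proof.
move=> n0 fC; have n0R : 0 < n%:R :> R by rewrite ltr0n.
rewrite normrM normfV [X in _ / X]ger0_norm ?(ltW n0R)// ler_pdivrMr//.
rewrite (le_trans (ler_norm_sum _ _ _))//.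
rewrite (le_trans (ler_sum _ (fun k _ => fC _)))//.
by rewrite sumr_const card_ord mulr_natr.
Qed.

End BirkhoffBounds.

(** * Jensen's inequality for finite convex combinations *)

Section Jensen.
Context {R : realType} {V : lmodType R}.
Variable F : V -> R.
Hypothesis cF : convex_function [set: V] F.

Lemma convex2 (t : R) x y : 0 <= t -> t <= 1 ->
  F (t *: x + (1 - t) *: y) <= t * F x + (1 - t) * F y.
Proof.
move=> t0 t1; have := cF (Itv01 t0 t1) (x := x) (y := y).
by apply; rewrite inE.
Qed.

(* Keeping a slack mass [1 - \sum_k w k] at an auxiliary point [y] lets the induction
   avoid renormalizing the weights. *)
Lemma jensen_slack (K : Type) (s : seq K) (w : K -> R) (v : K -> V) (y : V) :
  (forall k, 0 <= w k) -> \sum_(k <- s) w k <= 1 ->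
  F (\sum_(k <- s) w k *: v k + (1 - \sum_(k <- s) w k) *: y) <=
  \sum_(k <- s) w k * F (v k) + (1 - \sum_(k <- s) w k) * F y.
Proof.
move=> w0; elim: s y => [|k s ih] y.
  by rewrite !big_nil !add0r subr0 scale1r mul1r.
rewrite !big_cons; set W := \sum_(j <- s) w j => W1.
have W1' : W <= 1 by have := w0 k; lra.
(* If the tail has full mass, no slack is left to divide by, but then [w k = 0]. *)
have [WE|WN] := eqVneq W 1.
  have wk : w k = 0 by have := w0 k; lra.
  have := ih y W1'; rewrite -/W WE wk scale0r !add0r mul0r subrr !add0r; exact.
have W0 : 0 < 1 - W by rewrite subr_gt0 lt_neqAle WN.
(* The share of [w k] in the slack of the tail: [v k] is merged with [y] into a new auxiliary point,
   to which the induction hypothesis applies. *)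
pose t := w k / (1 - W).
have t0 : 0 <= t by rewrite divr_ge0 ?(ltW W0).
have t1 : t <= 1 by rewrite ler_pdivrMr// mul1r; lra.
have tW : (1 - W) * t = w k by rewrite mulrC divfK// gt_eqF.
have := ih (t *: v k + (1 - t) *: y) W1'; rewrite -/W => h.
have -> : w k *: v k + \sum_(j <- s) w j *: v j + (1 - (w k + W)) *: y =
    \sum_(j <- s) w j *: v j + (1 - W) *: (t *: v k + (1 - t) *: y).
  rewrite scalerDr !scalerA tW mulrBr mulr1 tW addrCA addrA.
  by rewrite [1 - (w k + W)](_ : _ = 1 - W - w k)//; ring.
apply: (le_trans h); rewrite -addrA addrCA lerD2l.
have := ler_wpM2l (ltW W0) (convex2 (v k) y t0 t1) => /le_trans; apply.
rewrite (_ : (1 - W) * _ = ((1 - W) * t) * F (v k) + ((1 - W) - (1 - W) * t) * F y).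
  by rewrite tW (_ : 1 - W - w k = 1 - (w k + W))//; ring.
by ring.
Qed.

Lemma jensen (K : finType) (w : K -> R) (v : K -> V) :
  (forall k, 0 <= w k) -> \sum_k w k = 1 ->
  F (\sum_k w k *: v k) <= \sum_k w k * F (v k).
Proof.
move=> w0 w1; have := @jensen_slack K (index_enum K) w v 0 w0.
by rewrite w1 subrr scale0r mul0r !addr0; apply.
Qed.

End Jensen.

(** * Means of [F] over Birkhoff averages *)

Section Averages.
Context {R : realType} {X : pmetricType R}.
Notation borelX := (@borel R X).
Notation prob := (@borel_probability R X).
Variables (T : X -> X) (d : nat) (Phi : 'I_d -> X -> R) (F : 'rV[R]_d -> R).
Hypothesis cX : compact [set: X].
Hypothesis cT : continuous T.
Hypothesis cPhi : forall i, continuous (Phi i).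
Hypothesis cF : continuous F.
Let mT := continuous_borel cT.
Let bPhi i : bmeas (Phi i) := continuous_bmeas cX (@cPhi i).

Definition average_close n (eta : R) (K : finType) (q : X -> K) (v : K -> 'rV[R]_d) :=
  forall x i, `|birkhoff_sum T n (Phi i) x / n%:R - v (q x) 0 i| <= eta.

(* The only property of [mu] that the lower bound on the pressure uses: the mean
   of [F] over the averages [S_n Phi / n] is asymptotically at least
   [F (\int Phi dmu)].  It follows from Jensen's inequality when [F] is convex,
   and from the convergence in measure of ergodic averages when [mu] is
   ergodic. *)
Definition subaverage (mu : prob) := forall e : R, 0 < e ->
  exists2 eta : R, 0 < eta & \forall n \near \oo,
  forall (K : finType) (q : X -> K) (v : K -> 'rV[R]_d), mlabel q ->
  average_close n eta q v ->
  F (integral_vec Phi mu) - e <= \sum_k law mu q k * F (v k).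

(** By invariance a Birkhoff average has the same integral as [Phi], so the mean of [v] under the
    law of [q] is close to that integral; Jensen's inequality moves [F] inside the mean. *)
Lemma convex_subaverage mu : invariant_measures T mu ->
  convex_function [set: 'rV[R]_d] F -> subaverage mu.
Proof.
move=> imu vF e e0.
have [r r0 rF] := rV_continuous_at (integral_vec Phi mu) cF e0.
exists (r / 2); first by rewrite divr_gt0.
exists 1%N => // n /= n0 K q v mq qv.
have n0R : (n%:R : R) != 0 by rewrite pnatr_eq0 -lt0n.
apply: (@le_trans _ _ (F (\sum_k law mu q k *: v k))); last first.
  by apply: jensen => //; [move=> k; exact: law_ge0|exact: law_sum1].
suff : `|F (integral_vec Phi mu) - F (\sum_k law mu q k *: v k)| < e.
  by rewrite ltr_norml => /andP[? ?]; lra.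
apply: rF => i; rewrite !mxE summxE.
have -> : \sum_k (law mu q k *: v k) 0 i = \int[mu]_x v (q x) 0 i.
  rewrite (integral_label mu (fun k => v k 0 i) mq).
  by apply: eq_bigr => k _; rewrite mxE.
have -> : \int[mu]_x Phi i x = \int[mu]_x (n%:R^-1 * birkhoff_sum T n (Phi i) x).
  rewrite RintZ; last exact: bmeas_birkhoff.
  by rewrite (integral_birkhoff mT)// mulKf.
have bv : bmeas (fun x => v (q x) 0 i) by exact: (bmeas_label (fun k => v k 0 i)).
have bS : bmeas (fun x => n%:R^-1 * birkhoff_sum T n (Phi i) x).
  by apply: bmeasZ; exact: bmeas_birkhoff.
rewrite -RintB// (@le_lt_trans _ _ (r / 2))//; last first.
  by rewrite ltr_pdivrMr// ltr_pMr// ltr1n.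
have bB := bmeasB bS bv.
rewrite ler_norml; apply/andP; split.
  rewrite -[leLHS](Rint_cst mu); apply: Rint_le => //; first exact: bmeas_cst.
  by move=> x; have := qv x i; rewrite mulrC ler_norml => /andP[].
rewrite -[leRHS](Rint_cst mu); apply: Rint_le => //; first exact: bmeas_cst.
by move=> x; have := qv x i; rewrite mulrC ler_norml => /andP[].
Qed.

End Averages.

(** * The maximal ergodic inequality and its consequence for ergodic measures *)

Section Ergodic.
Context {R : realType} {X : pmetricType R}.
Notation borelX := (@borel R X).
Notation prob := (@borel_probability R X).
Variable T : X -> X.
Hypothesis mT : forall A : set borelX, measurable A -> measurable (T @^-1` A : set borelX).

Lemma bmeas_gt (f : X -> R) (c : R) : bmeas f -> measurable ([set x | c < f x] : set borelX).
Proof.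
move=> [mf _]; have := mf measurableT (`]c, +oo[%classic) (measurable_itv _).
by rewrite setTI; congr measurable; apply/seteqP; split => x/=; rewrite in_itv/= andbT.
Qed.

Lemma bmeas_max0 (f : X -> R) : bmeas f -> bmeas (fun x => Num.max 0 (f x)).
Proof.
move=> [mf [M fM]]; split.
  by apply: (@measurable_maxr _ borelX R setT (cst 0) f) => //; exact: measurable_cst.
exists M => x; rewrite ger0_norm ?le_max ?lexx// ge_max.
by rewrite (le_trans _ (fM x))//= (le_trans (ler_norm _) (fM x)).
Qed.

(** The maximum of the Birkhoff sums of [f] of lengths [0, ..., n], the empty sum included, in the
    recursive form that the maximal inequality exploits. *)
Fixpoint max_birkhoff (f : X -> R) n x : R :=
  if n is n'.+1 then Num.max 0 (f x + max_birkhoff f n' (T x)) else 0.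

Lemma bmeas_max_birkhoff f n : bmeas f -> bmeas (max_birkhoff f n).
Proof.
move=> bf; elim: n => [|n ih]; first exact: bmeas_cst.
apply: bmeas_max0; apply: bmeasD => //; exact: (bmeas_compT mT ih).
Qed.

Lemma birkhoff_sumS n f x :
  birkhoff_sum T n.+1 f x = f x + birkhoff_sum T n f (T x).
Proof.
rewrite /birkhoff_sum big_ord_recl/=; congr (_ + _).
by apply: eq_bigr => k _; rewrite -iterSr.
Qed.

Lemma max_birkhoff_ge0 f n x : 0 <= max_birkhoff f n x.
Proof. by case: n => //= n; rewrite le_max lexx. Qed.

Lemma birkhoff_le_max f k n x : (k <= n)%N ->
  birkhoff_sum T k f x <= max_birkhoff f n x.
Proof.
elim: n k x => [|n ih] [|k] x // kn; rewrite ?[birkhoff_sum T 0 f x]big_ord0 ?max_birkhoff_ge0//.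
by rewrite birkhoff_sumS /= le_max lerD2l ih ?orbT.
Qed.

Lemma max_birkhoff_mono f n x : max_birkhoff f n x <= max_birkhoff f n.+1 x.
Proof.
elim: n x => [|n ih] x; first exact: max_birkhoff_ge0.
by rewrite /= ge_max le_max lexx/= le_max lerD2l ih orbT.
Qed.

(** Garsia's argument. With [M] the maximum of length [n.+1], the integrand dominates [M - M \o T]:
    where [M > 0] the recursion gives [f = M - max_birkhoff f n \o T], and elsewhere [M = 0]. By
    invariance [M - M \o T] has integral 0. *)
Lemma maximal_ergodic mu f n : invariant_measures T mu -> bmeas f ->
  0 <= \int[mu]_x (f x * \1_[set x | 0 < max_birkhoff f n x] x).
Proof.
case: n => [|n] imu bf.
  rewrite (@Rint_ext _ _ mu _ (fun=> 0)) ?Rint_cst// => x.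
  by rewrite indicE memNset ?mulr0//= ltxx.
have bM := bmeas_max_birkhoff n.+1 bf.
rewrite -[leLHS](subrr (\int[mu]_x max_birkhoff f n.+1 x)).
rewrite -[X in _ - X](integral_invariant mT imu bM) -RintB//; last first.
  exact: (bmeas_compT mT bM).
apply: Rint_le.
- by apply: bmeasB => //; exact: (bmeas_compT mT bM).
- by apply: bmeasM => //; apply: bmeas_indic; exact: bmeas_gt.
move=> x; have := max_birkhoff_mono f n (T x); have := max_birkhoff_ge0 f n.+1 (T x).
rewrite indicE; case: (boolP (0 < max_birkhoff f n.+1 x)) => h.
  rewrite mem_set// mulr1 => *.
  have Mx : max_birkhoff f n.+1 x = f x + max_birkhoff f n (T x).
    apply/max_idPr; rewrite leNgt; apply/negP => fM; move: h.
    by rewrite /= (max_idPl (ltW fM)) ltxx.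
  by rewrite Mx; lra.
rewrite memNset//; last exact/negP.
have -> : max_birkhoff f n.+1 x = 0.
  by apply/eqP; rewrite eq_le max_birkhoff_ge0 andbT leNgt.
by rewrite mulr0 sub0r oppr_le0.
Qed.

(** The set [A] where the Birkhoff sums are unbounded above is invariant, hence null or of full
    measure. Full measure would make the sets where [max_birkhoff f n] is positive exhaust the mass,
    and the maximal inequality would contradict the negative integral. So [B K] has small mass for
    large [K], and it contains the deviation set once [n * e >= K]. *)
Lemma ergodic_birkhoff_le mu f : ergodic T mu -> bmeas f -> \int[mu]_x f x < 0 ->
  forall e del : R, 0 < e -> 0 < del ->
  \forall n \near \oo, fine (mu [set x | n%:R * e < birkhoff_sum T n f x]) < del.
Proof.
move=> [imu erg] bf f0 e del e0 del0.
pose B (K : nat) : set borelX := [set x | exists n, K%:R < birkhoff_sum T n f x].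
pose A : set borelX := \bigcap_K B K.
have mB K : measurable (B K).
  rewrite [B K](_ : _ = \bigcup_n [set x | K%:R < birkhoff_sum T n f x]).
    by apply: bigcup_measurable => n _; apply: bmeas_gt; exact: bmeas_birkhoff.
  by apply/seteqP; split => x /= [n]; [exists n|move=> _ ?; exists n].
have mA : measurable A by exact: bigcap_measurable.
have [_ [M fM]] := bf.
(* Since [f] is bounded, the Birkhoff sums at [x] and at [T x] differ by a
   bounded amount, so their unboundedness is a strictly invariant property. *)
have TA : T @^-1` A = A.
  have BK (K : nat) : exists K' : nat, K%:R + `|M| <= K'%:R.
    exists (Num.truncn (K%:R + `|M|)).+1; apply/ltW; exact: truncnS_gt.
  apply/seteqP; split => x /= Ax K _.
    have [K' K'P] := BK K; have [n nP] := Ax K' I.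
    exists n.+1; rewrite birkhoff_sumS; have := fM x.
    rewrite ler_norml => /andP[? _]; have := ler_norm M; lra.
  have [K' K'P] := BK K; have [[|n] nP] := Ax K' I.
    exists 0%N; move: nP; rewrite /birkhoff_sum !big_ord0 => nP.
    by have := normr_ge0 M; lra.
  exists n; move: nP; rewrite birkhoff_sumS; have := fM x.
  rewrite ler_norml => /andP[_ ?]; have := ler_norm M; lra.
have muA : mu A = 0%E.
  have [//|A1] := erg A mA TA; exfalso.
  pose E n : set borelX := [set x | 0 < max_birkhoff f n x].
  have mE n : measurable (E n) by apply: bmeas_gt; exact: bmeas_max_birkhoff.
  have ndE : nondecreasing_seq E.
    apply/nondecreasing_seqP => n; apply/subsetPset => x /= h.
    exact: lt_le_trans h (max_birkhoff_mono f n x).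
  have muE : (mu \o E) @ \oo --> mu (\bigcup_n E n).
    by apply: nondecreasing_cvg_mu => //; exact: bigcup_measurable.
  have E1 : mu (\bigcup_n E n) = 1%E.
    apply/eqP; rewrite eq_le probability_le1/=; last exact: bigcup_measurable.
    rewrite -A1; apply: le_measure; rewrite ?inE//; first exact: bigcup_measurable.
    move=> x Ax; have [n nP] := Ax 0%N I; exists n => //=.
    exact: lt_le_trans nP (birkhoff_le_max f x (leqnn n)).
  rewrite E1 in muE.
  have M0 : 0 < `|M| + 1 by rewrite ltr_wpDl.
  (* Mass below [c] outside [E n], weighted by the bound [|M| + 1], cannot compensate the negative
     integral of [f]. *)
  pose c := - (\int[mu]_x f x) / (`|M| + 1).
  have c0 : 0 < c by rewrite divr_gt0// oppr_gt0.
  move/fine_cvgP : muE => [_ /cvgr_gt/(_ (1 - c))].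
  rewrite ltrBlDr ltrDl => /(_ c0) [n _ /(_ n (leqnn n)) /= nc].
  have := maximal_ergodic n imu bf; apply/negP; rewrite -ltNge.
  have bE : bmeas (\1_(E n) : X -> R) by exact: bmeas_indic.
  have bE' : bmeas (fun x => 1 - \1_(E n) x : R) by apply: bmeasB => //; exact: bmeas_cst.
  have bfE : bmeas (fun x => f x * \1_(E n) x) by exact: bmeasM.
  have le1 : \int[mu]_x (f x * \1_(E n) x) <=
      \int[mu]_x (f x + (`|M| + 1) * (1 - \1_(E n) x)).
    apply: Rint_le => //; first by apply: bmeasD => //; exact: bmeasZ.
    move=> x; have := fM x; rewrite ler_norml => /andP[? _]; have := ler_norm M.
    by rewrite indicE; case: (_ \in _) => /=; lra.
  apply: (le_lt_trans le1); rewrite RintD//; last exact: bmeasZ.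
  rewrite RintZ// RintB//; last exact: bmeas_cst.
  rewrite Rint_cst integral_indicE// -ltrBrDl sub0r mulrC -ltr_pdivlMr//.
  by rewrite -/c; lra.
have : (mu \o B) @ \oo --> mu A.
  apply: nonincreasing_cvg_mu => //.
    by rewrite ltey_eq fin_num_measure.
  move=> m n mn; apply/subsetPset => x [k kP]; exists k; apply: le_lt_trans kP.
  by rewrite ler_nat.
rewrite muA => /fine_cvgP[_ /cvgr_lt/(_ del del0)] [K _ /(_ K (leqnn K))/= BK].
near=> n; apply: le_lt_trans BK; apply: fine_le; rewrite ?fin_num_measure//.
  by apply: bmeas_gt; exact: bmeas_birkhoff.
apply: le_measure; rewrite ?inE//; first by apply: bmeas_gt; exact: bmeas_birkhoff.
move=> x /= nx; exists n; apply: le_lt_trans nx.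
by rewrite -ler_pdivrMr//; near: n; exact: nbhs_infty_ger.
Unshelve. all: by end_near. Qed.

End Ergodic.

(** * Convergence in measure of ergodic averages *)

Section ErgodicAverages.
Context {R : realType} {X : pmetricType R}.
Notation borelX := (@borel R X).
Notation prob := (@borel_probability R X).
Variables (T : X -> X) (d : nat) (Phi : 'I_d -> X -> R) (F : 'rV[R]_d -> R).
Hypothesis cX : compact [set: X].
Hypothesis cT : continuous T.
Hypothesis cPhi : forall i, continuous (Phi i).
Hypothesis cF : continuous F.
Let mT := continuous_borel cT.
Let bPhi i : bmeas (Phi i) := continuous_bmeas cX (@cPhi i).

Lemma ergodic_deviation_half mu (f : X -> R) : ergodic T mu -> bmeas f ->
  forall eta del : R, 0 < eta -> 0 < del -> \forall n \near \oo,
  fine (mu [set x | eta < birkhoff_sum T n f x / n%:R - \int[mu]_x f x]) < del.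
Proof.
move=> erg bf eta del eta0 del0; set a := \int[mu]_x f x.
(* The integral of [g] is [- eta / 2 < 0], and a deviation of the average of [f] above [eta] leaves
   a Birkhoff sum of [g] above [n * (eta / 2)]. *)
pose g x := f x - (a + eta / 2).
have bg : bmeas g by apply: bmeasB => //; exact: bmeas_cst.
have eta20 : 0 < eta / 2 by rewrite divr_gt0.
have g0 : \int[mu]_x g x < 0.
  by rewrite RintB ?Rint_cst//; [rewrite -/a; lra|exact: bmeas_cst].
have := ergodic_birkhoff_le mT erg bg g0 eta20 del0.
apply: filter_app; near=> n; apply: le_lt_trans.
have n0 : 0 < n%:R :> R by rewrite ltr0n; near: n; exists 1%N.
rewrite (_ : [set x | _] = [set x | n%:R * (eta / 2) < birkhoff_sum T n g x])//.
apply/seteqP; split => x/=.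
  rewrite ltrBrDr ltr_pdivlMr//; rewrite /birkhoff_sum /g sumrB sumr_const card_ord.
  by rewrite -[_ *+ n]mulr_natl; lra.
rewrite ltrBrDr ltr_pdivlMr//; rewrite /birkhoff_sum /g sumrB sumr_const card_ord.
by rewrite -[_ *+ n]mulr_natl; lra.
Unshelve. all: by end_near. Qed.

Lemma ergodic_deviation mu (f : X -> R) : ergodic T mu -> bmeas f ->
  forall eta del : R, 0 < eta -> 0 < del -> \forall n \near \oo,
  fine (mu [set x | eta < `|birkhoff_sum T n f x / n%:R - \int[mu]_x f x|]) < del.
Proof.
move=> erg bf eta del eta0 del0; have del20 : 0 < del / 2 by rewrite divr_gt0.
pose g x := -1 * f x; have bg : bmeas g by exact: bmeasZ.
have h1 := ergodic_deviation_half erg bf eta0 del20.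
have h2 := ergodic_deviation_half erg bg eta0 del20.
have mB (h : X -> R) n : bmeas h ->
    bmeas (fun x => birkhoff_sum T n h x / n%:R - \int[mu]_x h x).
  move=> bh; apply: bmeasB; last exact: bmeas_cst.
  by apply: bmeasM; [exact: bmeas_birkhoff|exact: bmeas_cst].
near=> n.
pose A (h : X -> R) := [set x | eta < birkhoff_sum T n h x / n%:R - \int[mu]_x h x].
have mA (h : X -> R) : bmeas h -> measurable (A h : set borelX).
  by move=> bh; apply: bmeas_gt; exact: mB.
have gE x : birkhoff_sum T n g x / n%:R - \int[mu]_x g x =
    - (birkhoff_sum T n f x / n%:R - \int[mu]_x f x).
  by rewrite RintZ// /birkhoff_sum /g -mulr_sumr !mulN1r mulNr opprB opprK addrC.
have AE : [set x | eta < `|birkhoff_sum T n f x / n%:R - \int[mu]_x f x|] = A f `|` A g.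
  apply/seteqP; split => x; rewrite /A /= gE lter_normr.
    by move=> /orP.
  by move=> h; apply/orP.
rewrite AE; apply: (@le_lt_trans _ _ (fine (mu (A f)) + fine (mu (A g)))).
  rewrite -fineD ?fin_num_measure//; try exact: mA.
  apply: fine_le; rewrite ?fin_numD ?fin_num_measure//; try exact: mA.
    by apply: measurableU; exact: mA.
  by apply: measureU2; exact: mA.
rewrite [del]splitr ltrD//; [exact: (near h1 n)|exact: (near h2 n)].
Unshelve. all: by end_near. Qed.

Lemma bmeas_norm (f : X -> R) : bmeas f -> bmeas (fun x => `|f x|).
Proof.
move=> [mf [M fM]]; split; last by exists M => x; rewrite normr_id.
exact: measurableT_comp.
Qed.

(** Off the sets [B i] the averages are near the integrals, so [F (v (q x))] is within [e / 2] of
    [F a]. On them [F] loses at most [2 * M], and their total mass is small. *)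
Lemma ergodic_subaverage mu : ergodic T mu -> subaverage T Phi F mu.
Proof.
move=> erg e e0; pose a := integral_vec Phi mu.
have e20 : 0 < e / 2 by rewrite divr_gt0.
have [r r0 rF] := rV_continuous_at a cF e20.
have r40 : 0 < r / 4 by rewrite divr_gt0.
(* The extra 1 leaves room for the values [v (q x)], which lie within [eta <= 1] of true
   averages. *)
have [C0 C0P] := family_bounded cX cPhi; pose C1 := C0 + 1.
have C1P i x : `|Phi i x| <= C1 - 1 by rewrite addrK.
have [M M0 FM] := rV_bounded C1 cF.
exists (Num.min 1 (r / 4)); first by rewrite lt_min ltr01.
(* The [d] exceptional sets have total mass at most [e / (4 * M)], which costs [e / 2] when
   multiplied by [2 * M]; [d.+1] is nonzero even for [d = 0]. *)
have del0 : 0 < e / (4 * M * d.+1%:R) by rewrite divr_gt0// !mulr_gt0.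
have : \forall n \near \oo, forall i : 'I_d,
    fine (mu [set x | r / 4 < `|birkhoff_sum T n (Phi i) x / n%:R - \int[mu]_x Phi i x|])
    < e / (4 * M * d.+1%:R).
  by apply: filter_forall => i; exact: ergodic_deviation.
apply: filter_app; near=> n => dev K q v mq qv.
have n0 : 0 < n%:R :> R by rewrite ltr0n; near: n; exists 1%N.
pose B (i : 'I_d) : set borelX :=
  [set x | r / 4 < `|birkhoff_sum T n (Phi i) x / n%:R - \int[mu]_x Phi i x|].
have mB i : measurable (B i).
  have bS : bmeas (fun x => birkhoff_sum T n (Phi i) x / n%:R - \int[mu]_x Phi i x).
    apply: bmeasB; last exact: bmeas_cst.
    by apply: bmeasM; [exact: bmeas_birkhoff|exact: bmeas_cst].
  by apply: bmeas_gt; exact: bmeas_norm.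
have avC1 x i : `|birkhoff_sum T n (Phi i) x / n%:R| <= C1 - 1.
  by apply: birkhoff_average_le => //; rewrite -(ltr0n R).
have aC1 i : `|a 0 i| <= C1.
  rewrite mxE; have bp := bPhi i; rewrite ler_norml; apply/andP; split.
    rewrite -[leLHS](Rint_cst mu); apply: Rint_le => //; first exact: bmeas_cst.
    by move=> x; have := C1P i x; rewrite ler_norml => /andP[? _]; lra.
  rewrite -[leRHS](Rint_cst mu); apply: Rint_le => //; first exact: bmeas_cst.
  by move=> x; have := C1P i x; rewrite ler_norml => /andP[_ ?]; lra.
have Fa : F a <= M by rewrite (le_trans (ler_norm _))// FM.
rewrite -(integral_label mu (fun k => F (v k)) mq).
have bind i : bmeas (\1_(B i) : X -> R) by exact: bmeas_indic.
have bsum : bmeas (fun x => \sum_i \1_(B i) x : R) by apply: bmeas_sum => i _.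
apply: (@le_trans _ _ (\int[mu]_x ((F a - e / 2) - (2 * M) * \sum_i \1_(B i) x))).
  rewrite RintB ?Rint_cst; [|exact: bmeas_cst|exact: bmeasZ].
  rewrite RintZ// Rint_sum; last by move=> i _.
  have : \sum_i \int[mu]_x (\1_(B i) x : R) <= e / (4 * M).
    apply: (@le_trans _ _ (\sum_(i < d) e / (4 * M * d.+1%:R))).
      by apply: ler_sum => i _; rewrite integral_indicE// ltW// dev.
    rewrite sumr_const card_ord -[leLHS]mulr_natr invfM mulrA -[leLHS]mulrA.
    apply: ler_piMr; first by rewrite divr_ge0 ?(ltW e0)// mulr_ge0 ?(ltW M0).
    by rewrite mulrC ler_pdivrMr// mul1r ler_nat.
  have M20 : 0 < 2 * M by rewrite mulr_gt0.
  move=> /(ler_wpM2l (ltW M20)); rewrite (_ : 2 * M * (e / (4 * M)) = e / 2); last first.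
    by field; rewrite gt_eqF.
  lra.
apply: Rint_le.
- by apply: bmeasB; [exact: bmeas_cst|exact: bmeasZ].
- exact: (bmeas_label (fun k => F (v k))).
move=> x; have [[i Bix]|nB] := pselect (exists i, B i x).
  have : (1 : R) <= \sum_i \1_(B i) x.
    by rewrite (bigD1 i)//= indicE mem_set// lerDl sumr_ge0.
  have M20 : 0 < 2 * M by rewrite mulr_gt0.
  move=> /(ler_wpM2l (ltW M20)); rewrite mulr1.
  have : `|F (v (q x))| <= M.
    apply: FM => j; have := qv x j; rewrite le_min => /andP[vx _].
    have := avC1 x j; rewrite (_ : v (q x) 0 j = birkhoff_sum T n (Phi j) x / n%:R -
      (birkhoff_sum T n (Phi j) x / n%:R - v (q x) 0 j)); last by ring.
    by move=> h; rewrite (le_trans (ler_normB _ _))//; lra.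
  rewrite ler_norml => /andP[? _]; lra.
rewrite big1 ?mulr0 ?subr0; last first.
  move=> i _; rewrite indicE memNset// => Bix; apply: nB; by exists i.
suff : `|F a - F (v (q x))| < e / 2 by rewrite ltr_norml => /andP[_ ?]; lra.
apply: rF => i; have := qv x i; rewrite le_min => /andP[_ vx].
have : `|birkhoff_sum T n (Phi i) x / n%:R - a 0 i| <= r / 4.
  by rewrite mxE leNgt; apply/negP => Bix; apply: nB; exists i.
move: vx; rewrite !ler_norml ltr_norml => /andP[? ?] /andP[? ?].
by apply/andP; split; lra.
Unshelve. all: by end_near. Qed.

End ErgodicAverages.

Lemma limn_esup_ge (R : realType) (u : nat -> \bar R) (c : \bar R) :
  (\forall n \near \oo, (c <= u n)%E) -> (c <= limn_esup u)%E.
Proof.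
move=> cu; apply: le_ereal_inf_tmp => _ [V [N _ NV] <-].
have [n [cn Nn]] : exists n, (c <= u n)%E /\ (N <= n)%N.
  near \oo => n; exists n; split; first by near: n.
  by near: n; exists N.
by apply: (le_trans cn); apply: ereal_sup_ubound; exists n => //; exact: NV.
Unshelve. all: by end_near. Qed.

Lemma limn_esup_gt (R : realType) (u : nat -> \bar R) (c : \bar R) :
  (c < limn_esup u)%E -> forall N, exists2 n, (N <= n)%N & (c < u n)%E.
Proof.
move=> cu N; have : (c < ereal_sup (u @` [set n | (N <= n)%N]))%E.
  apply: (lt_le_trans cu); apply: ereal_inf_lbound; exists [set n | (N <= n)%N] => //.
  by exists N.
by move=> /ereal_sup_gt[_ [n Nn <-] cn]; exists n.
Qed.

(** * The pressure at a fixed scale and its limit *)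

Section Pressure.
Context {R : realType} {X : pmetricType R}.
Variables (T : X -> X) (d : nat) (Phi : 'I_d -> X -> R) (F : 'rV[R]_d -> R).

Let w n x : R := expR (n%:R * F (\row_i (birkhoff_sum T n (Phi i) x / n%:R))).

Lemma separated_sum_seq n (E : seq X) : uniq E ->
  separated_sum T Phi F n [set` E] = (\sum_(x <- E) w n x)%:E.
Proof.
move=> uE; rewrite /separated_sum esum_fset//; last exact: finite_seq.
by rewrite -fsbig_seq// sumEFin.
Qed.

Lemma separated_sup_ge0 n (e : R) :
  (0 <= ereal_sup [set separated_sum T Phi F n E | E in dn_separated T n e])%E.
Proof.
apply: ereal_sup_ubound; exists set0 => //.
by rewrite /separated_sum esum_set0.
Qed.

Lemma lne_le (x y : \bar R) : (0 <= x)%E -> (x <= y)%E -> (lne x <= lne y)%E.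
Proof.
move=> x0 xy; rewrite lee_lne// in_itv/= leey andbT//.
exact: le_trans xy.
Qed.

Lemma pressure_at_noninc : nonincreasing_fun (pressure_at T Phi F).
Proof.
move=> y x yx; apply: le_ereal_inf_tmp => _ [V NV <-].
apply: (@le_trans _ _ (ereal_sup ((fun n => (n%:R^-1)%:E *
  lne (ereal_sup [set separated_sum T Phi F n E | E in dn_separated T n x]))%E @` V))).
  by apply: ereal_inf_lbound; exists V.
apply: ge_ereal_sup => _ [n Vn <-].
apply: (@le_trans _ _ ((n%:R^-1)%:E *
  lne (ereal_sup [set separated_sum T Phi F n E | E in dn_separated T n y]))%E); last first.
  by apply: ereal_sup_ubound; exists n.
apply: lee_wpmul2l; first by rewrite lee_fin invr_ge0.
apply: lne_le; first exact: separated_sup_ge0.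
apply: ge_ereal_sup => _ [E sE <-]; apply: ereal_sup_ubound.
by exists E => // a b Ea Eb ab; apply: le_lt_trans yx _; exact: sE.
Qed.

(** By monotonicity in the scale the limit is a supremum, so every single scale bounds the pressure
    from below. *)
Lemma nonlinear_pressureE :
  nonlinear_pressure T Phi F = ereal_sup (pressure_at T Phi F @` `]0, +oo[%classic).
Proof.
apply/cvg_lim => //; apply: (nonincreasing_at_right_cvge +oo%O) => //.
by move=> x y _ _; exact: pressure_at_noninc.
Qed.

Lemma pressure_at_ge (e c : R) :
  (\forall n \near \oo, exists2 E : seq X, [/\ uniq E, dn_separated T n e [set` E] & E != [::]] &
    n%:R * c <= ln (\sum_(x <- E) w n x)) ->
  (c%:E <= pressure_at T Phi F e)%E.
Proof.
move=> h; apply: limn_esup_ge; apply: filter_app h; near=> n => -[E [uE sE E0] Ec].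
have n0 : 0 < n%:R :> R by rewrite ltr0n; near: n; exists 1%N.
have cE : c%:E = ((n%:R^-1)%:E * (n%:R * c)%:E)%E by rewrite -EFinM mulKf// gt_eqF.
rewrite cE; apply: lee_wpmul2l; first by rewrite lee_fin invr_ge0 ltW.
(* Nonemptiness of [E] makes the sum positive, which is where [lne] is computed by [ln]. *)
have Z0 : 0 < \sum_(x <- E) w n x.
  case: (E) E0 => // x s _; rewrite big_cons; apply: ltr_pwDl; first exact: expR_gt0.
  by apply: sumr_ge0 => *; exact: expR_ge0.
apply: (@le_trans _ _ (lne (\sum_(x <- E) w n x)%:E)).
  by rewrite lne_EFin// lee_fin.
apply: lne_le; first by rewrite lee_fin ltW.
by rewrite -separated_sum_seq//; apply: ereal_sup_ubound; exists [set` E].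
Unshelve. all: by end_near. Qed.

End Pressure.

(** * From partitions to separated sums *)

Section LowerBound.
Context {R : realType} {X : pmetricType R}.
Notation borelX := (@borel R X).
Notation prob := (@borel_probability R X).
Variables (T : X -> X) (d : nat) (Phi : 'I_d -> X -> R) (F : 'rV[R]_d -> R).
Hypothesis cX : compact [set: X].
Hypothesis cT : continuous T.
Hypothesis cPhi : forall i, continuous (Phi i).
Hypothesis cF : continuous F.
Let mT := continuous_borel cT.
Implicit Types mu : prob.

(** Each fibre is approximated from inside by a closed set [K i], up to mass [del / m]. Disjoint
    closed sets of a compact space are at positive distance, so the label is locally constant at a
    uniform scale off [bad], the complement of the union of the [K i]. *)
Lemma label_compact_approx mu m (l : X -> 'I_m) (del : R) : mlabel l -> 0 < del ->
  exists bad : set borelX, [/\ measurable bad, fine (mu bad) <= del &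
    \forall e \near (0 : R)^'+, forall x y, ~ bad x -> ~ bad y -> mdist x y < e -> l x = l y].
Proof.
move=> ml del0; have m0 : (0 < m)%N by case: (l point) => k; case: m {l ml}.
have kap0 : 0 < del / m%:R by rewrite divr_gt0// ltr0n.
have /choice[K /choice[V KV]] : forall i, exists K V : set X,
  [/\ closed K, open V, K `<=` l @^-1` [set i], l @^-1` [set i] `<=` V &
  (mu (V `\` K) < (del / m%:R)%:E)%E].
  by move=> i; exact: (borel_regular mu (ml i) kap0).
have mK i : measurable (K i : set borelX) by apply: closed_borel; have [] := KV i.
have mV i : measurable (V i : set borelX) by apply: open_borel; have [] := KV i.
pose bad : set borelX := [set x | ~ K (l x) x].
have badE : bad = ~` (\big[setU/set0]_i K i).
  apply/seteqP; split => x /= h.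
    rewrite -bigcup_seq => -[i /= _ Kx]; apply: h.
    by have [_ _ Kl _ _] := KV i; rewrite (Kl x Kx).
  move=> Kx; apply: h; rewrite -bigcup_seq; exists (l x) => //=.
  by rewrite mem_index_enum.
have mbad : measurable bad.
  by rewrite badE; apply: measurableC; apply: bigsetU_measurable.
exists bad; split => //.
  have mVK i : measurable (V i `\` K i : set borelX) by exact: measurableD.
  rewrite -integral_indicE//.
  apply: (@le_trans _ _ (\int[mu]_x (\sum_i \1_(V i `\` K i) x))).
    apply: Rint_le; [exact: bmeas_indic| |].
      by apply: bmeas_sum => i _; exact: bmeas_indic.
    move=> x; rewrite indicE; case: (boolP (x \in bad)) => [/set_mem xb|_] /=.
      rewrite (bigD1 (l x))//= indicE mem_set/= ?lerDl ?sumr_ge0//.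
      by split => //; have [_ _ _ + _] := KV (l x); apply.
    by rewrite sumr_ge0.
  rewrite Rint_sum; last by move=> i _; exact: bmeas_indic.
  apply: (@le_trans _ _ (\sum_(i < m) del / m%:R)).
    apply: ler_sum => i _; rewrite integral_indicE//.
    rewrite -lee_fin fineK ?fin_num_measure//; apply/ltW.
    by have [] := KV i.
  by rewrite sumr_const card_ord -[leLHS]mulr_natr divfK// pnatr_eq0 -lt0n.
have : \forall e \near (0 : R)^'+, forall i j, i != j ->
    forall x y, K i x -> K j y -> e <= mdist x y.
  apply: filter_forall => i; apply: filter_forall => j.
  have [->|ij] := eqVneq i j; first by apply: nearW.
  have : \forall e \near (0 : R)^'+, forall x y, K i x -> K j y -> e <= mdist x y.
    apply: closed_separation => //; [by have [] := KV i|by have [] := KV j|].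
    apply/seteqP; split => // x [Ki Kj]; move/eqP: ij; apply.
    have [_ _ Kl _ _] := KV i; have [_ _ Kl' _ _] := KV j.
    by rewrite -(Kl x Ki) -(Kl' x Kj).
  by apply: filterS => e he _.
apply: filterS => e he x y /contrapT Kx /contrapT Ky xy; apply/eqP/negPn/negP => lxy.
by have := he _ _ lxy x y Kx Ky; rewrite leNgt xy.
Qed.

Lemma birkhoff_close n x y (f : X -> R) (e eta : R) : 0 <= e ->
  (forall x y, mdist x y <= e -> `|f x - f y| <= eta) ->
  bowen_dist T n x y <= e -> (0 < n)%N ->
  `|birkhoff_sum T n f x / n%:R - birkhoff_sum T n f y / n%:R| <= eta.
Proof.
move=> e0 fe /(bowen_dist_le T n x y e0) xy n0.
have n0R : 0 < n%:R :> R by rewrite ltr0n.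
rewrite -mulrBl normrM normfV [X in _ / X]ger0_norm ?(ltW n0R)// ler_pdivrMr//.
rewrite /birkhoff_sum -sumrB (le_trans (ler_norm_sum _ _ _))//.
apply: (@le_trans _ _ (\sum_(k < n) eta)).
  by apply: ler_sum => k _; apply: fe; exact: xy.
by rewrite sumr_const card_ord mulr_natr.
Qed.

(** The letter at time [j] is guessed from the net point; the guess fails only when [iter j T x]
    lies in [bad], whose mass [del / c1] keeps the penalties below [n * del]. The three [del] pay
    for the normalization in [gibbs_partition], for these penalties, and for the error of
    [subaverage]. *)
Lemma pressure_ge_entropy mu m (l : X -> 'I_m) (del : R) :
  invariant_measures T mu -> subaverage T Phi F mu -> mlabel l -> 0 < del ->
  exists2 e : R, 0 < e & \forall n \near \oo,
  exists2 E : seq X, [/\ uniq E, dn_separated T n e [set` E] & E != [::]] &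
    entropy mu (itin T l n) + n%:R * (F (integral_vec Phi mu) - 3 * del) <=
    ln (\sum_(x <- E) expR (n%:R * F (\row_i (birkhoff_sum T n (Phi i) x / n%:R)))).
Proof.
move=> imu sub ml del0; have m0 : (0 < m)%N by case: (l point) => k; case: m {l ml}.
have m0R : 0 < m%:R :> R by rewrite ltr0n.
(* Large enough that [m * exp (- c1) <= m / (1 + c1) <= del]. *)
pose c1 : R := m%:R / del.
have c10 : 0 < c1 by rewrite divr_gt0.
have c01 : m%:R * expR (- c1) <= del.
  rewrite expRN ler_pdivrMr ?expR_gt0//.
  have := expR_ge1Dx c1; have -> : m%:R = del * c1 by rewrite mulrC divfK// gt_eqF.
  by move=> h; rewrite ler_pM2l//; lra.
have [eta eta0 subn] := sub del del0.
have [bad [mbad bad_le badP]] := @label_compact_approx mu m l (del / c1) ml (divr_gt0 del0 c10).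
have unif : \forall e \near (0 : R)^'+, forall i, forall x y, mdist x y <= e -> `|Phi i x - Phi i y| <= eta.
  by apply: filter_forall => i; exact: continuous_uniform.
have [e' [e'0 sep un]] : exists e' : R, [/\ 0 < e',
    forall x y, ~ bad x -> ~ bad y -> mdist x y < e' -> l x = l y &
    forall i x y, mdist x y <= e' -> `|Phi i x - Phi i y| <= eta].
  near (0 : R)^'+ => e'; exists e'; split.
  - by near: e'; exact: nbhs_right_gt.
  - exact: (near badP e').
  - exact: (near unif e').
(* Two points with the same net point stay within [4 * e] of each other, which must be below the
   scale [e'] of the label. *)
pose e := e' / 5; have e0 : 0 < e by rewrite divr_gt0.
exists e => //; apply: filter_app subn; near=> n => subn.
have n0 : (0 < n)%N by near: n; exists 1%N.
have [E [uE sE netE]] := separated_net cX n cT e0.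
have E0 : E != [::] by case: (netE point) => x; case: (E).
exists E => //.
pose K := 'I_(size E); pose z (k : K) := nth point E k.
have [q [mq qP]] : exists q : X -> K, mlabel q /\
    forall x, bowen_dist T n (z (q x)) x <= 2 * e.
  apply: (mlabel_cover (B := fun k => [set x | bowen_dist T n (z k) x <= 2 * e])).
    move=> k; apply: closed_borel.
    apply: (closed_comp (f := bowen_dist T n (z k)) (D := [set y | y <= 2 * e])).
      by move=> x _; exact: bowen_dist_continuous.
    exact: closed_le.
  move=> x; have [y yE yx] := netE x.
  have iE : (index y E < size E)%N by rewrite index_mem.
  by exists (Ordinal iE); rewrite /= /z/= nth_index.
pose v (k : K) : 'rV[R]_d := \row_i (birkhoff_sum T n (Phi i) (z k) / n%:R).
have qv : average_close T Phi n eta q v.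
  move=> x i; rewrite mxE distrC.
  apply: (@birkhoff_close n _ _ (Phi i) (2 * e)) => //; first by rewrite mulr_ge0 ?(ltW e0).
  by move=> y y' yy'; apply: un; rewrite (le_trans yy')// /e; lra.
have {}subn := subn K q v mq qv.
(* The common letter at time [j] of the points of cell [k] that are then outside [bad]; [l point] is
   a default for cells without such points. *)
pose g (k : K) (j : 'I_n) : 'I_m :=
  odflt (l point) [pick i | `[< exists y, [/\ q y = k, ~ bad (iter j T y) & l (iter j T y) = i] >]].
have gP x (j : 'I_n) : ~ bad (iter j T x) -> l (iter j T x) = g (q x) j.
  move=> bx; rewrite /g; case: pickP => [i /asboolP[y [yx by_ <-]]|/(_ (l (iter j T x)))] /=.
    apply: sep => //; apply: (@le_lt_trans _ _ (4 * e)); last by rewrite /e; lra.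
    have e20 : 0 <= 2 * e by rewrite mulr_ge0 ?(ltW e0).
    have := (bowen_dist_le T n _ _ e20).1 (qP x) j (ltn_ord j).
    have := (bowen_dist_le T n _ _ e20).1 (qP y) j (ltn_ord j).
    rewrite yx => h1; rewrite metric_sym => h2.
    by rewrite (le_trans (metric_triangle _ (iter j T (z (q x))) _))//; lra.
  by move=> /negP; case; apply/asboolP; exists x.
have := @gibbs_partition R X T mT mu m n l K q (fun k => n%:R * F (v k)) g del c1 ml mq c01.
have -> : \sum_k expR (n%:R * F (v k)) = \sum_(x <- E)
    expR (n%:R * F (\row_i (birkhoff_sum T n (Phi i) x / n%:R))).
  by rewrite (big_nth point) big_mkord.
have -> : \sum_k law mu q k * (n%:R * F (v k)) = n%:R * \sum_k law mu q k * F (v k).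
  by rewrite mulr_sumr; apply: eq_bigr => k _; rewrite mulrCA.
set S := \sum_(j < n) _ => h.
have S_le : c1 * S <= n%:R * del.
  have -> : n%:R * del = c1 * (n%:R * (del / c1)) by field; rewrite gt_eqF.
  rewrite ler_pM2l//; apply: (@le_trans _ _ (\sum_(j < n) (del / c1))); last first.
    by rewrite sumr_const card_ord mulr_natl.
  apply: ler_sum => j _; apply: le_trans bad_le.
  have bb : bmeas (\1_bad : X -> R) by exact: bmeas_indic.
  rewrite -(integral_indicE mu mbad) -(integral_invariant_iter mT j imu bb).
  have mA : measurable ([set x | l (iter j T x) != g (q x) j] : set borelX).
    exact: (mlabel_preimage [set p | p.1 != g p.2 j] (mlabel_pair (mlabel_iter mT j ml) mq)).
  rewrite -(integral_indicE mu mA); apply: Rint_le; first exact: bmeas_indic.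
    exact: (bmeas_comp_iter mT j bb).
  move=> x; rewrite !indicE ler_nat; case: (boolP (x \in _)) => // /set_mem /= lx.
  rewrite mem_set//; apply: contrapT => /gP lE; move: lx; rewrite lE eqxx.
  by [].
have n0R : 0 < n%:R :> R by rewrite ltr0n.
have := ler_wpM2l (ltW n0R) subn; rewrite mulrBr => h2.
by rewrite mulrBr mulrCA; lra.
Unshelve. all: by end_near. Qed.

Lemma pressure_ge_partition mu m (l : X -> 'I_m) (h : R) :
  invariant_measures T mu -> subaverage T Phi F mu -> mlabel l ->
  n%:R^-1 * entropy mu (itin T l n) @[n --> \oo] --> h ->
  ((h + F (integral_vec Phi mu))%:E <= nonlinear_pressure T Phi F)%E.
Proof.
move=> imu sub ml hl; apply/lee_addgt0Pr => del4 del40.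
(* Three quarters go to [pressure_ge_entropy], one to the convergence towards [h]. *)
pose del := del4 / 4; have del0 : 0 < del by rewrite divr_gt0.
have [e e0 he] := pressure_ge_entropy imu sub ml del0.
rewrite -leeBlDr// -EFinB nonlinear_pressureE.
apply: (@le_trans _ _ (pressure_at T Phi F e)); last first.
  by apply: ereal_sup_ubound; exists e => //=; rewrite in_itv/= e0.
apply: pressure_at_ge; apply: filter_app he; near=> n => -[E EP HE]; exists E => //.
apply: le_trans HE.
have n0 : 0 < n%:R :> R by rewrite ltr0n; near: n; exists 1%N.
have hn : h - del < n%:R^-1 * entropy mu (itin T l n).
  by near: n; apply: (cvgr_gt _ hl); lra.
have : n%:R * (h - del) <= entropy mu (itin T l n).
  by rewrite -ler_pdivlMl// ltW.
have -> : n%:R * (h + F (integral_vec Phi mu) - del4) =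
  n%:R * (h - del) + n%:R * (F (integral_vec Phi mu) - 3 * del).
  by rewrite -mulrDr; congr (_ * _); rewrite /del; lra.
by rewrite lerD2r.
Unshelve. all: by end_near. Qed.

Lemma pressure_ge mu : invariant_measures T mu -> subaverage T Phi F mu ->
  (KS_entropy T mu + (F (integral_vec Phi mu))%:E <= nonlinear_pressure T Phi F)%E.
Proof.
move=> imu sub; rewrite -leeBrDr//; apply: ge_ereal_sup => _ [m [P [PP ->]]].
have [l [ml lE]] := partition_label PP.
rewrite leeBrDr// -EFinD; apply: (pressure_ge_partition imu sub ml).
exact: partition_entropy_cvg.
Qed.

End LowerBound.

(** * Upper bound for the pressure *)

Section Jordan.
Context {R : realType} {X : pmetricType R}.
Notation borelX := (@borel R X).
Notation prob := (@borel_probability R X).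
Implicit Types (mu : prob) (A B : set X).
Hypothesis cX : compact [set: X].

(* [A] has a [mu]-null boundary, phrased through continuous functions. *)
Definition jordan mu A := forall e : R, 0 < e -> exists f g : X -> R,
  [/\ continuous f, continuous g,
      forall x, 0 <= f x /\ g x <= 1,
      forall x, f x <= \1_A x <= g x &
      \int[mu]_x (g x - f x) < e].

Lemma jordan_setC mu A : jordan mu A -> jordan mu (~` A).
Proof.
move=> jA e /jA[f [g [cf cg fg Afg I]]].
exists (fun x => 1 - g x), (fun x => 1 - f x); split.
- by move=> x; apply: cvgB; [exact: cvg_cst|exact: cg].
- by move=> x; apply: cvgB; [exact: cvg_cst|exact: cf].
- by move=> x; have [? ?] := fg x; split; lra.
- move=> x; have := Afg x; rewrite !indicE in_setC; case: (x \in A) => /=.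
    by move=> /andP[? ?]; apply/andP; split; lra.
  by move=> /andP[? ?]; apply/andP; split; lra.
- apply: le_lt_trans I; rewrite (@Rint_ext _ _ mu _ (fun x => g x - f x))// => x; ring.
Qed.

Lemma jordan_setI mu A B : jordan mu A -> jordan mu B -> jordan mu (A `&` B).
Proof.
move=> jA jB e e0; have e20 : 0 < e / 2 by rewrite divr_gt0.
have [f [g [cf cg fg Afg I]]] := jA _ e20.
have [f' [g' [cf' cg' fg' Afg' I']]] := jB _ e20.
exists (fun x => f x * f' x), (fun x => g x * g' x); split.
- by move=> x; apply: cvgM; [exact: cf|exact: cf'].
- by move=> x; apply: cvgM; [exact: cg|exact: cg'].
- move=> x; have [? ?] := fg x; have [? ?] := fg' x.
  have /andP[? ?] := Afg x; have /andP[? ?] := Afg' x.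
  split; first by rewrite mulr_ge0.
  have : 0 <= \1_A x :> R by rewrite indicE.
  have : 0 <= \1_B x :> R by rewrite indicE.
  by move=> *; rewrite mulr_ile1//; lra.
- move=> x; have /andP[? ?] := Afg x; have /andP[? ?] := Afg' x.
  have [? ?] := fg x; have [? ?] := fg' x.
  by rewrite indicI; apply/andP; split; rewrite /= ler_pM// indicE.
- have bfg : bmeas (fun x => g x - f x).
    by apply: bmeasB; exact: continuous_bmeas.
  have bfg' : bmeas (fun x => g' x - f' x).
    by apply: bmeasB; exact: continuous_bmeas.
  rewrite [e]splitr; apply: (@le_lt_trans _ _ (\int[mu]_x ((g x - f x) + (g' x - f' x)))).
    apply: Rint_le; last 2 first.
    + exact: bmeasD.
    + move=> x; have [? ?] := fg x; have [? ?] := fg' x.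
      have /andP[? ?] := Afg x; have /andP[? ?] := Afg' x.
      have : 0 <= \1_A x :> R by rewrite indicE.
      have : 0 <= \1_B x :> R by rewrite indicE.
      move=> *; have -> : g x * g' x - f x * f' x =
        (g x - f x) * g' x + f x * (g' x - f' x) by ring.
      apply: lerD; first by rewrite ler_piMr//; lra.
      by rewrite ler_piMl//; lra.
    by apply: bmeasB; apply: bmeasM; exact: continuous_bmeas.
  by rewrite RintD// ltrD.
Qed.

Lemma jordan_setT mu : jordan mu setT.
Proof.
move=> e e0; exists (fun=> 1), (fun=> 1); split.
- by move=> x; exact: cvg_cst.
- by move=> x; exact: cvg_cst.
- by move=> x; split.
- by move=> x; rewrite indicT lexx.
- by rewrite subrr Rint_cst.
Qed.

Lemma jordan_forall mu (I : finType) (A : I -> set X) :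
  (forall i, jordan mu (A i)) -> jordan mu [set x | forall i, A i x].
Proof.
move=> jA; have : forall s : seq I, jordan mu [set x | forall i, i \in s -> A i x].
  elim=> [|i s ih].
    by rewrite (_ : [set x | _] = setT); [exact: jordan_setT|apply/seteqP; split].
  rewrite (_ : [set x | _] = A i `&` [set x | forall i, i \in s -> A i x]).
    exact: jordan_setI.
  apply/seteqP; split => x /=.
    by move=> h; split=> [|j js]; apply: h; rewrite inE ?eqxx// js orbT.
  by move=> [Ai h] j; rewrite inE => /predU1P[->//|/h].
move=> /(_ (index_enum I)); rewrite (_ : [set x | _] = [set x | forall i, A i x])//.
apply/seteqP; split => x /= h i; last by move=> _; exact: h.
by apply: h; rewrite mem_index_enum.
Qed.

Lemma jordan_preimage mu (T : X -> X) A : continuous T ->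
  invariant_measures T mu -> jordan mu A -> jordan mu (T @^-1` A).
Proof.
move=> cT imu jA e /jA[f [g [cf cg fg Afg I]]].
exists (f \o T), (g \o T); split.
- by move=> x; apply: continuous_comp; [exact: cT|exact: cf].
- by move=> x; apply: continuous_comp; [exact: cT|exact: cg].
- by move=> x; exact: fg.
- by move=> x; have := Afg (T x).
- have bfg : bmeas (fun x => g x - f x) by apply: bmeasB; exact: continuous_bmeas.
  by rewrite (integral_invariant (continuous_borel cT) imu bfg).
Qed.

(** The portmanteau principle: masses of [A] are squeezed between integrals of [f] and [g], which
    converge to limits less than [e / 2] apart. *)
Lemma jordan_cvg mu (I : Type) (U : set_system I) (nu : I -> prob) (A : set borelX) :
  Filter U -> measurable A -> jordan mu A ->
  (forall f : X -> R, continuous f -> (fun i => \int[nu i]_x f x) @ U --> \int[mu]_x f x) ->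
  (fun i => fine (nu i A)) @ U --> fine (mu A).
Proof.
move=> FU mA jA numu; apply/cvgrPdist_lt => e e0.
have e20 : 0 < e / 2 by rewrite divr_gt0.
have [f [g [cf cg fg Afg Ifg]]] := jA _ e20.
have bf := continuous_bmeas cX cf; have bg := continuous_bmeas cX cg.
have bA : bmeas (\1_A : X -> R) by exact: bmeas_indic.
have le_f (rho : prob) : \int[rho]_x f x <= fine (rho A).
  by rewrite -integral_indicE//; apply: Rint_le => // x; have /andP[] := Afg x.
have le_g (rho : prob) : fine (rho A) <= \int[rho]_x g x.
  by rewrite -integral_indicE//; apply: Rint_le => // x; have /andP[] := Afg x.
have /cvgrPdist_lt/(_ _ e20) hf := numu f cf.
have /cvgrPdist_lt/(_ _ e20) hg := numu g cg.
rewrite RintB// in Ifg.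
near=> i.
have : `|\int[mu]_x f x - \int[nu i]_x f x| < e / 2 by near: i.
have : `|\int[mu]_x g x - \int[nu i]_x g x| < e / 2 by near: i.
have := le_f mu; have := le_f (nu i); have := le_g mu; have := le_g (nu i).
rewrite !ltr_norml => ? ? ? ? /andP[? ?] /andP[? ?].
by apply/andP; split; lra.
Unshelve. all: by end_near. Qed.

Lemma sphere_measurable (x : X) (r : R) : measurable ([set y | mdist x y = r] : set borelX).
Proof.
apply: closed_borel; apply: (closed_comp (f := mdist x) (D := [set z | z = r])).
  by move=> y _; exact: mdist_continuous.
exact: closed_eq.
Qed.

(** Spheres of distinct radii are disjoint, so at most [k] of them have mass above [1 / k.+1]. Only
    countably many radii are charged, whereas the interval []0, e[] has positive Lebesgue
    measure. *)
Lemma null_sphere mu (x : X) (e : R) : 0 < e ->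
  exists2 r : R, 0 < r < e & mu [set y | mdist x y = r] = 0%E.
Proof.
move=> e0; apply: contrapT => no.
pose S r : set borelX := [set y | mdist x y = r].
have mS r : measurable (S r) by exact: sphere_measurable.
pose D k := [set r : R | 0 < r < e /\ k.+1%:R^-1 < fine (mu (S r))].
have D_fin k : finite_set (D k).
  apply: contrapT => /infiniteP/pcard_leP/injfunPex[f fD finj].
  pose F (i : 'I_k.+1) := S (f i).
  have tF : trivIset setT F.
    move=> i j _ _ [y [/= yi yj]]; apply: val_inj; apply: finj; rewrite ?inE//.
    by rewrite -yi -yj.
  have := @fine_prob_sum _ _ mu 'I_k.+1 F xpredT (fun i => mS (f i)) tF.
  have DF (i : 'I_k.+1) : k.+1%:R^-1 < fine (mu (F i)) by have [] := fD (i : nat) I.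
  have le1 : fine (mu (\big[setU/set0]_(i < k.+1) F i)) <= 1.
    have mU : measurable (\big[setU/set0]_(i < k.+1) F i).
      by apply: bigsetU_measurable => i _; exact: mS.
    by rewrite -lee_fin fineK ?fin_num_measure ?probability_le1.
  move=> sE; move: le1; rewrite sE; apply/negP; rewrite -ltNge.
  apply: (@le_lt_trans _ _ (\sum_(i < k.+1) (k.+1%:R^-1 : R))).
    by rewrite sumr_const card_ord -[leRHS]mulr_natr mulVf.
  apply: ltr_sum => //; by apply/hasP; exists ord0; rewrite ?mem_index_enum.
have DU : `]0, e[%classic `<=` \bigcup_k D k.
  move=> r /=; rewrite in_itv/= => re.
  have Sr : 0 < fine (mu (S r)).
    rewrite lt_neqAle fine_ge0// andbT eq_sym; apply/eqP => S0; apply: no.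
    by exists r => //; rewrite -/(S r) -[LHS]fineK ?S0// fin_num_measure.
  exists (Num.truncn (fine (mu (S r)))^-1) => //; split => //.
  by rewrite -[ltRHS]invrK ltf_pV2 ?posrE ?invr_gt0//; exact: truncnS_gt.
have cD : countable (\bigcup_k D k).
  by apply: bigcup_countable => // k _; exact: finite_set_countable.
have l0 : lebesgue_measure (`]0, e[%classic : set R) = 0%E.
  by apply: countable_lebesgue_measure0; exact: sub_countable (subset_card_le DU) cD.
move: l0; rewrite lebesgue_measure_itv/= lte_fin e0 oppr0 adde0 => -[].
by move=> e00; rewrite e00 ltxx in e0.
Qed.

(** [f] and [g] are ramps of slope [j.+1] in the distance, inside and outside radius [r]. They
    differ only on the shell of half-width [1 / j.+1], whose mass tends to that of the sphere. *)
Lemma jordan_ball mu (x : X) (r : R) : 0 < r -> mu [set y | mdist x y = r] = 0%E ->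
  jordan mu [set y | mdist x y < r].
Proof.
move=> r0 mur e e0.
pose A (j : nat) : set borelX := [set y | `|mdist x y - r| <= j.+1%:R^-1].
have cd : continuous (fun y => mdist x y - r : R).
  by move=> y; apply: cvgB; [exact: mdist_continuous|exact: cvg_cst].
have mA j : measurable (A j).
  apply: closed_borel; apply: (closed_comp (f := fun y => `|mdist x y - r|)
    (D := [set z | z <= j.+1%:R^-1])); last exact: closed_le.
  by move=> y _; apply: cvg_norm; exact: cd.
have AE : \bigcap_j A j = [set y | mdist x y = r].
  apply/seteqP; split => y /=; last by move=> yr j _; rewrite /A/= yr subrr normr0 invr_ge0.
  move=> Ay; apply/eqP; rewrite -subr_eq0 -normr_eq0 eq_le normr_ge0 andbT.
  apply/ler_addgt0Pr => d d0; rewrite add0r.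
  apply: (le_trans (Ay (Num.truncn d^-1) I)).
  by rewrite -[leRHS]invrK lef_pV2 ?posrE ?invr_gt0//; apply/ltW; exact: truncnS_gt.
have : (mu \o A) @ \oo --> mu (\bigcap_j A j).
  apply: nonincreasing_cvg_mu => //.
  - by rewrite ltey_eq fin_num_measure.
  - exact: bigcap_measurable.
  - move=> m n mn; apply/subsetPset => y /= h; apply: (le_trans h).
    by rewrite lef_pV2 ?posrE// ler_nat.
rewrite AE mur => /fine_cvgP[_ /cvgr_lt/(_ _ e0)] [j _ /(_ j (leqnn j))/= Aj].
pose clamp (z : R) := Num.max 0 (Num.min 1 z).
have cclamp (h : X -> R) : continuous h -> continuous (fun y => clamp (h y)).
  move=> ch y; apply: (@continuous_max _ _ (fun=> 0) (fun y => Num.min 1 (h y))).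
    exact: cvg_cst.
  by apply: (@continuous_min _ _ (fun=> 1) h); [exact: cvg_cst|exact: ch].
have clamp0 z : z <= 0 -> clamp z = 0.
  by move=> z0; rewrite /clamp; apply/max_idPl; rewrite ge_min z0 orbT.
have clamp1 z : 1 <= z -> clamp z = 1.
  by move=> z1; rewrite /clamp (min_idPl z1); apply/max_idPr.
have clamp01 z : 0 <= clamp z <= 1.
  by rewrite /clamp le_max lexx/= ge_max ler01 ge_min lexx.
pose t y := j.+1%:R * (r - mdist x y).
have ct : continuous t.
  move=> y; apply: cvgM; first exact: cvg_cst.
  by apply: cvgB; [exact: cvg_cst|exact: mdist_continuous].
have jp : 0 < j.+1%:R :> R by [].
exists (fun y => clamp (t y)), (fun y => clamp (1 + t y)); split.
- exact: cclamp.
- apply: cclamp => y; apply: cvgD; [exact: cvg_cst|exact: ct].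
- by move=> y; split; [have /andP[] := clamp01 (t y)|have /andP[] := clamp01 (1 + t y)].
- move=> y; rewrite indicE; case: (boolP (y \in _)) => [/set_mem/= xy|/negP xy] /=.
    have ty : 0 <= t y by rewrite mulr_ge0// subr_ge0 ltW.
    by rewrite [clamp (1 + t y)]clamp1 ?lexx ?andbT ?lerDl//; have /andP[] := clamp01 (t y).
  have xy' : r <= mdist x y by rewrite leNgt; apply/negP => h; apply: xy; exact/mem_set.
  have ty : t y <= 0 by rewrite mulr_ge0_le0// subr_le0.
  by rewrite clamp0// lexx/=; have /andP[] := clamp01 (1 + t y).
apply: le_lt_trans Aj; rewrite -integral_indicE//; apply: Rint_le.
- by apply: bmeasB; apply: continuous_bmeas => //; apply: cclamp => // y;
    apply: cvgD; [exact: cvg_cst|exact: ct].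
- exact: bmeas_indic.
move=> y; rewrite indicE; case: (boolP (y \in _)) => [_|/negP yA] /=.
  have /andP[? ?] := clamp01 (t y); have /andP[? ?] := clamp01 (1 + t y); lra.
have : j.+1%:R^-1 < `|mdist x y - r|.
  by rewrite ltNge; apply/negP => h; apply: yA; exact/mem_set.
have jM (w : R) : j.+1%:R^-1 < w -> 1 < j.+1%:R * w.
  by rewrite -[X in X < _ -> _]mulr1 ltr_pdivrMl.
rewrite lter_normr => /orP[/jM h|/jM h].
  have ty : t y <= -1 by rewrite /t -opprB mulrN; lra.
  by rewrite !clamp0 ?subrr//; lra.
have ty : 1 <= t y by rewrite /t -(opprB (mdist x y)); lra.
by rewrite !clamp1 ?subrr//; lra.
Qed.

(** The label records which balls of a finite cover, of radii below [e / 2] and with null spheres,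
    contain the point. Only the vectors that occur are numbered, because the cells of a partition
    must be nonempty. *)
Lemma jordan_label mu (e : R) : 0 < e -> exists m (l : X -> 'I_m),
  [/\ mlabel l, forall i, jordan mu (l @^-1` [set i]), forall i, exists x, l x = i &
      forall x y, l x = l y -> mdist x y < e].
Proof.
move=> e0; have e20 : 0 < e / 2 by rewrite divr_gt0.
have /choice[r rP] : forall x, exists r : R, [/\ 0 < r, r < e / 2 &
    mu [set y | mdist x y = r] = 0%E].
  by move=> x; have [r /andP[? ?] ?] := null_sphere mu x e20; exists r.
have oB x : open [set y | mdist x y < r x].
  apply: (open_comp (f := mdist x) (D := [set z | z < r x])); last exact: open_lt.
  by move=> y _; exact: mdist_continuous.
move: (cX); rewrite compact_cover => /(_ X setT (fun x => [set y | mdist x y < r x])).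
case => [x _|x _|D _ DX].
- exact: oB.
- by exists x => //=; rewrite mdistxx; have [] := rP x.
pose E : seq X := finmap.enum_fset D.
pose z (k : 'I_(size E)) := nth point E k.
pose B k := [set y | mdist (z k) y < r (z k)].
pose b x : {ffun 'I_(size E) -> bool} := [ffun k => `[< B k x >]].
have mb : mlabel b.
  by apply: mlabel_ffun => k; apply: open_borel; exact: oB.
pose W := {ffun 'I_(size E) -> bool}.
pose S := {w : W | `[< exists x, b x = w >]}.
have bS x : `[< exists y, b y = b x >] by apply/asboolP; exists x.
pose l x : 'I_#|{: S}| := enum_rank (exist _ (b x) (bS x) : S).
pose ev (i : 'I_#|{: S}|) : W := sval (enum_val i).
have lE x : ev (l x) = b x by rewrite /ev enum_rankK.
have ev_inj : injective ev by move=> i j /val_inj/enum_val_inj.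
have lib i : l @^-1` [set i] = b @^-1` [set ev i].
  apply/seteqP; split => x /=; first by move=> <-; rewrite lE.
  by rewrite -lE => /ev_inj.
exists #|{: S}|, l; split.
- by move=> i; rewrite lib; exact: mb.
- move=> i; rewrite lib (_ : _ @^-1` _ =
      [set x | forall k, [set x | `[< B k x >] = ev i k] x]); last first.
    apply/seteqP; split => x /=; first by move=> <- k; rewrite ffunE.
    by move=> h; apply/ffunP => k; rewrite ffunE h.
  apply: jordan_forall => k; have jB : jordan mu (B k).
    by have [? _ ?] := rP (z k); exact: jordan_ball.
  case: (ev i k).
    rewrite (_ : [set x | _] = B k)//.
    by apply/seteqP; split => x /= /asboolP.
  rewrite (_ : [set x | _] = ~` B k); first exact: jordan_setC.
  by apply/seteqP; split => x/= => [/negbT/asboolPn|/asboolPn/negbTE].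
- move=> i; have /asboolP[x xi] := svalP (enum_val i); exists x.
  by apply: ev_inj; rewrite lE.
move=> x y lxy; have bxy : b x = b y by rewrite -!lE lxy.
have [w wD wx] := DX x I.
have iE : (index w E < size E)%N by rewrite index_mem.
pose k := Ordinal iE.
have zk : z k = w by rewrite /z/= nth_index.
have bx : b x k = true by rewrite ffunE; apply/asboolP; rewrite /B/= zk.
have : b y k = true by rewrite -bxy.
rewrite ffunE => /asboolP; rewrite /B/= zk => wy.
have [_ rw _] := rP w; rewrite (le_lt_trans (metric_triangle _ w _))//.
rewrite metric_sym [e]splitr; apply: ltrD; apply: lt_trans rw => //.
Qed.

End Jordan.

(** * Continuity of [t * ln t], including at 0 *)

Section XlnX.
Context {R : realType}.

(** For [t = s ^+ 2] with [s > 0], the left side is [2 * s ^+ 2 * ln (1 / s)], and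
    [ln (1 / s) <= 1 / s]. *)
Lemma norm_xlnx_le (t : R) : 0 <= t <= 1 -> `|t * ln t| <= 2 * Num.sqrt t.
Proof.
move=> /andP[]; rewrite le_eqVlt => /predU1P[<- _|t0 t1].
  by rewrite mul0r normr0 sqrtr0 mulr0.
have s0 : 0 < Num.sqrt t by rewrite sqrtr_gt0.
have tE : t = Num.sqrt t ^+ 2 by rewrite sqr_sqrtr// ltW.
rewrite ler0_norm; last by rewrite mulr_ge0_le0 ?(ltW t0)// ln_le0.
move: (Num.sqrt t) s0 tE => s s0 ->.
have : ln s^-1 <= s^-1 by rewrite ltW// ln_sublinear// invr_gt0.
rewrite lnV ?posrE// => /(ler_wpM2l (sqr_ge0 s)).
rewrite (_ : s ^+ 2 * s^-1 = s); last by rewrite expr2 -mulrA divff ?mulr1// gt_eqF.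
by rewrite lnXn// mulr2n; lra.
Qed.

Lemma cvg_xlnx (I : Type) (U : set_system I) (p : I -> R) (l : R) : ProperFilter U ->
  (forall i, 0 <= p i) -> p @ U --> l -> (fun i => p i * ln (p i)) @ U --> l * ln l.
Proof.
move=> FU p0 pl; have [l0|l0|l0] := ltgtP l 0; last 2 first.
- have lnpl : (fun i => ln (p i)) @ U --> ln l.
    exact: (cvg_comp _ _ pl (continuous_ln l0)).
  exact: (cvgM pl lnpl).
- subst l; rewrite mul0r; apply: norm_cvg0.
  apply: (squeeze_cvgr (f := fun=> 0) (h := fun i => 2 * Num.sqrt (p i))).
  + have p1 : \forall i \near U, p i < 1 by apply: (cvgr_lt _ pl).
    apply: filterS p1 => i pi1; rewrite normr_ge0/= norm_xlnx_le// p0/= ltW//.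
  + exact: cvg_cst.
  + have sq : (fun i => Num.sqrt (p i)) @ U --> Num.sqrt (0 : R).
      exact: (cvg_comp _ _ pl (@sqrt_continuous R 0)).
    have h : (fun i => 2 * Num.sqrt (p i)) @ U --> 2 * Num.sqrt (0 : R).
      by apply: cvgM; [exact: cvg_cst|exact: sq].
    by rewrite sqrtr0 mulr0 in h.
- have /filter_ex[i] : \forall i \near U, p i < 0 by apply: (cvgr_lt _ pl).
  by rewrite ltNge p0.
Qed.

End XlnX.

(** * Entropy of orbit averages *)

Section Misiurewicz.
Context {R : realType} {X : pmetricType R}.
Notation borelX := (@borel R X).
Notation prob := (@borel_probability R X).
Implicit Types (mu rho : prob).

Lemma entropy_cvg (I : Type) (U : set_system I) (nu : I -> prob) mu
    (K : finType) (f : X -> K) : ProperFilter U ->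
  (forall k, (fun i => law (nu i) f k) @ U --> law mu f k) ->
  (fun i => entropy (nu i) f) @ U --> entropy mu f.
Proof.
move=> FU h; rewrite /entropy; apply: cvgN.
elim: (index_enum K) => [|k s ih].
  by rewrite big_nil; under eq_fun do rewrite big_nil; exact: cvg_cst.
rewrite big_cons; under eq_fun do rewrite big_cons.
by apply: cvgD => //; apply: cvg_xlnx => // i; exact: law_ge0.
Qed.

(** [f] separates the [n] points that carry [rho], so no fibre has mass above [1 / n]. *)
Lemma entropy_uniform_ge rho (n : nat) (x : nat -> X) (K : finType) (f : X -> K) :
  mlabel f -> (0 < n)%N ->
  (forall i j, (i < n)%N -> (j < n)%N -> f (x i) = f (x j) -> i = j) ->
  (forall A : set borelX, measurable A -> fine (rho A) = n%:R^-1 * \sum_(i < n) \1_A (x i)) ->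
  ln n%:R <= entropy rho f.
Proof.
move=> mf n0 finj rhoE; have n0R : 0 < n%:R :> R by rewrite ltr0n.
have le1 k : law rho f k <= n%:R^-1.
  rewrite /law rhoE; last exact: mf.
  rewrite -[leRHS]mulr1 ler_wpM2l ?invr_ge0 ?(ltW n0R)//.
  have [[i xi]|no] := pselect (exists i : 'I_n, f (x i) = k).
    rewrite (bigD1 i)//= big1 ?addr0; last first.
      move=> j ji; rewrite indicE memNset// => /= xj; move/eqP: ji; apply.
      by apply: val_inj; exact: (finj _ _ (ltn_ord j) (ltn_ord i) (etrans xj (esym xi))).
    by rewrite indicE; case: (_ \in _).
  rewrite big1// => i _; rewrite indicE memNset// => /= xi; apply: no.
  by exists i.
have -> : ln n%:R = \sum_k law rho f k * ln n%:R.
  by rewrite -mulr_suml law_sum1// mul1r.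
rewrite /entropy -sumrN.
apply: ler_sum => k _; have := law_ge0 rho f k; rewrite le_eqVlt => /predU1P[<-|l0].
  by rewrite !mul0r oppr0.
rewrite -mulrN ler_wpM2l ?law_ge0// -lnV ?posrE// ler_ln ?posrE ?invr_gt0//.
by rewrite -[leLHS]invrK lef_pV2 ?posrE ?invr_gt0.
Qed.

Variable T : X -> X.
Hypothesis mT : forall A : set borelX, measurable A -> measurable (T @^-1` A : set borelX).

(* Peeling off one letter at a time costs a conditional entropy of [nu j], which
   Gibbs' inequality bounds by the cross entropy against the conditional weights
   of the average [rho].  The cross entropy is affine in the measure, so these
   costs average exactly, and no concavity of the entropy is needed. *)
Lemma misiurewicz (nu : nat -> prob) rho (m n q : nat) (l : X -> 'I_m) :
  mlabel l -> (0 < n)%N ->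
  (forall j (A : set borelX), measurable A -> nu j.+1 A = nu j (T @^-1` A)) ->
  (forall A : set borelX, measurable A ->
    fine (rho A) = n%:R^-1 * \sum_(j < n) fine (nu j A)) ->
  entropy (nu 0%N) (itin T l (n + q)) <=
  n%:R * (entropy rho (fun x => (l x, itin T l q (T x))) - entropy rho (itin T l q \o T)) +
  q%:R * ln m%:R.
Proof.
move=> ml n0 nuT rhoE; have m0 : (0 < m)%N by case: (l point) => k; case: m {l ml}.
have n0R : 0 < n%:R :> R by rewrite ltr0n.
pose f x := (l x, itin T l q (T x)).
have mq : mlabel (itin T l q \o T) by exact: (mlabel_compT mT (mlabel_itin mT ml (n:=q))).
have mf : mlabel f by exact: mlabel_pair.
pose kap x : R := ln (law rho f x / law rho (itin T l q \o T) x.2).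
pose cross j := - \sum_x law (nu j) f x * kap x.
have rho_law x : law rho f x = n%:R^-1 * \sum_(j < n) law (nu j) f x.
  by rewrite /law rhoE//; exact: mf.
have pos j x : (j < n)%N -> 0 < law (nu j) f x -> 0 < law rho f x.
  move=> jn lj; rewrite rho_law mulr_gt0 ?invr_gt0// (bigD1 (Ordinal jn))//=.
  by apply: ltr_pwDl => //; apply: sumr_ge0 => *; exact: law_ge0.
have entT j k : entropy (nu j) (itin T l k \o T) = entropy (nu j.+1) (itin T l k).
  rewrite /entropy; congr (- _); apply: eq_bigr => w _.
  have -> : law (nu j) (itin T l k \o T) w = law (nu j.+1) (itin T l k) w.
    rewrite /law nuT//; exact: (mlabel_itin mT ml).
  by [].
(* Words of length [n + q] keep [q] letters to condition on at each of the [n] removals; the last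
   [q] letters cost at most [q * ln m]. *)
have step i : (i <= n)%N -> entropy (nu 0%N) (itin T l (n + q)) <=
    \sum_(j < i) cross j + entropy (nu i) (itin T l (n - i + q)).
  elim: i => [_|i ih iN]; first by rewrite big_ord0 add0r subn0.
  apply: (le_trans (ih (ltnW iN))); rewrite big_ord_recr/= -addrA lerD2l.
  have -> : (n - i + q = (n - i.+1 + q).+1)%N by rewrite -addSn subnSK.
  have := @entropy_itin_step _ _ T mT m l ml (nu i) rho q (n - i.+1 + q) (leq_addl _ _).
  rewrite -/f entT => /(_ (fun x => @pos i x iN)).
  by rewrite addrC.
apply: (le_trans (step n (leqnn n))); rewrite subnn add0n lerD//; last first.
  apply: (le_trans (entropy_le_ln _ (mlabel_itin mT ml (n:=q)))).
  by rewrite card_ffun !card_ord natrX lnXn ?ltr0n// mulr_natl.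
rewrite -(@entropy_condE _ _ rho _ _ l (itin T l q \o T) ml mq) -/f.
rewrite sumrN mulrN lerN2 exchange_big/= mulr_sumr.
rewrite le_eqVlt; apply/orP; left; apply/eqP; apply: eq_bigr => x _.
by rewrite -mulr_suml -/(kap x) mulrA rho_law mulVKf ?gt_eqF.
Qed.

End Misiurewicz.

(** * Separated sets and their orbit averages *)

Section UpperBound.
Context {R : realType} {X : pmetricType R}.
Notation borelX := (@borel R X).
Notation prob := (@borel_probability R X).
Implicit Types (mu rho : prob).
Variables (T : X -> X) (d : nat) (Phi : 'I_d -> X -> R) (F : 'rV[R]_d -> R).
Hypothesis cX : compact [set: X].
Hypothesis cT : continuous T.
Hypothesis cPhi : forall i, continuous (Phi i).
Hypothesis cF : continuous F.
Let mT := continuous_borel cT.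

Let av n x : 'rV[R]_d := \row_i (birkhoff_sum T n (Phi i) x / n%:R).

(** The sum over a separated set is a supremum over its finite subsets, which are separated as
    well. *)
Lemma finite_separated_gt (e c : R) N : (c%:E < pressure_at T Phi F e)%E ->
  exists n (s : seq X), [/\ (N < n)%N, uniq s, dn_separated T n e [set` s] &
    expR (n%:R * c) < \sum_(x <- s) expR (n%:R * F (av n x))].
Proof.
move=> /limn_esup_gt/(_ N.+1)[n Nn]; set S := ereal_sup _ => cS.
have n0 : 0 < n%:R :> R by rewrite ltr0n (leq_trans _ Nn).
have [E sE Egt] : exists2 E, dn_separated T n e E &
    ((expR (n%:R * c))%:E < separated_sum T Phi F n E)%E.
  apply: contrapT => no; have : (S <= (expR (n%:R * c))%:E)%E.
    apply: ge_ereal_sup => _ [E sE <-]; rewrite leNgt; apply/negP => Egt.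
    by apply: no; exists E.
  move=> /(lne_le (separated_sup_ge0 T Phi F n e)).
  rewrite lne_EFin ?expR_gt0// expRK => SE.
  move: cS; apply/negP; rewrite -leNgt.
  have -> : c%:E = ((n%:R^-1)%:E * (n%:R * c)%:E)%E by rewrite -EFinM mulKf// gt_eqF.
  by apply: lee_wpmul2l => //; rewrite lee_fin invr_ge0 ltW.
have [_ [A [/finite_seqP[t tA] AE] <-]] := ereal_sup_gt Egt.
have AE' : A = [set` undup t] by rewrite tA; apply/seteqP; split => x /=; rewrite mem_undup.
rewrite AE' -fsbig_seq ?undup_uniq// sumEFin lte_fin => As.
exists n, (undup t); split => //; first exact: undup_uniq.
by move=> x y; rewrite -AE' => Ax Ay; apply: sE; exact: AE.
Qed.

Lemma cell_code (C r : R) : 0 < r -> exists (J : finType) (code : 'rV[R]_d -> J),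
  forall u v : 'rV[R]_d, (forall i, `|u 0 i| <= C) -> (forall i, `|v 0 i| <= C) ->
    code u = code v -> forall i, `|u 0 i - v 0 i| <= r.
Proof.
move=> r0; pose B := Num.truncn (2 * C / r).
pose t (x : R) := Num.truncn ((x + C) / r).
exists {ffun 'I_d -> 'I_B.+1}, (fun u : 'rV[R]_d => [ffun i => inord (t (u 0 i))]).
move=> u v uC vC /ffunP uv i; have := congr1 val (uv i); rewrite !ffunE /=.
have tB (x : R) : `|x| <= C -> (t x < B.+1)%N.
  move=> xC; rewrite ltnS; apply: le_truncn; rewrite ler_pM2r ?invr_gt0//.
  by have := le_trans (ler_norm x) xC; lra.
rewrite !inordK ?tB// => tE.
have tP (x : R) : `|x| <= C -> (t x)%:R * r <= x + C < (t x).+1%:R * r.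
  move=> xC; have x0 : 0 <= (x + C) / r.
    by rewrite divr_ge0 ?(ltW r0)//; move: xC; rewrite ler_norml => /andP[? _]; lra.
  by have := truncn_itv x0; rewrite -/(t x) ler_pdivlMr// ltr_pdivrMr.
have := tP _ (uC i); have := tP _ (vC i); rewrite tE -natr1 mulrDl mul1r.
by move=> /andP[? ?] /andP[? ?]; rewrite ler_norml; apply/andP; split; lra.
Qed.

Lemma pigeonhole (I : Type) (J : finType) (code : I -> J) (j0 : J) (s : seq I) (w : I -> R) :
  exists j, \sum_(x <- s) w x <= #|J|%:R * \sum_(x <- s | code x == j) w x.
Proof.
apply: contrapT => /forallNP no.
have : \sum_j (#|J|%:R * \sum_(x <- s | code x == j) w x) < \sum_(j : J) \sum_(x <- s) w x.
  apply: ltr_sum; first by apply/hasP; exists j0; rewrite ?mem_index_enum.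
  by move=> j _; rewrite ltNge; apply/negP; exact: no.
have -> : \sum_(x <- s) w x = \sum_j \sum_(x <- s | code x == j) w x.
  by rewrite (partition_big code xpredT).
by rewrite -mulr_sumr sumr_const -[ltRHS]mulr_natl ltxx.
Qed.

(** On the heaviest cell all averages are within [r] of their mean [v], so each weight is at most
    [exp (n * (F v + del))] and many points are needed. The loss [J] is the logarithm of the number
    of cells, the same for all [n]. *)
Lemma separated_data (e c del : R) : 0 < del -> (c%:E < pressure_at T Phi F e)%E ->
  exists (J : R), forall N, exists n (s : seq X),
  [/\ (N < n)%N, uniq s, dn_separated T n e [set` s], s != [::] &
   forall v : 'rV[R]_d,
    (forall i, v 0 i = (size s)%:R^-1 * \sum_(x <- s) (birkhoff_sum T n (Phi i) x / n%:R)) ->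
    n%:R * (c - F v - 2 * del) - J <= ln (size s)%:R].
Proof.
move=> del0 ce.
have [C1 C1P] := family_bounded cX cPhi.
have [r r0 rF] := rV_uniform C1 cF del0.
have [J [code codeP]] := cell_code C1 r0.
exists (ln #|J|%:R) => N.
have [n [s [Nn us ss sgt]]] := finite_separated_gt N ce.
have n0 : (0 < n)%N by rewrite (leq_trans _ Nn).
have n0R : 0 < n%:R :> R by rewrite ltr0n.
have avC x i : `|av n x 0 i| <= C1 by rewrite mxE birkhoff_average_le.
have [j jP] := pigeonhole (fun x => code (av n x)) (code (av n point)) s
  (fun x => expR (n%:R * F (av n x))).
pose s' := [seq x <- s | code (av n x) == j].
have J0 : 0 < #|J|%:R :> R by rewrite ltr0n; apply/card_gt0P; exists j.
have s'0 : s' != [::].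
  apply/eqP => s'0; move: jP; rewrite -[X in _ * X]big_filter -/s' s'0 big_nil mulr0.
  by apply/negP; rewrite -ltNge (lt_trans _ sgt)// expR_gt0.
have size0 : 0 < (size s')%:R :> R by rewrite ltr0n lt0n size_eq0.
exists n, s'; split => //.
- exact: filter_uniq.
- by move=> x y /=; rewrite !mem_filter => /andP[_ xs] /andP[_ ys]; exact: ss.
move=> v vE.
have sumc (a : R) : \sum_(y <- s') a = (size s')%:R * a.
  by rewrite big_const_seq count_predT iter_addr_0 mulr_natl.
have vclose x : x \in s' -> forall i, `|av n x 0 i - v 0 i| <= r.
  rewrite mem_filter => /andP[/eqP xj xs] i.
  have -> : v 0 i = (size s')%:R^-1 * \sum_(y <- s') av n y 0 i.
    by rewrite vE; congr (_ * _); apply: eq_bigr => y _; rewrite mxE.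
  have -> : av n x 0 i = (size s')%:R^-1 * \sum_(y <- s') av n x 0 i.
    by rewrite sumc mulKf// gt_eqF.
  rewrite -mulrBr -sumrB normrM ger0_norm ?invr_ge0 ?(ltW size0)// ler_pdivrMl//.
  rewrite (le_trans (ler_norm_sum _ _ _))//.
  apply: (@le_trans _ _ (\sum_(y <- s') r)); last by rewrite sumc.
  rewrite big_seq [leRHS]big_seq; apply: ler_sum => y; rewrite mem_filter => /andP[/eqP yj ys].
  by apply: codeP => //; rewrite xj yj.
have Fle x : x \in s' -> F (av n x) <= F v + del.
  move=> xs; have := rF (av n x) v (avC x) (vclose x xs).
  by rewrite ler_norml => /andP[_ ?]; lra.
have : expR (n%:R * c) < #|J|%:R * ((size s')%:R * expR (n%:R * (F v + del))).
  apply: (lt_le_trans sgt); apply: (le_trans jP).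
  rewrite ler_pM2l// -[leLHS]big_filter -/s'.
  apply: (@le_trans _ _ (\sum_(x <- s') expR (n%:R * (F v + del)))); last by rewrite sumc.
  rewrite big_seq [leRHS]big_seq; apply: ler_sum => x xs.
  by rewrite ler_expR ler_pM2l// Fle.
rewrite -ltr_ln ?posrE ?mulr_gt0 ?expR_gt0//.
rewrite !lnM ?posrE ?mulr_gt0 ?expR_gt0// !expRK => h.
have := mulr_gt0 n0R del0; lra.
Qed.

(** [nu j] is the uniform measure on the [k] points moved [j] steps, counted with multiplicity since
    orbits may merge; [rho] averages these over time. *)
Lemma empirical (x : nat -> X) (k n : nat) : (0 < k)%N -> (0 < n)%N ->
  exists (nu : nat -> prob) (rho : prob),
  [/\ forall A : set borelX, measurable A ->
        fine (nu 0%N A) = k%:R^-1 * \sum_(i < k) \1_A (x i),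
      forall j (A : set borelX), measurable A -> nu j.+1 A = nu j (T @^-1` A),
      forall A : set borelX, measurable A ->
        fine (rho A) = n%:R^-1 * \sum_(j < n) fine (nu j A) &
      forall f, bmeas f -> \int[rho]_y f y =
        k%:R^-1 * \sum_(i < k) (birkhoff_sum T n f (x i) / n%:R)].
Proof.
case: k => // k _; case: n => // n _.
have /choice[D DP] : forall y : X, exists rho : prob,
  (forall A : set borelX, measurable A -> fine (rho A) = \1_A y) /\
  (forall f, bmeas f -> \int[rho]_z f z = f y) by exact: dirac_prob.
have /choice[nu nuP] : forall j, exists rho : prob,
  (forall A : set borelX, measurable A ->
     fine (rho A) = k.+1%:R^-1 * \sum_(i < k.+1) \1_A (iter j T (x i))) /\
  (forall f, bmeas f ->
     \int[rho]_y f y = k.+1%:R^-1 * \sum_(i < k.+1) f (iter j T (x i))).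
  move=> j; have [rho [rho1 rho2]] := average_prob (fun i => D (iter j T (x i))) k.
  exists rho; split=> [A mA|f bf].
    by rewrite rho1//; congr (_ * _); apply: eq_bigr => i _; rewrite (DP _).1.
  by rewrite rho2//; congr (_ * _); apply: eq_bigr => i _; rewrite (DP _).2.
have [rho [rho1 rho2]] := average_prob nu n.
exists nu, rho; split => //.
- by move=> A mA; rewrite (nuP 0%N).1.
- move=> j A mA; have mTA := mT mA.
  rewrite -[LHS]fineK ?fin_num_measure// -[RHS]fineK ?fin_num_measure//.
  by rewrite (nuP _).1// (nuP _).1//; congr (_ * _)%:E.
- move=> f bf; rewrite rho2//.
  under eq_bigr do rewrite (nuP _).2//.
  rewrite -mulr_sumr mulrCA; congr (_ * _); rewrite exchange_big/= mulr_sumr.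
  by apply: eq_bigr => i _; rewrite mulrC.
Qed.

Lemma empirical_almost_invariant (f : X -> R) (M : R) n y :
  (forall z, `|f z| <= M) ->
  `|birkhoff_sum T n (f \o T) y - birkhoff_sum T n f y| <= 2 * M.
Proof.
move=> fM; have -> : birkhoff_sum T n (f \o T) y - birkhoff_sum T n f y =
    f (iter n T y) - f y.
  rewrite /birkhoff_sum -sumrB -(big_mkord xpredT (fun i => (f \o T) (iter i T y) - f (iter i T y))).
  by rewrite (telescope_sumr (fun i => f (iter i T y))).
by rewrite (le_trans (ler_normB _ _))// mulr_natl mulr2n lerD.
Qed.

(** Itineraries through cells of diameter below [e] tell the points of the separated set apart, so
    the entropy of [nu 0] is at least [ln (size s)]. The label is quantified after [rho], because it
    will be adapted to a limit of such measures. *)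
Lemma empirical_ineq (e c del : R) : 0 < del -> 0 < e -> (c%:E < pressure_at T Phi F e)%E ->
  exists (J : R), forall N, exists n (rho : prob), [/\ (N < n)%N,
   forall (f : X -> R) M, bmeas f -> (forall z, `|f z| <= M) ->
     `|\int[rho]_y f (T y) - \int[rho]_y f y| <= 2 * M / n%:R &
   forall m (l : X -> 'I_m) q, mlabel l -> (forall y z, l y = l z -> mdist y z < e) ->
    n%:R * (c - F (integral_vec Phi rho) - 2 * del) - J <=
    n%:R * (entropy rho (fun x => (l x, itin T l q (T x))) - entropy rho (itin T l q \o T)) +
    q%:R * ln m%:R].
Proof.
move=> del0 e0 ce; have [J JP] := separated_data del0 ce; exists J => N.
have [n [s [Nn us ss s0 sP]]] := JP N.
have n0 : (0 < n)%N by rewrite (leq_trans _ Nn).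
have n0R : 0 < n%:R :> R by rewrite ltr0n.
have k0 : (0 < size s)%N by rewrite lt0n size_eq0.
have k0R : 0 < (size s)%:R :> R by rewrite ltr0n.
have [nu [rho [nu0 nuT rhoE rhoI]]] := empirical (nth point s) k0 n0.
exists n, rho; split => //.
- move=> f M bf fM.
  rewrite (rhoI f)// (rhoI (f \o T)); last exact: (bmeas_compT mT bf).
  rewrite -mulrBr -sumrB normrM ger0_norm ?invr_ge0 ?(ltW k0R)// ler_pdivrMl//.
  rewrite (le_trans (ler_norm_sum _ _ _))//.
  apply: (@le_trans _ _ (\sum_(i < size s) 2 * M / n%:R)); last first.
    by rewrite sumr_const card_ord -[leLHS]mulr_natl.
  apply: ler_sum => i _; rewrite -mulrBl normrM normfV [X in _ / X]ger0_norm ?(ltW n0R)//.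
  by rewrite ler_pM2r ?invr_gt0//; exact: empirical_almost_invariant.
move=> m l q ml le.
apply: (@le_trans _ _ (ln (size s)%:R)).
  apply: sP => i; rewrite mxE rhoI; last by exact: continuous_bmeas.
  by rewrite (big_nth point) big_mkord.
apply: le_trans (misiurewicz mT q ml n0 nuT rhoE).
apply: (entropy_uniform_ge (x := nth point s) (n := size s)) => //.
  exact: mlabel_itin.
move=> i j is_ js itinE; apply/eqP; rewrite -(nth_uniq point is_ js us); apply/eqP.
apply: contrapT => ne.
have := ss _ _ (mem_nth point is_) (mem_nth point js) ne; apply/negP; rewrite -leNgt.
apply/bowen_dist_le => [|h hn]; first exact: ltW.
apply/ltW/le.
have hnq : (h < n + q)%N by rewrite (leq_trans hn)// leq_addr.
by move/ffunP/(_ (Ordinal hnq)) : itinE; rewrite !ffunE.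
Qed.

End UpperBound.

Lemma ultra_fmap (I J : Type) (U : set_system I) (f : I -> J) :
  UltraFilter U -> UltraFilter (f @ U).
Proof.
move=> UU; split; first exact: fmap_proper_filter.
move=> G PG UG; apply/seteqP; split => // A GA.
have [//|UA] := in_ultra_setVsetC (f @^-1` A) UU.
have GC : G (~` A) by exact: UG.
by have [x []] := filter_ex (filterI GA GC).
Qed.

(** * Existence of equilibrium measures *)

Section Equilibrium.
Context {R : realType} {X : pmetricType R}.
Notation borelX := (@borel R X).
Notation prob := (@borel_probability R X).
Notation wstar := (@weak_star R X).
Implicit Types (mu nu rho : prob).
Variables (T : X -> X) (d : nat) (Phi : 'I_d -> X -> R) (F : 'rV[R]_d -> R).
Hypothesis cX : compact [set: X].
Hypothesis cT : continuous T.
Hypothesis cPhi : forall i, continuous (Phi i).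
Hypothesis cF : continuous F.
Let mT := continuous_borel cT.

Lemma continuous_integral_vec (I : Type) (U : set_system I) (rho : I -> prob) mu :
  Filter U ->
  (forall f : X -> R, continuous f -> \int[rho i]_x f x @[i --> U] --> \int[mu]_x f x) ->
  F (integral_vec Phi (rho i)) @[i --> U] --> F (integral_vec Phi mu).
Proof.
move=> FU h; apply/cvgrPdist_lt => e e0.
have [r r0 rF] := rV_continuous_at (integral_vec Phi mu) cF e0.
have : \forall i \near U, forall j : 'I_d, `|\int[mu]_x Phi j x - \int[rho i]_x Phi j x| < r.
  apply: filter_forall => j.
  by have /cvgrPdist_lt/(_ _ r0) := h _ (@cPhi j).
by apply: filterS => i ir; apply: rF => j; rewrite !mxE; exact: ir.
Qed.

(** The defect [del] covers two uses: [2 * M / n] for orbit averages, and 0 for measures that are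
    already invariant. *)
Lemma limit_invariant (I : Type) (U : set_system I) (rho : I -> prob) mu (del : R -> I -> R) :
  ProperFilter U ->
  (forall f : X -> R, continuous f -> \int[rho i]_x f x @[i --> U] --> \int[mu]_x f x) ->
  (forall M, del M i @[i --> U] --> 0) ->
  (forall (f : X -> R) M i, continuous f -> (forall x, `|f x| <= M) ->
    `|\int[rho i]_x f (T x) - \int[rho i]_x f x| <= del M i) ->
  invariant_measures T mu.
Proof.
move=> PU rhomu del0 rhodel; apply: (invariantP mT cX) => f cf.
have [M _ fM] := continuous_bounded cX cf.
have cfT : continuous (f \o T).
  by move=> x; apply: continuous_comp; [exact: cT|exact: cf].
have h1 : \int[rho i]_x f (T x) - \int[rho i]_x f x @[i --> U] -->
    \int[mu]_x f (T x) - \int[mu]_x f x.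
  by apply: cvgB; [exact: (rhomu _ cfT)|exact: rhomu].
have h0 : \int[rho i]_x f (T x) - \int[rho i]_x f x @[i --> U] --> (0 : R).
  apply: norm_cvg0; apply: (squeeze_cvgr (f := fun=> 0) (h := del M)) => //.
  - by apply: filterE => i; rewrite normr_ge0/=; exact: rhodel.
  - exact: cvg_cst.
by apply/eqP; rewrite -subr_eq0; apply/eqP; exact: (cvg_unique _ h1 h0).
Qed.

(** Surjectivity of [l] makes the cells nonempty, as a partition demands; a bound valid for every
    increment passes to their limit. *)
Lemma KS_entropy_ge mu m (l : X -> 'I_m) (h : R) : invariant_measures T mu -> mlabel l ->
  (forall i, exists x, l x = i) -> (forall q, h <= entropy_incr T l mu q) ->
  (h%:E <= KS_entropy T mu)%E.
Proof.
move=> imu ml surj hq; pose P (i : 'I_m) : set borelX := l @^-1` [set i].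
apply: (@le_trans _ _ (partition_entropy T mu P)%:E).
  rewrite lee_fin (partition_entropyE mT imu ml (fun=> erefl)).
  apply: limr_ge; first exact: cvg_entropy_incr.
  by apply: nearW.
apply: ereal_sup_ubound; exists m, P; split => //; split; last exact: ml.
split.
- by apply/seteqP; split => // x _; exists (l x).
- by move=> i j _ _ [x [/= <- <-]].
- by move=> i _; have [x xi] := surj i; exists x.
Qed.

Lemma invariant_ge (c del : R) : 0 < del -> (c%:E < nonlinear_pressure T Phi F)%E ->
  exists mu, invariant_measures T mu /\
    ((c - 2 * del)%:E <= KS_entropy T mu + (F (integral_vec Phi mu))%:E)%E.
Proof.
move=> del0; rewrite nonlinear_pressureE => /ereal_sup_gt[_ [e e1 <-] ce].
have e0 : 0 < e by move: e1; rewrite /= in_itv/= andbT.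
have [J /choice[n /choice[rho H]]] := empirical_ineq cX cT cPhi cF del0 e0 ce.
have [U [UU oU]] := @ultraFilterLemma _ (\oo : set_system nat) _.
have [mu [_ Umu]] : setT `&` [set p : wstar | (rho : nat -> wstar) @ U --> p] !=set0.
  have := @weak_star_compact R X cX; rewrite compact_ultra.
  move=> /(_ ((rho : nat -> wstar) @ U) (ultra_fmap _ UU)); apply.
  exact: filterT.
have rhomu f : continuous f -> \int[rho i]_x f x @[i --> U] --> \int[mu]_x f x.
  move=> cf; exact: (cvg_comp _ _ Umu (@weak_star_integral_continuous _ _ f cf mu)).
have ninv : (n i)%:R^-1 @[i --> U] --> (0 : R).
  suff : (n i)%:R^-1 @[i --> \oo] --> (0 : R) by move=> n0 A /n0; exact: oU.
  apply: (squeeze_cvgr (f := fun=> 0) (h := harmonic)) => //.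
  - apply: nearW => i; rewrite invr_ge0 ler0n/= lef_pV2 ?posrE ?ltr0n//.
      by rewrite ler_nat; have [] := H i.
    by have [Ni _ _] := H i; rewrite (leq_trans _ Ni).
  - exact: cvg_cst.
  - exact: cvg_harmonic.
have imu : invariant_measures T mu.
  apply: (@limit_invariant _ U rho mu (fun M i => 2 * M / (n i)%:R)) => //.
    by move=> M; rewrite -[0](mulr0 (2 * M)); apply: cvgM => //; exact: cvg_cst.
  by move=> f M i cf fM; have [_ + _] := H i; apply => //; exact: continuous_bmeas.
exists mu; split => //.
(* Null boundaries for the limit [mu] make the masses of all words converge along [U]. *)
have [m [l [ml jl surj lmdist]]] := jordan_label cX mu e0.
have jitin q (w : {ffun 'I_q -> 'I_m}) : jordan mu (itin T l q @^-1` [set w]).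
  have -> : itin T l q @^-1` [set w] = [set x | forall k : 'I_q, l (iter k T x) = w k].
    apply/seteqP; split => x /=.
      by move=> <- k; rewrite ffunE.
    by move=> h; apply/ffunP => k; rewrite ffunE.
  apply: (@jordan_forall _ _ cX mu _ (fun k : 'I_q => [set x | l (iter k T x) = w k])) => k.
  elim: (k : nat) => [|j ih]; first exact: jl.
  have -> : [set x | l (iter j.+1 T x) = w k] = T @^-1` [set x | l (iter j T x) = w k].
    by apply/seteqP; split => x /=; rewrite -iterSr.
  exact: jordan_preimage.
pose P1 q x := (l x, itin T l q (T x)).
have mitin q : mlabel (itin T l q) by exact: mlabel_itin.
have mP q : mlabel (P1 q).
  apply: mlabel_pair => //; exact: (mlabel_compT mT (mitin q)).
have cvg1 q : entropy (rho i) (P1 q) @[i --> U] --> entropy mu (itin T l q.+1).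
  rewrite (entropy_itinS mT ml); apply: entropy_cvg => -[a w].
  apply: (jordan_cvg cX) => //; first exact: mP.
  have -> : P1 q @^-1` [set (a, w)] = l @^-1` [set a] `&` T @^-1` (itin T l q @^-1` [set w]).
    by apply/seteqP; rewrite /P1; split => [x [<- <-]|x /= [-> ->]].
  by apply: jordan_setI => //; exact: jordan_preimage.
have cvg2 q : entropy (rho i) (itin T l q \o T) @[i --> U] --> entropy mu (itin T l q).
  rewrite -(entropy_itinT mT ml q imu); apply: entropy_cvg => w.
  apply: (jordan_cvg cX) => //; first exact: (mlabel_compT mT (mitin q)).
  exact: (jordan_preimage cX cT imu (jitin q w)).
rewrite -leeBlDr// -EFinB; apply: (KS_entropy_ge imu ml surj) => q.
have cF' := continuous_integral_vec _ rhomu.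
(* For fixed [q] the counting inequality is divided by [n i]; the terms in [J] and [q * ln m] vanish
   along [U], leaving the increment of [mu] at [q]. *)
apply: (@ler_cvg_to _ U _ R
  (fun i => c - F (integral_vec Phi (rho i)) - 2 * del - J / (n i)%:R)
  (fun i => entropy (rho i) (P1 q) - entropy (rho i) (itin T l q \o T) +
            q%:R * ln m%:R / (n i)%:R)).
- have -> : c - 2 * del - F (integral_vec Phi mu) =
            c - F (integral_vec Phi mu) - 2 * del - J * 0 by lra.
  apply: cvgB; last by apply: cvgM => //; exact: cvg_cst.
  by apply: cvgB; [apply: cvgB; [exact: cvg_cst|exact: cF']|exact: cvg_cst].
- rewrite -[entropy_incr T l mu q]addr0 -[0](mulr0 (q%:R * ln m%:R)).
  by apply: cvgD; [exact: cvgB|apply: cvgM => //; exact: cvg_cst].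
- apply: nearW => i; have [Ni _ /(_ m l q ml lmdist)] := H i.
  have n0 : 0 < (n i)%:R :> R by rewrite ltr0n (leq_trans _ Ni).
  have n1 : (n i)%:R != 0 :> R by rewrite gt_eqF.
  have nE (a b : R) : (n i)%:R * (a + b / (n i)%:R) = (n i)%:R * a + b.
    by rewrite mulrDr mulrCA mulfV// mulr1.
  by rewrite -/(P1 q) -(ler_pM2l n0 (_ - J / _)) -[- (J / _)]mulNr !nE.
Qed.

End Equilibrium.

Lemma ereal_between (R : realType) (x y : \bar R) : (x < y)%E ->
  exists r : R, (x < r%:E)%E /\ (r%:E < y)%E.
Proof.
case: x y => [x| |] [y| |] //.
- rewrite lte_fin => xy; exists ((x + y) / 2); rewrite !lte_fin.
  by split; lra.
- by move=> _; exists (x + 1); rewrite lte_fin ltrDl ltry.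
- by move=> _; exists (y - 1); rewrite ltNyr lte_fin ltrBlDr ltrDl.
- by move=> _; exists 0; rewrite ltNyr ltry.
Qed.

(** * Attaining the pressure *)

Section Existence.
Context {R : realType} {X : pmetricType R}.
Notation prob := (@borel_probability R X).
Notation wstar := (@weak_star R X).
Implicit Types (mu nu rho : prob).
Variables (T : X -> X) (d : nat) (Phi : 'I_d -> X -> R) (F : 'rV[R]_d -> R).
Hypothesis cX : compact [set: X].
Hypothesis cT : continuous T.
Hypothesis cPhi : forall i, continuous (Phi i).
Hypothesis cF : continuous F.

Lemma entropy_plus_le_pressure mu :
  abundance_of_ergodic_measures T Phi \/ convex_function [set: 'rV[R]_d] F ->
  invariant_measures T mu ->
  (KS_entropy T mu + (F (integral_vec Phi mu))%:E <= nonlinear_pressure T Phi F)%E.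
Proof.
move=> [ab|convF] imu; last first.
  by apply: (pressure_ge cX cT cPhi imu); exact: convex_subaverage.
apply/lee_addgt0Pr => e e0; have e20 : 0 < e / 2 by rewrite divr_gt0.
have [r r0 rF] := rV_continuous_at (integral_vec Phi mu) cF e20.
have er0 : 0 < Num.min (e / 2) r by rewrite lt_min e20.
have [nu [ergnu KSnu intnu]] := ab mu imu _ er0.
have Fnu : F (integral_vec Phi mu) <= F (integral_vec Phi nu) + e / 2.
  have : `|F (integral_vec Phi mu) - F (integral_vec Phi nu)| < e / 2.
    by apply: rF => i; rewrite !mxE distrC (lt_le_trans (intnu i))// ge_min lexx orbT.
  by rewrite ltr_norml => /andP[_ ?]; lra.
have [inu _] := ergnu.
have := pressure_ge cX cT cPhi inu (ergodic_subaverage cX cT cPhi cF ergnu).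
move=> /(leeD2r e%:E); apply: le_trans.
have -> : (KS_entropy T nu + (F (integral_vec Phi nu))%:E + e%:E =
  KS_entropy T nu + (e / 2)%:E + (F (integral_vec Phi nu) + e / 2)%:E)%E.
  by rewrite -!addeA -!EFinD; congr (_ + _%:E)%E; lra.
apply: leeD; last by rewrite lee_fin.
rewrite -leeBlDr//; apply: le_trans KSnu; apply: leeB => //.
by rewrite lee_fin ge_min lexx.
Qed.

(** A single orbit already gives the bound [- M]. It provides real numbers below the pressure, on
    which the limit in [equilibrium_exists] is based. *)
Lemma nonlinear_pressure_gtNy : (-oo < nonlinear_pressure T Phi F)%E.
Proof.
have [C CP] := family_bounded cX cPhi.
have [M _ FM] := rV_bounded C cF.
apply: (@lt_le_trans _ _ (- M)%:E); first exact: ltNyr.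
rewrite nonlinear_pressureE; apply: (@le_trans _ _ (pressure_at T Phi F 1)); last first.
  by apply: ereal_sup_ubound; exists 1 => //=; rewrite in_itv/= ltr01.
apply: pressure_at_ge; near=> n; exists [:: point].
  by split => // x y /=; rewrite !inE => /eqP-> /eqP->.
rewrite big_seq1 expRK ler_wpM2l//.
have : `|F (\row_i (birkhoff_sum T n (Phi i) point / n%:R))| <= M.
  by apply: FM => i; rewrite mxE birkhoff_average_le//; near: n; exists 1%N.
by rewrite ler_norml => /andP[].
Unshelve. all: by end_near. Qed.

Lemma equilibrium_exists :
  upper_semicontinuous
    (KS_entropy T : subspace (invariant_measures T) -> \bar R) ->
  exists nu, invariant_measures T nu /\
    (nonlinear_pressure T Phi F <= KS_entropy T nu + (F (integral_vec Phi nu))%:E)%E.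
Proof.
move=> usc; set P := nonlinear_pressure T Phi F.
have gap (a : R) : (a%:E < P)%E -> exists mu, invariant_measures T mu /\
    (a%:E <= KS_entropy T mu + (F (integral_vec Phi mu))%:E)%E.
  move=> /ereal_between[c [ac cP]]; have del0 : 0 < (c - a) / 2 by rewrite divr_gt0// subr_gt0 -lte_fin.
  have [mu [imu muc]] := invariant_ge cX cT cPhi cF del0 cP.
  by exists mu; split => //; have -> : a = c - 2 * ((c - a) / 2) by lra.
have [a0 [_ a0P]] := ereal_between nonlinear_pressure_gtNy.
have /choice[rho rhoP] : forall a, exists mu, invariant_measures T mu /\
    ((a%:E < P)%E -> (a%:E <= KS_entropy T mu + (F (integral_vec Phi mu))%:E)%E).
  move=> a; have [/gap[mu [? ?]]|aP] := pselect (a%:E < P)%E; first by exists mu.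
  by have [mu [imu _]] := gap _ a0P; exists mu.
(* The filter of reals tending to [P] from below, meaningful also if [P] is infinite. *)
pose G := filter_from [set a : R | (a%:E < P)%E] (fun a => [set b | a <= b /\ (b%:E < P)%E]).
have PG : ProperFilter G.
  apply: filter_from_proper; last by move=> a aP; exists a.
  apply: filter_from_filter; first by exists a0.
  move=> a b aP bP; exists (Num.max a b) => /=; first by rewrite /Num.max; case: ifP.
  by move=> c []; rewrite ge_max => /andP[? ?] ?.
have [U [UU GU]] := ultraFilterLemma PG.
have [nu [_ Unu]] : setT `&` [set p : wstar | (rho : R -> wstar) @ U --> p] !=set0.
  have := @weak_star_compact R X cX; rewrite compact_ultra.
  move=> /(_ ((rho : R -> wstar) @ U) (ultra_fmap _ UU)); apply.
  exact: filterT.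
have rhonu f : continuous f -> \int[rho i]_x f x @[i --> U] --> \int[nu]_x f x.
  move=> cf; exact: (cvg_comp _ _ Unu (@weak_star_integral_continuous _ _ f cf nu)).
have inu : invariant_measures T nu.
  apply: (@limit_invariant _ _ T cX cT _ U rho nu (fun _ _ => 0)) => //.
    by move=> M; exact: cvg_cst.
  move=> f M a cf fM; have [irho _] := rhoP a.
  rewrite (integral_invariant (continuous_borel cT) irho) ?subrr ?normr0//.
  exact: continuous_bmeas.
exists nu; split => //; rewrite leNgt; apply/negP.
(* Two real numbers fit in the supposed gap: [k] above the entropy of [nu], for semicontinuity, and
   [a] between [k + F (integral_vec Phi nu)] and [P], leaving room for the variation of [F]. *)
rewrite -lteBrDr// => /ereal_between[k [KSk]]; rewrite lteBrDr// -EFinD => /ereal_between[a [ka aP]].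
have [|V nuV VP] := usc nu (- k); first by rewrite EFinN lteN2.
have UV : \forall b \near U, (KS_entropy T (rho b) < k%:E)%E.
  (* Semicontinuity holds in the subspace of invariant measures, so [V] is a neighbourhood only
     within it; every [rho b] is invariant. *)
  have /Unu UV : within (invariant_measures T) (nbhs (nu : wstar)) V.
    by rewrite nbhs_subspace_in.
  have {}UV : \forall b \near U, invariant_measures T (rho b) -> V (rho b) := UV.
  apply: filterS UV => b /(_ (rhoP b).1)/VP.
  by rewrite EFinN lteN2.
have e0 : 0 < a - (k + F (integral_vec Phi nu)) by rewrite subr_gt0 -lte_fin.
have UF : \forall b \near U, `|F (integral_vec Phi nu) - F (integral_vec Phi (rho b))| <
    a - (k + F (integral_vec Phi nu)).
  have cFnu : F (integral_vec Phi (rho b)) @[b --> U] --> F (integral_vec Phi nu).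
    exact: continuous_integral_vec.
  by move: cFnu => /cvgrPdist_lt/(_ _ e0).
have Ua : \forall b \near U, a <= b /\ (b%:E < P)%E by apply: GU; exists a.
have [b [Kb [Fb [ab bP]]]] := filter_ex (filterI UV (filterI UF Ua)).
have := (rhoP b).2 bP; apply/negP; rewrite -ltNge.
apply: (@lt_le_trans _ _ (k%:E + (F (integral_vec Phi (rho b)))%:E)%E).
  by rewrite lteD2rE.
by rewrite -EFinD lee_fin; move: Fb; rewrite ltr_norml => /andP[? ?]; lra.
Qed.

End Existence.

Theorem theorem5 (R : realType) (X : pmetricType R) (T : X -> X)
    (d : nat) (Phi : 'I_d -> X -> R) (F : 'rV[R]_d -> R) :
  compact [set: X] ->
  continuous T ->
  upper_semicontinuous
    (KS_entropy T : subspace (invariant_measures T) -> \bar R) ->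
  (forall i, continuous (Phi i)) ->
  continuous F ->
  abundance_of_ergodic_measures T Phi \/ convex_function [set: 'rV[R]_d] F ->
  exists nu, equilibrium_measure T Phi F nu.
Proof.
move=> cX cT usc cPhi cF hyp.
have [nu [inu Ple]] := equilibrium_exists cX cT cPhi cF usc.
exists nu; split => //; apply: le_anti; rewrite Ple/=.
exact: entropy_plus_le_pressure.
Qed.
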